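(* Let $C \subset \mathbb{P}^2$ be a smooth plane curve of degree $d \ge 4$ over $K$, and let $n \ge 3$ be an integer. Then $\delta[n] \in \{0, 1, 4\}$. Furthermore, $\delta[n]=4$ only if $n=3$ and $d=6m+4$ for some integer $m \ge 0$.
   Context: $K$ is an algebraically closed field of characteristic zero. For a point $P \in \mathbb{P}^2$, $\pi_P : C \dashrightarrow \mathbb{P}^1$ denotes the projection from $P$, $Q \mapsto \overline{PQ}$, and $G[P]$ denotes the group of all birational transformations $\sigma$ of $C$ preserving the fibers of $\pi_P$ (i.e. $\pi_P\circ\sigma=\pi_P$). A point $P$ is called quasi-Galois if $|G[P]| \ge 2$. $\delta[n]$ denotes the number of quasi-Galois points $P \in C$ with $|G[P]|=n$. *)

(* Defs.v *)
From mathcomp Require Import all_boot all_order all_algebra.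
From mathcomp Require Import mpoly.

Set Implicit Arguments.
Unset Strict Implicit.
Unset Printing Implicit Defensive.

Import GRing.Theory.
Local Open Scope ring_scope.

(* A point of P^2 is a line through the origin of K^3, so that equality of
   points is Leibniz equality. *)
Definition point (K : fieldType) : Type :=
  {U : {vspace 'rV[K]_3} | \dim U == 1%N}.

(* [v] is the vector of homogeneous coordinates of a point of {F = 0}. *)
Definition on_curve (K : fieldType) (F : {mpoly K[3]}) (v : 'rV[K]_3) : Prop :=
  v != 0 /\ F.@[v ord0] = 0.

Definition point_on_curve (K : fieldType) (F : {mpoly K[3]}) (P : point K) :
    Prop :=
  forall v : 'rV[K]_3, v \in sval P -> v != 0 -> on_curve F v.

(* The polynomial 0 is d-homogeneous in the library; it is excluded here by the
   nonvanishing of the gradient. *)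
Definition smooth_plane_curve (K : fieldType) (d : nat) (F : {mpoly K[3]}) :
    Prop :=
  F \is d.-homog /\
  forall v : 'rV[K]_3, on_curve F v ->
    exists i : 'I_3, (F^`M(i)).@[v ord0] != 0.

Definition eval3 (K : fieldType) (A : 'I_3 -> {mpoly K[3]}) (v : 'rV[K]_3) :
    'rV[K]_3 :=
  \row_i (A i).@[v ord0].

(* Representatives (A_0 : A_1 : A_2) of rational maps from {F = 0} to itself:
   forms of the same degree that do not all vanish identically on the curve.
   A representative is defined at the points where some A_i is nonzero. *)
Record ratmap (K : fieldType) (F : {mpoly K[3]}) := RatMap {
  rm_deg : nat;
  rm_form : 'I_3 -> {mpoly K[3]};
  rm_homog : forall i, rm_form i \is rm_deg.-homog;
  rm_dom : exists v, on_curve F v /\ eval3 rm_form v != 0;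
  rm_img : forall v, on_curve F v -> eval3 rm_form v != 0 ->
             on_curve F (eval3 rm_form v)
}.

Definition rm_eval (K : fieldType) (F : {mpoly K[3]}) (s : ratmap F)
    (v : 'rV[K]_3) : 'rV[K]_3 :=
  eval3 (rm_form s) v.

(* Two representatives define the same rational map when they agree at every
   point where both are defined; on an irreducible curve these points form a
   dense open set. *)
Definition rm_eq (K : fieldType) (F : {mpoly K[3]}) (s t : ratmap F) : Prop :=
  forall v, on_curve F v -> rm_eval s v != 0 -> rm_eval t v != 0 ->
    <[rm_eval s v]>%VS = <[rm_eval t v]>%VS.

(* The composite t o s is defined somewhere and is the identity. *)
Definition rm_comp_id (K : fieldType) (F : {mpoly K[3]}) (t s : ratmap F) :
    Prop :=
  (exists v, [/\ on_curve F v, rm_eval s v != 0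
               & rm_eval t (rm_eval s v) != 0]) /\
  (forall v, on_curve F v -> rm_eval s v != 0 ->
     rm_eval t (rm_eval s v) != 0 ->
     <[rm_eval t (rm_eval s v)]>%VS = <[v]>%VS).

Definition birational (K : fieldType) (F : {mpoly K[3]}) (s : ratmap F) : Prop :=
  exists t : ratmap F, rm_comp_id t s /\ rm_comp_id s t.

(* The projection from P, Q |-> line PQ, a line being a plane of K^3. It is
   meaningful for Q <> P, i.e. for [v] outside [P]. *)
Definition proj_from (K : fieldType) (P : point K) (v : 'rV[K]_3) :
    {vspace 'rV[K]_3} :=
  (sval P + <[v]>)%VS.

Definition preserves_fibers (K : fieldType) (F : {mpoly K[3]}) (P : point K)
    (s : ratmap F) : Prop :=
  forall v, on_curve F v -> v \notin sval P ->
    rm_eval s v != 0 -> rm_eval s v \notin sval P ->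
    proj_from P (rm_eval s v) = proj_from P v.

(* Membership in G[P]; its elements are to be taken up to [rm_eq]. *)
Definition in_G (K : fieldType) (F : {mpoly K[3]}) (P : point K)
    (s : ratmap F) : Prop :=
  birational s /\ preserves_fibers P s.

Definition G_order (K : fieldType) (F : {mpoly K[3]}) (P : point K) (n : nat) :
    Prop :=
  exists s : 'I_n -> ratmap F,
    [/\ forall i, in_G P (s i),
        forall i j, rm_eq (s i) (s j) -> i = j
      & forall t : ratmap F, in_G P t -> exists i, rm_eq t (s i)].

(* |G[P]| >= 2, also meaningful when G[P] is infinite. *)
Definition quasi_galois (K : fieldType) (F : {mpoly K[3]}) (P : point K) :
    Prop :=
  exists s t : ratmap F, [/\ in_G P s, in_G P t & ~ rm_eq s t].

(* delta[n] = k; in particular the set of points counted by delta[n] is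
   finite. *)
Definition delta_eq (K : fieldType) (F : {mpoly K[3]}) (n k : nat) : Prop :=
  exists s : seq (point K),
    [/\ uniq s, size s = k
      & forall P : point K,
          P \in s <->
          [/\ point_on_curve F P, quasi_galois F P & G_order F P n]].

(* Main.v *)
Require Import Defs.
From mathcomp Require Import all_boot all_order all_algebra.
From mathcomp Require Import cyclic separable mpoly ring zify.
From Stdlib Require Import Classical.

(** Let C be the curve F = 0. The proof studies the homologies of the plane that
    preserve C and have their centre on it.

    Elements of G[P] are homologies. Let P = [e]. An element of G[P] moves a
    point v of C along the line through P, so it has the form
    v |-> v + theta(v) e with a rational function theta on C. If x is an
    equation of the tangent at P, the equation F(v + theta e) = 0 shows that
    x theta is integral over the homogeneous coordinate ring of C. A smooth
    plane curve is projectively normal ([coordinate_ring_normal]), so x theta is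
    the restriction of a quadratic form. On the general line through P the map
    permutes the d - 1 further points of C, hence is affine with a root of unity
    as linear part; this forces x theta = x mu with a linear form mu, and the
    map is the restriction of the homology v |-> v + mu(v) e, which preserves F
    ([fibre_map_linear]). The second order expansion of F at e shows that mu is
    determined by the ratio 1 + mu(e), and G[P] becomes the group of all n-th
    roots of unity for some n dividing d - 1 ([G_order_roots]).

    Pairs of points. Fix a primitive n-th root of unity om with n >= 3 and call
    e a centre, with axis f, if the homology of ratio om preserves F, where
    f(e) = 1. The homology at a centre permutes all the centres. Hence the
    finitely many centres on a line joining two of them are invariant under a
    rotation of order n about each of them. Let psi be the binary form with
    these roots. At each root, the rotation makes psi agree to the order n with
    a form l l'^M, on which the fourth transvectant vanishes. The transvectant
    of psi therefore has more zeros than its degree allows and vanishes, and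
    its leading coefficient leaves only the case of n = 3 and four points
    ([configuration_four]). For two centres this also gives the relation
    3 f(e') f'(e) = 1 ([centre_pair]).

    Counting. Applied to three centres and their images, the relation excludes
    noncollinear triples ([centres_collinear]). Two counted points thus give
    exactly four centres, all counted by [centre_acts_roots]. Finally 3 divides
    d - 1, and d is even because a homology at one centre followed by the
    inverse homology at another one acts on the line joining them as a square
    root of - 1 ([pair_even_degree]); hence d = 6 m + 4.

    Normality and irreducibility of C are obtained together, by elementary
    means, from the Jacobian criterion in affine charts: an element of the
    function ring K[X, Y] / (f) that becomes integral after division by N(X) is
    divisible by N ([integral_closed]), and its total degree is controlled by
    a line at infinity transversal to C ([integral_tdeg]). *)

Set Implicit Arguments.
Unset Strict Implicit.
Unset Printing Implicit Defensive.

Import GRing.Theory.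
Local Open Scope ring_scope.

(** * Congruences modulo a principal ideal *)

Section Congruence.
Variables (R : comNzRingType) (f : R).

Definition mult (a : R) : Prop := exists b, a = f * b.
Definition cong (a b : R) : Prop := mult (a - b).

Lemma mult0 : mult 0.
Proof. by exists 0; rewrite mulr0. Qed.

Lemma multD a b : mult a -> mult b -> mult (a + b).
Proof. by move=> [x ->] [y ->]; exists (x + y); rewrite mulrDr. Qed.

Lemma multN a : mult a -> mult (- a).
Proof. by move=> [x ->]; exists (- x); rewrite mulrN. Qed.

Lemma multMl a b : mult b -> mult (a * b).
Proof. by move=> [x ->]; exists (a * x); rewrite mulrCA. Qed.

Lemma mult_self a : mult (f * a).
Proof. by exists a. Qed.

Lemma mult_sum (I : Type) (r : seq I) (P : pred I) (g : I -> R) :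
  (forall i, P i -> mult (g i)) -> mult (\sum_(i <- r | P i) g i).
Proof. by move=> h; elim/big_ind: _ => //; [exact: mult0 | exact: multD]. Qed.

Lemma cong_refl a : cong a a.
Proof. by rewrite /cong subrr; apply: mult0. Qed.

Lemma congD a b a' b' : cong a b -> cong a' b' -> cong (a + a') (b + b').
Proof. by move=> h h'; rewrite /cong opprD addrACA; apply: multD. Qed.

Lemma congM a b a' b' : cong a b -> cong a' b' -> cong (a * a') (b * b').
Proof.
move=> h h'; rewrite /cong.
have -> : a * a' - b * b' = a' * (a - b) + b * (a' - b') by ring.
by apply: multD; apply: multMl.
Qed.

Lemma congX a b n : cong a b -> cong (a ^+ n) (b ^+ n).
Proof.
move=> h; elim: n => [|n IH]; first by rewrite !expr0; apply: cong_refl.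
by rewrite !exprS; apply: congM.
Qed.

Lemma cong_sum (I : Type) (r : seq I) (P : pred I) (g h : I -> R) :
  (forall i, P i -> cong (g i) (h i)) ->
  cong (\sum_(i <- r | P i) g i) (\sum_(i <- r | P i) h i).
Proof.
by move=> H; rewrite /cong -sumrB; apply: mult_sum.
Qed.

Lemma cong_mult a b : cong a b -> mult b -> mult a.
Proof. by move=> h h'; rewrite -(subrK b a); apply: multD. Qed.

Lemma cong_sym a b : cong a b -> cong b a.
Proof. by move=> h; rewrite /cong -opprB; apply: multN. Qed.

End Congruence.

(** The homogenised monic equation of degree m: for c 0 = 1 it vanishes when g
    / x satisfies an integral equation with coefficients c i. *)
Definition int_form (R : comNzRingType) (m : nat) (c : nat -> R) (x g : R) : R :=
  \sum_(i < m.+1) c i * x ^+ i * g ^+ (m - i).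

Lemma int_formM (R : comNzRingType) m (c : nat -> R) (u x g : R) :
  u ^+ m * int_form m c x g = int_form m c (u * x) (u * g).
Proof.
rewrite /int_form big_distrr /=; apply: eq_bigr => i _.
have -> : u ^+ m = u ^+ i * u ^+ (m - i) by rewrite -exprD subnKC // -ltnS.
by rewrite !exprMn; ring.
Qed.

Lemma int_form_scale (R : comNzRingType) m (c : nat -> R) (N x g : R) :
  int_form m c (N * x) g = int_form m (fun i => c i * N ^+ i) x g.
Proof. by apply: eq_bigr => i _; rewrite exprMn !mulrA. Qed.

Lemma int_form_cong (R : comNzRingType) (f : R) m (c : nat -> R) (x x' g g' : R) :
  cong f x x' -> cong f g g' -> cong f (int_form m c x g) (int_form m c x' g').
Proof.
move=> hx hg; apply: cong_sum => i _.
by apply: congM (congM (cong_refl _ _) (congX _ hx)) (congX _ hg).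
Qed.

Lemma int_form0 (R : comNzRingType) m (c : nat -> R) (g : R) :
  int_form m c 0 g = c 0%N * g ^+ m.
Proof.
rewrite /int_form big_ord_recl /= expr0 mulr1 subn0 big1 ?addr0 // => i _.
by rewrite expr0n /= mulr0 mul0r.
Qed.

Lemma rmorph_int_form (R S : comNzRingType) (h : {rmorphism R -> S}) m
    (c : nat -> R) (x g : R) :
  h (int_form m c x g) = int_form m (h \o c) (h x) (h g).
Proof.
by rewrite /int_form rmorph_sum; apply: eq_bigr => i _; rewrite !rmorphM !rmorphXn.
Qed.

(** The local reason for normality. At a point of F = 0 with coordinates x and
    y, the fibre x = 0 has multiplicity e, and G has multiplicity k < e on it.
    Multiplying the integral equation of G / x by U^m, one may replace x U by -
    y^e W; all terms become divisible by y^(k m), and after cancelling this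
    power only the leading term (W2 U)^m survives at the point. *)
Lemma smooth_local_order (R : comNzRingType) (S : idomainType)
    (ev : {rmorphism R -> S}) (F U W G G2 W2 x y : R) (e k m : nat) (c : nat -> R) :
  F = x * U + y ^+ e * W -> G = x * G2 + y ^+ k * W2 -> (k < e)%N ->
  c 0%N = 1 -> mult F (int_form m c x G) ->
  (forall A, mult F (y * A) -> mult F A) ->
  ev y = 0 -> ev F = 0 -> ev (W2 * U) = 0.
Proof.
move=> eF eG lt_ke c0 hint reg evy evF.
pose t := - (y ^+ (e - k) * W); pose V := W2 * U - y ^+ (e - k) * W * G2.
have ye : y ^+ e = y ^+ k * y ^+ (e - k) by rewrite -exprD subnKC // ltnW.
have hx : cong F (U * x) (y ^+ k * t).
  by exists 1; rewrite mulr1 eF /t ye; ring.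
have hG : cong F (U * G) (y ^+ k * V).
  by exists G2; rewrite eF eG /V ye; ring.
have h1 : mult F ((y ^+ k) ^+ m * int_form m c t V).
  rewrite int_formM; apply: cong_mult (int_form_cong m c (cong_sym hx) (cong_sym hG)) _.
  by rewrite -int_formM; apply: multMl.
have {h1} h2 : mult F (int_form m c t V).
  move: h1; rewrite -exprM; elim: (k * m)%N => [|j IH]; first by rewrite expr0 mul1r.
  by rewrite exprS -mulrA => /reg.
have evt : ev t = 0.
  rewrite /t rmorphN rmorphM rmorphXn /= evy expr0n.
  by rewrite -[_ == 0%N]negbK -lt0n subn_gt0 lt_ke mul0r oppr0.
have /eqP : ev V ^+ m = 0.
  case: h2 => B hB; have := congr1 ev hB.
  by rewrite rmorph_int_form evt int_form0 /= c0 rmorph1 mul1r rmorphM evF mul0r.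
rewrite expf_eq0 => /andP[_ /eqP].
have evyk : ev (y ^+ (e - k)) = 0.
  rewrite rmorphXn /= evy expr0n.
  by rewrite -[_ == 0%N]negbK -lt0n subn_gt0 lt_ke.
rewrite /V rmorphB [X in _ - X]rmorphM [X in _ - X * _]rmorphM /= evyk !mul0r subr0.
by [].
Qed.

Section Bivariate.
Variable K : closedFieldType.
Implicit Types (p f g h : {poly {poly K}}) (x y : K).

(** Polynomials in Y over K[X] are functions on the affine plane; [fib x]
    restricts them to the vertical line X = x, and [clift] extends a polynomial
    in Y constantly in X. *)
Definition fib x : {rmorphism {poly {poly K}} -> {poly K}} :=
  map_poly (horner_eval x).
Definition clift : {rmorphism {poly K} -> {poly {poly K}}} := map_poly polyC.
Definition ev2 x y : {rmorphism {poly {poly K}} -> K} :=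
  horner_eval y \o map_poly (horner_eval x).

Arguments fib : simpl never.
Arguments clift : simpl never.
Arguments ev2 : simpl never.

Lemma ev2_fib x y p : ev2 x y p = (fib x p).[y].
Proof. by []. Qed.

Lemma ev2_horner x y p : ev2 x y p = p.[y%:P].[x].
Proof.
rewrite /ev2 /= /horner_eval.
have := horner_map (horner_eval x) p y%:P.
by rewrite /= /horner_eval hornerC.
Qed.

Lemma fib_lift x q : fib x (clift q) = q.
Proof.
apply/polyP => i; rewrite coef_map coef_map /= /horner_eval hornerC //.
Qed.

Lemma fibC x (c : {poly K}) : fib x c%:P = (c.[x])%:P.
Proof. exact: (map_polyC (horner_eval x)). Qed.

Lemma fib_deriv x p : (fib x p)^`() = fib x p^`().
Proof. exact: deriv_map. Qed.

Lemma fib_eq0 x p : fib x p = 0 -> exists q, p = ('X - x%:P)%:P * q.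
Proof.
move=> h; exists (\poly_(i < size p) (p`_i %/ ('X - x%:P))).
apply/polyP => i; rewrite coefCM coef_poly.
case: ltnP => [lt_i|le_i]; last by rewrite mulr0 nth_default.
rewrite mulrC divpK // dvdp_XsubCl rootE.
by have := congr1 (fun q : {poly K} => q`_i) h; rewrite coef_map coef0 /= => /eqP.
Qed.

Lemma fib_dvd x p : exists q, p = ('X - x%:P)%:P * q + clift (fib x p).
Proof.
have /fib_eq0 [q hq] : fib x (p - clift (fib x p)) = 0.
  by rewrite rmorphB /= fib_lift subrr.
by exists q; rewrite -hq subrK.
Qed.

(** The two derivatives are those along the vertical and the horizontal line
    through the point. *)
Definition smooth2 f : Prop := forall x y, ev2 x y f = 0 ->
  (fib x f)^`().[y] != 0 \/ (f.[y%:P])^`().[x] != 0.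

Lemma fib_monic x f : f \is monic -> fib x f \is monic.
Proof. exact: monic_map. Qed.

Lemma size_fib_monic x f : f \is monic -> size (fib x f) = size f.
Proof.
move=> mf; apply: size_poly_eq; move: (monicP mf); rewrite lead_coefE => ->.
by rewrite (rmorph1 (horner_eval x)) oner_neq0.
Qed.

Lemma size_fib x p : (size (fib x p) <= size p)%N.
Proof. exact: size_poly. Qed.

Lemma deriv_double_root (a : K) (q : {poly K}) :
  (('X - a%:P) * (('X - a%:P) * q))^`().[a] = 0.
Proof. by rewrite derivM hornerD !hornerM !hornerXsubC subrr !(mul0r, mulr0) addr0. Qed.

(** Suppose that the remainder rho of G on the fibre X = x0 is nonzero. Having
    lower degree than f, it vanishes at some root y0 of f on this fibre to a
    lower order than f does, and [smooth_local_order] makes the X-derivative of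
    f vanish at (x0, y0). If rho(y0) <> 0 the integral equation fails at this
    point; otherwise y0 is a multiple root of f and the point is singular. *)
Lemma integral_on_fibre f (m : nat) (c : nat -> {poly {poly K}}) G x0 :
  f \is monic -> smooth2 f -> c 0%N = 1 ->
  mult f (int_form m c ('X - x0%:P)%:P G) ->
  exists G', cong f G (('X - x0%:P)%:P * G').
Proof.
move=> mf sm c0 hint; set l := ('X - x0%:P)%:P in hint *.
pose r := Pdiv.CommonRing.rmodp G f.
have eG := Pdiv.RingMonic.rdivp_eq mf G.
have cGr : cong f G r.
  exists (Pdiv.CommonRing.rdivp G f); rewrite {1}eG /r; ring.
have fn0 : f != 0 by apply: monic_neq0.
have szr : (size r < size f)%N by apply: Pdiv.CommonRing.ltn_rmodpN0.
suff rho0 : fib x0 r = 0.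
  have [q hq] := fib_eq0 rho0; exists q; by rewrite -hq.
apply/eqP/negPn/negP => rho_n0.
have {}hint : mult f (int_form m c l r).
  by apply: cong_mult hint; apply/cong_sym/int_form_cong => //; apply: cong_refl.
set rho := fib x0 r in rho_n0; set phi := fib x0 f.
pose g := gcdp phi rho.
have mphi : phi \is monic by apply: fib_monic.
have phi_n0 : phi != 0 by apply: monic_neq0.
have gn0 : g != 0 by rewrite gcdp_eq0 negb_and phi_n0.
have hphi : phi = phi %/ g * g by rewrite divpK // dvdp_gcdl.
have hrho : rho = rho %/ g * g by rewrite divpK // dvdp_gcdr.
set h := phi %/ g in hphi; set q := rho %/ g in hrho.
have cop : coprimep h q.
  rewrite /h /q /g; apply: coprimep_div_gcd; by rewrite phi_n0.
have szh : size h != 1%N.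
  apply/negP => /size_poly1P [a an0 ha].
  have : (size phi <= size rho)%N.
    apply: dvdp_leq => //; apply: dvdp_trans (dvdp_gcdr phi rho).
    by rewrite -/g {1}hphi ha mul_polyC dvdpZl.
  by rewrite leqNgt (leq_ltn_trans (size_fib _ _)) // size_fib_monic.
have /closed_rootP [y0 ry0] := szh.
have qy0 : q.[y0] != 0 by apply: coprimep_root cop ry0.
have [k [g']] := multiplicity_XsubC g y0; rewrite gn0 /= => g'y0 eg.
have /factor_theorem [h' eh] := ry0.
have [U eU] := fib_dvd x0 f; rewrite -/l -/phi in eU.
have [G2 eG2] := fib_dvd x0 r; rewrite -/l -/rho in eG2.
pose yy : {poly {poly K}} := 'X - (y0%:P)%:P.
have lyy : clift ('X - y0%:P) = yy.
  by rewrite rmorphB /= /clift map_polyX map_polyC.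
have eU' : f = l * U + yy ^+ k.+1 * clift (h' * g').
  rewrite {1}eU; congr (_ + _).
  by rewrite hphi eg eh -lyy !rmorphM !rmorphXn /= exprS; ring.
have eG' : r = l * G2 + yy ^+ k * clift (q * g').
  rewrite {1}eG2; congr (_ + _).
  by rewrite hrho eg -lyy !rmorphM !rmorphXn /=; ring.
have evl : ev2 x0 y0 l = 0.
  by rewrite ev2_fib fibC !hornerE subrr.
have evyy : ev2 x0 y0 yy = 0.
  by rewrite ev2_horner /yy !hornerE subrr.
have evf : ev2 x0 y0 f = 0.
  by rewrite {1}eU' rmorphD !rmorphM rmorphXn evl evyy exprS !mul0r addr0.
have evW2 : ev2 x0 y0 (clift (q * g')) != 0.
  by rewrite ev2_fib fib_lift hornerM mulf_neq0.
have U0 : ev2 x0 y0 U = 0.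
  apply/eqP/negPn/negP => Un0.
  have := @smooth_local_order _ _ (ev2 x0 y0) f U (clift (h' * g')) r G2
    (clift (q * g')) l yy k.+1 k m c eU' eG' (ltnSn k) c0 hint _ evyy evf.
  rewrite rmorphM => H; have /eqP : ev2 x0 y0 (clift (q * g')) * ev2 x0 y0 U = 0.
    apply: H => A [B hB].
    have : f.[y0%:P] * B.[y0%:P] = 0 by rewrite -hornerM -hB !hornerE subrr mul0r.
    move/eqP; rewrite mulf_eq0 => /orP[/eqP f0|].
      case/negP: Un0; move: f0; rewrite {1}eU' !hornerE subrr exprS mul0r mul0r addr0.
      move/eqP; rewrite mulf_eq0 polyXsubC_eq0 orFb => /eqP U0.
      by rewrite ev2_horner U0 horner0.
    move=> /factor_theorem [B' eB]; exists B'.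
    have yn0 : yy != 0 by rewrite /yy polyXsubC_eq0.
    apply: (mulfI yn0); rewrite hB eB /yy; ring.
  by rewrite mulf_eq0 (negPf evW2) (negPf Un0).
case: k eU' eG' eg => [|k] eU' eG' eg.
  have : ev2 x0 y0 r ^+ m = 0.
    case: hint => B hB; have := congr1 (ev2 x0 y0) hB.
    by rewrite rmorph_int_form evl int_form0 /comp c0 rmorph1 mul1r rmorphM evf mul0r.
  move/eqP; rewrite expf_eq0 => /andP[_].
  rewrite {1}eG' expr0 mul1r rmorphD rmorphM evl mul0r add0r.
  by apply/negP.
have [] := sm x0 y0 evf.
  have -> : fib x0 f = ('X - y0%:P) * (('X - y0%:P) * (h' * (g' * ('X - y0%:P) ^+ k))).
    by rewrite -/phi hphi eh eg !exprS; ring.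
  by rewrite deriv_double_root eqxx.
rewrite {1}eU' !hornerE subrr exprS !mul0r addr0 derivM derivXsubC !hornerE subrr.
by rewrite -ev2_horner U0 !mul0r addr0 eqxx.
Qed.
End Bivariate.
Arguments clift {K}.

Section Normality.
Variable K : closedFieldType.
Implicit Types (p f g h : {poly {poly K}}) (x y : K).

Lemma reduce f (A : {poly {poly K}}) : f \is monic ->
  exists2 r : {poly {poly K}}, cong f A r & (size r < size f)%N.
Proof.
move=> mf; exists (Pdiv.CommonRing.rmodp A f).
  exists (Pdiv.CommonRing.rdivp A f).
  rewrite {1}(Pdiv.RingMonic.rdivp_eq mf A); ring.
by apply: Pdiv.CommonRing.ltn_rmodpN0; apply: monic_neq0.
Qed.

Lemma mult_small f (r : {poly {poly K}}) : f \is monic -> (size r < size f)%N -> mult f r -> r = 0.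
Proof.
move=> mf sz [B hB]; apply/eqP/negPn/negP => rn0.
have Bn0 : B != 0 by apply: contraNneq rn0 => B0; rewrite hB B0 mulr0.
move: sz; rewrite hB size_monicM // ltnNge; case: (size B) (size_poly_eq0 B) => [|s _].
  by rewrite eqxx (negPf Bn0).
by rewrite addnS /= leq_addr.
Qed.

(** f is monic in Y, hence primitive. *)
Lemma mult_cancelC f (N : {poly K}) A : f \is monic -> N != 0 ->
  mult f (N%:P * A) -> mult f A.
Proof.
move=> mf Nn0 h; have [r cr sz] := reduce A mf.
suff r0 : r = 0 by apply: cong_mult cr _; rewrite r0; apply: mult0.
have : N%:P * r = 0.
  apply: (@mult_small f) => //; first by rewrite mul_polyC size_scale.
  by apply: cong_mult h; apply: congM (cong_refl _ _) (cong_sym cr).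
by move/eqP; rewrite mulf_eq0 polyC_eq0 (negPf Nn0) => /eqP.
Qed.

(** The roots of N are removed one at a time with [integral_on_fibre]. *)
Lemma integral_closed f (m : nat) (c : nat -> {poly {poly K}}) (N : {poly K}) G :
  f \is monic -> smooth2 f -> c 0%N = 1 -> N != 0 ->
  mult f (int_form m c N%:P G) ->
  exists2 R, cong f G (N%:P * R) & mult f (int_form m c 1 R).
Proof.
move=> mf sm c0; have [n] := ubnP (size N); elim: n => // n IH in N G *.
move=> szN Nn0 hint; case: (eqVneq (size N) 1%N) => [sz1|sz1].
  have /size_poly1P [a an0 eN] : size N == 1%N by rewrite sz1.
  exists ((a^-1)%:P%:P * G).
    rewrite eN mulrA -!polyCM divff // mul1r; apply: cong_refl.
  apply: (@mult_cancelC f (N ^+ m)) => //; first by rewrite expf_neq0.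
  rewrite polyC_exp int_formM mulr1.
  by rewrite [X in int_form _ _ _ X]mulrA {2}eN -!polyCM divff // mul1r.
have /closed_rootP [x0 /factor_theorem [N' eN]] := sz1.
have N'n0 : N' != 0 by apply: contraNneq Nn0 => N0; rewrite eN N0 mul0r.
have ln0 : 'X - x0%:P != 0 :> {poly K} by rewrite polyXsubC_eq0.
have hint' : mult f (int_form m (fun i => c i * N'%:P ^+ i) ('X - x0%:P)%:P G).
  by rewrite -int_form_scale -polyCM -eN.
have c0' : c 0%N * N'%:P ^+ 0 = 1 by rewrite c0 mul1r.
have [G' cG'] := @integral_on_fibre _ f m _ G x0 mf sm c0' hint'.
have szN' : (size N' < n)%N.
  by move: szN; rewrite eN size_Mmonic ?monicXsubC // size_XsubC addn2 ltnS.
have hintG' : mult f (int_form m c N'%:P G').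
  apply: (@mult_cancelC f (('X - x0%:P) ^+ m)) => //; first by rewrite expf_neq0.
  rewrite polyC_exp int_formM.
  apply: cong_mult hint; apply: int_form_cong; last exact: cong_sym.
  by rewrite eN polyCM mulrC; apply: cong_refl.
have [R cR hR] := IH N' G' szN' N'n0 hintG'.
exists R => //.
have h1 : cong f (('X - x0%:P)%:P * G') (('X - x0%:P)%:P * (N'%:P * R)).
  by apply: congM cR; apply: cong_refl.
rewrite /cong; have -> : G - N%:P * R = (G - ('X - x0%:P)%:P * G') +
    (('X - x0%:P)%:P * G' - ('X - x0%:P)%:P * (N'%:P * R)).
  rewrite eN polyCM; ring.
exact: multD.
Qed.

(** [flat p] is p(s, s Y) as a polynomial in s over K[Y]: its degree in s is
    the total degree of p, and its leading coefficient is the top form of p. *)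
Definition flat : {rmorphism {poly {poly K}} -> {poly {poly K}}} :=
  horner_eval ('X%:P * 'X) \o map_poly (@clift K).

Lemma coef_flat p k j :
  (flat p)`_k`_j = if (j <= k)%N then p`_j`_(k - j) else 0.
Proof.
have -> : flat p = \sum_(i < size p) @clift K p`_i * ('X^i)%:P * 'X^i.
  have -> : flat p = (map_poly (@clift K) p).['X%:P * 'X] by [].
  rewrite (@horner_coef_wide _ (size p)) ?size_poly //.
  by apply: eq_bigr => i _; rewrite coef_map exprMn polyC_exp mulrA.
rewrite coef_sum coef_sum.
have H (i : 'I_(size p)) : (@clift K p`_i * ('X^i)%:P * 'X^i)`_k`_j =
   if (j == i :> nat) && (j <= k)%N then p`_i`_(k - i) else 0.
  rewrite coefMXn; case: ltnP => [lt|le].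
    case: eqP => [->|] /=; last by rewrite coef0.
    by rewrite leqNgt lt coef0.
  rewrite coefMC coef_map_id0 // mul_polyC coefZ coefXn.
  case: eqP => [->|] /=; last by rewrite mulr0.
  by rewrite le mulr1.
rewrite (eq_bigr _ (fun i _ => H i)).
case: (ltnP j (size p)) => [lt|le].
  rewrite (bigD1 (Ordinal lt)) //= eqxx /= big1 ?addr0 // => i.
  by rewrite eq_sym -val_eqE /= => /negPf ->.
rewrite big1; last first.
  by move=> i _; rewrite gtn_eqF // (leq_trans (ltn_ord i)).
by rewrite (nth_default 0 le) coef0 if_same.
Qed.

Definition tdeg_le (n : nat) p : Prop := (size (flat p) <= n.+1)%N.

Lemma tdeg_leP n p :
  tdeg_le n p <-> (forall i j, (n < i + j)%N -> p`_i`_j = 0).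
Proof.
split=> [h i j lt|h].
  have := coef_flat p (i + j) i; rewrite leq_addr addKn => <-.
  have -> : (flat p)`_(i + j) = 0 by apply: nth_default; apply: leq_trans h lt.
  by rewrite coef0.
apply/leq_sizeP => k lt; apply/polyP => j; rewrite coef_flat coef0.
by case: leqP => // le; apply: h; rewrite subnKC.
Qed.

Lemma separable_splits (q : {poly K}) : q \is monic -> coprimep q q^`() ->
  exists2 rs : seq K, uniq rs & q = \prod_(z <- rs) ('X - z%:P).
Proof.
move=> mq cop; have [rs] := closed_field_poly_normal q.
rewrite (monicP mq) scale1r => eq; exists rs => //.
by rewrite -separable_prod_XsubC -eq unlock.
Qed.

Lemma dvdp_of_roots (rs : seq K) (q : {poly K}) : uniq rs ->
  (forall z, z \in rs -> q.[z] = 0) -> \prod_(z <- rs) ('X - z%:P) %| q.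
Proof.
move=> u h; apply: uniq_roots_dvdp; last by rewrite uniq_rootsE.
by apply/allP => z /h; rewrite rootE => ->.
Qed.

Lemma poly_eq0_generic (W q : {poly K}) : W != 0 ->
  (forall x, W.[x] != 0 -> q.[x] = 0) -> q = 0.
Proof.
move=> Wn0 h; apply/eqP/negPn/negP => qn0.
have /closed_nonrootP [x] : W * q != 0 by rewrite mulf_neq0.
rewrite rootE hornerM mulf_eq0 negb_or => /andP[/h ->].
by rewrite eqxx.
Qed.

Lemma poly2_eq0_generic (W : {poly K}) (q : {poly {poly K}}) : W != 0 ->
  (forall x, W.[x] != 0 -> fib x q = 0) -> q = 0.
Proof.
move=> Wn0 h; apply/polyP => i; rewrite coef0.
apply: (poly_eq0_generic Wn0) => x /h /(congr1 (fun p : {poly K} => p`_i)).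
by rewrite coef_map coef0.
Qed.

(** Total degree at infinity: a nonzero top form of R of degree above n would
    have its m-th power divisible by the top form T of f, since the other terms
    of the equation have lower degree. T is squarefree because the line at
    infinity is transversal, so T would divide the top form of R, whose degree
    in Y is too low. *)
Lemma integral_tdeg f (d m n : nat) (c : nat -> {poly {poly K}})
    (R : {poly {poly K}}) :
  f \is monic -> size f = d.+1 -> tdeg_le d f ->
  coprimep (flat f)`_d ((flat f)`_d)^`() ->
  c 0%N = 1 -> (forall i, (i <= m)%N -> tdeg_le (n * i) (c i)) ->
  (size R <= d)%N -> mult f (int_form m c 1 R) -> tdeg_le n R.
Proof.
move=> mf szf tf sepT c0 tc szR [B hB]; rewrite /tdeg_le leqNgt; apply/negP => big.
set T := (flat f)`_d in sepT.
have T_coef j : T`_j = if (j <= d)%N then f`_j`_(d - j) else 0 by rewrite coef_flat.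
have Td : T`_d = 1.
  rewrite T_coef leqnn subnn; move: (monicP mf); rewrite lead_coefE szf /= => ->.
  by rewrite coef1.
have szT : size T = d.+1.
  apply/eqP; rewrite eqn_leq; apply/andP; split.
    by apply/leq_sizeP => j lt; rewrite T_coef leqNgt lt.
  by rewrite ltnNge; apply/negP => /leq_sizeP /(_ d (leqnn d)) /eqP; rewrite Td oner_eq0.
have mT : T \is monic by rewrite monicE lead_coefE szT Td.
have szff : size (flat f) = d.+1.
  apply/eqP; rewrite eqn_leq tf ltnNge; apply/negP => /leq_sizeP /(_ d (leqnn d)) /eqP.
  by rewrite -/T -size_poly_eq0 szT.
have leadf : lead_coef (flat f) = T by rewrite lead_coefE szff.
set r := flat R in big; set e := (size r).-1.
have szr : size r = e.+1 by rewrite prednK // (leq_ltn_trans _ big).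
have ne : (n < e)%N by rewrite -ltnS -szr.
pose L := lead_coef r.
have Ln0 : L != 0 by rewrite lead_coef_eq0 -size_poly_eq0 szr.
have eqn : r ^+ m + \sum_(i < m) flat (c i.+1) * r ^+ (m - i.+1) = flat f * flat B.
  rewrite -rmorphM -hB rmorph_int_form /int_form big_ord_recl subn0 /comp c0.
  rewrite rmorph1 expr0 !mul1r; congr (_ + _); apply: eq_bigr => i _.
  by rewrite lift0 expr1n mulr1.
have szrm : size (r ^+ m) = (e * m).+1.
  by have := size_exp r m; rewrite szr /= => <-; rewrite prednK // lt0n size_poly_eq0
    expf_eq0 -size_poly_eq0 szr andbF.
have szsum : (size (\sum_(i < m) flat (c i.+1) * r ^+ (m - i.+1))%R < size (r ^+ m)%R)%N.
  rewrite szrm ltnS; apply: (leq_trans (size_sum _ _ _)); apply/bigmax_leqP => i _.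
  apply: (leq_trans (size_polyMleq _ _)).
  have sz1 := tc i.+1 (ltn_ord i).
  have sz2 : size (r ^+ (m - i.+1)) = (e * (m - i.+1)).+1.
    by have := size_exp r (m - i.+1); rewrite szr /= => <-; rewrite prednK // lt0n size_poly_eq0
      expf_eq0 -size_poly_eq0 szr andbF.
  rewrite sz2 addnS /=; apply: (leq_trans (leq_add sz1 (leqnn _))).
  rewrite addSn -[X in (_ <= e * X)%N](subnKC (ltn_ord i)) mulnDr ltn_add2r.
  by rewrite ltn_mul2r.
have hL : L ^+ m = T * lead_coef (flat B).
  by rewrite -leadf -lead_coefM -eqn lead_coefDl // lead_coef_exp.
have [rs urs eT] := separable_splits mT sepT.
have dvd : T %| L.
  rewrite eT; apply: dvdp_of_roots => // z zin.
  have : (L ^+ m).[z] = 0.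
    rewrite hL hornerM; suff -> : T.[z] = 0 by rewrite mul0r.
    by apply/eqP; rewrite -rootE eT root_prod_XsubC.
  by rewrite horner_exp => /eqP; rewrite expf_eq0 => /andP[_ /eqP].
have := dvdp_leq Ln0 dvd; rewrite szT ltnNge => /negP; apply.
apply/leq_sizeP => j le; rewrite /L lead_coefE coef_flat.
by rewrite (nth_default 0 (leq_trans szR le)) coef0 if_same.
Qed.

End Normality.
Arguments flat {K}.

(** * Connectedness of a smooth plane curve *)

Section Prime.
Variable K : closedFieldType.
Hypothesis charK0 : [pchar K] =i pred0.
Implicit Types (p f g h : {poly {poly K}}) (x y : K).

Lemma natK_eq0 n : (n%:R == 0 :> K) = (n == 0%N).
Proof. exact: (proj1 (pcharf0P K) charK0 n). Qed.

Lemma natP_eq0 n : (n%:R == 0 :> {poly K}) = (n == 0%N).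
Proof. by rewrite -polyC_natr polyC_eq0 natK_eq0. Qed.

Lemma deriv_neq0 g : (1 < size g)%N -> g^`() != 0.
Proof.
move=> sz; apply/eqP => /(congr1 (fun p : {poly {poly K}} => p`_(size g).-2)).
rewrite coef_deriv coef0 -(ltn_predK sz) /=.
have e : (size g).-1 = (size g).-2.+1 by rewrite -(ltn_predK sz); case: (size g) sz => [|[]].
rewrite -e => /eqP; rewrite -mulr_natr mulf_eq0 natP_eq0 -lead_coefE lead_coef_eq0.
rewrite -size_poly_eq0; case: (size g) sz => [|[]] //.
Qed.

Lemma dvdp2P f g : g %| f -> exists c : {poly K}, exists2 h, c != 0 & c%:P * f = h * g.
Proof.
case/Pdiv.Idomain.dvdpP => [[c h] /= cn0 e]; exists c, h => //.
by rewrite mul_polyC.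
Qed.

Lemma bezout2 f g : coprimep f g ->
  exists u v, exists2 N : {poly K}, N != 0 & u * f + v * g = N%:P.
Proof.
case/Bezout_coprimepP => [[u v]] /=; rewrite -size_poly_eq1 => /size_poly1P [N Nn0 e].
by exists u, v, N.
Qed.

(** A minimal common divisor g is prime to its own derivative, and a general
    vertical line meets g = 0 in a point where g_Y <> 0. Writing c f = h g, the
    vanishing of f_Y there gives h = 0, so f_X vanishes too. *)
Lemma smooth_no_common f g : smooth2 f ->
  (1 < size g)%N -> g %| f -> g %| f^`() -> False.
Proof.
move=> sm; have [n] := ubnP (size g); elim: n => // n IH in g *.
rewrite ltnS => szn sz1 gf gf'.
have g'n0 := deriv_neq0 sz1; have gn0 : g != 0 by rewrite -size_poly_gt0 ltnW.
case: (leqP (size (gcdp g g^`())) 1) => [cop|big]; last first.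
  apply: (IH (gcdp g g^`())) => //.
  - apply: leq_trans szn; apply: leq_ltn_trans (lt_size_deriv gn0).
    by apply: dvdp_leq => //; apply: dvdp_gcdr.
  - by apply: dvdp_trans gf; apply: dvdp_gcdl.
  - by apply: dvdp_trans gf'; apply: dvdp_gcdl.
have {}cop : coprimep g g^`().
  by rewrite /coprimep eqn_leq cop lt0n size_poly_eq0 gcdp_eq0 negb_and gn0.
have [u [v [N Nn0 eN]]] := bezout2 cop.
have [c [h cn0 ef]] := dvdp2P gf; have [c' [h' c'n0 ef']] := dvdp2P gf'.
have /closed_nonrootP [x0] : N * c * c' * lead_coef g != 0.
  by rewrite !mulf_neq0 // lead_coef_eq0.
rewrite rootE !hornerM !mulf_eq0 !negb_or => /andP[/andP[/andP[Nx cx] c'x] lx].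
have szg : size (fib x0 g) = size g by apply: size_poly_eq; rewrite -lead_coefE.
have /closed_rootP [y0] : size (fib x0 g) != 1%N by rewrite szg gtn_eqF.
rewrite rootE => /eqP gy0; have {}gy0 : ev2 x0 y0 g = 0 by [].
have evC (a : {poly K}) : ev2 x0 y0 a%:P = a.[x0] by rewrite ev2_horner hornerC.
have fy0 : ev2 x0 y0 f = 0.
  have := congr1 (ev2 x0 y0) ef; rewrite !rmorphM evC gy0 mulr0 => /eqP.
  by rewrite mulf_eq0 (negPf cx) => /eqP.
have f'y0 : ev2 x0 y0 f^`() = 0.
  have := congr1 (ev2 x0 y0) ef'; rewrite !rmorphM evC gy0 mulr0 => /eqP.
  by rewrite mulf_eq0 (negPf c'x) => /eqP.
have derY (p : {poly {poly K}}) : (fib x0 p)^`().[y0] = ev2 x0 y0 p^`().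
  by rewrite fib_deriv ev2_fib.
have [|fX] := sm x0 y0 fy0; first by rewrite derY f'y0 eqxx.
have hn0 : ev2 x0 y0 h != 0.
  apply: contra_neq fX => h0.
  have := congr1 (fun p : {poly {poly K}} => (p.[y0%:P])^`().[x0]) ef.
  rewrite !hornerM hornerC !derivM !hornerD !hornerM -!ev2_horner fy0 gy0 h0.
  rewrite !(mulr0, mul0r, add0r, addr0) => /eqP; rewrite mulf_eq0 (negPf cx) => /eqP //.
have g'0 : ev2 x0 y0 g^`() = 0.
  have := congr1 (fun p : {poly {poly K}} => ev2 x0 y0 p^`()) ef.
  rewrite !derivM derivC mul0r add0r rmorphD !rmorphM f'y0 gy0 !mulr0 add0r => /esym/eqP.
  by rewrite mulf_eq0 (negPf hn0) => /eqP.
have := congr1 (ev2 x0 y0) eN.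
by rewrite rmorphD !rmorphM gy0 g'0 !mulr0 addr0 evC => /esym/eqP; rewrite (negPf Nx).
Qed.

Lemma smooth_coprime f : f \is monic -> smooth2 f -> coprimep f f^`().
Proof.
move=> mf sm; rewrite /coprimep eqn_leq leqNgt; apply/andP; split.
  apply/negP => big; apply: (smooth_no_common sm big); [exact: dvdp_gcdl | exact: dvdp_gcdr].
by rewrite lt0n size_poly_eq0 gcdp_eq0 negb_and monic_neq0.
Qed.

Lemma generic_separable f : f \is monic -> smooth2 f ->
  exists2 W : {poly K}, W != 0 &
    forall x, W.[x] != 0 -> coprimep (fib x f) (fib x f)^`().
Proof.
move=> mf sm; have [u [v [N Nn0 eN]]] := bezout2 (smooth_coprime mf sm).
exists N => // x Nx; apply/Bezout_coprimepP.
exists (fib x u, fib x v) => /=.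
rewrite fib_deriv.
rewrite -!rmorphM -rmorphD eN fibC -size_poly_eq1 size_polyC Nx //.
Qed.

(** On a general vertical line the roots of f are simple, and the remainder of
    A modulo f vanishes at more of them than its degree allows. *)
Lemma vanishing_mult f (W : {poly K}) (A : {poly {poly K}}) :
  f \is monic -> smooth2 f -> W != 0 ->
  (forall x y, W.[x] != 0 -> ev2 x y f = 0 -> ev2 x y A = 0) -> mult f A.
Proof.
move=> mf sm Wn0 h; have [V Vn0 hV] := generic_separable mf sm.
have [r cr szr] := reduce A mf.
suff r0 : r = 0 by apply: cong_mult cr _; rewrite r0; apply: mult0.
apply: (@poly2_eq0_generic _ (W * V)); first by rewrite mulf_neq0.
move=> x; rewrite hornerM mulf_eq0 negb_or => /andP[Wx Vx].
apply/eqP/negPn/negP => rn0.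
have [rs urs ers] := separable_splits (fib_monic x mf) (hV x Vx).
have : fib x f %| fib x r.
  rewrite ers; apply: dvdp_of_roots => // z zin.
  have fz : ev2 x z f = 0.
    by apply/eqP; rewrite ev2_fib -rootE ers root_prod_XsubC.
  case: cr => B hB; have := congr1 (ev2 x z) hB.
  by rewrite rmorphB rmorphM fz mul0r h // sub0r ev2_fib => /eqP; rewrite oppr_eq0 => /eqP.
move/(dvdp_leq rn0); rewrite size_fib_monic // leqNgt => /negP; apply.
exact: leq_ltn_trans (size_fib _ _) szr.
Qed.

(** An affine chart of a smooth projective curve of degree d in which Y is
    integral over K[X] of degree d, and which is transversal to the line at
    infinity. *)
Definition good_chart (d : nat) f : Prop :=
  [/\ f \is monic, size f = d.+1, smooth2 f, tdeg_le d f
    & coprimep (flat f)`_d ((flat f)`_d)^`()].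

Lemma good_chart_normal d f m n (c : nat -> {poly {poly K}}) (N : {poly K})
    (G : {poly {poly K}}) :
  good_chart d f -> c 0%N = 1 -> (forall i, (i <= m)%N -> tdeg_le (n * i) (c i)) ->
  N != 0 -> mult f (int_form m c N%:P G) ->
  exists2 R, cong f G (N%:P * R) & tdeg_le n R.
Proof.
move=> [mf szf sm tf sepT] c0 tc Nn0 h.
have [R cR hR] := integral_closed mf sm c0 Nn0 h.
have [r cr szr] := reduce R mf.
exists r.
  rewrite /cong -(subrK (N%:P * R) G) -addrA; apply: multD => //.
  by apply: congM cr; apply: cong_refl.
apply: (@integral_tdeg _ f d m n c) => //; first by rewrite -ltnS -szf.
apply: cong_mult hR; apply: int_form_cong; [exact: cong_refl | exact: cong_sym].
Qed.

Lemma tdeg_leC n (a : K) : tdeg_le n (a%:P%:P : {poly {poly K}}).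
Proof.
apply/tdeg_leP => i j lt; rewrite coefC; case: eqP => [i0|_]; last by rewrite coef0.
by rewrite coefC; case: eqP lt => // j0; rewrite i0 j0.
Qed.

Lemma tdeg0P (R : {poly {poly K}}) : tdeg_le 0 R -> exists a : K, R = a%:P%:P.
Proof.
move/tdeg_leP => h; exists (R`_0`_0); apply/polyP => i; apply/polyP => j.
rewrite coefC; case: eqP => [->|/eqP i0]; last by rewrite coef0 h // addn_gt0 lt0n i0.
by rewrite coefC; case: eqP => [->|/eqP j0] //; rewrite h // add0n lt0n.
Qed.

(** Connectedness of the curve: let g be the common divisor of f and A, and c f
    = g h. Smoothness makes g and h coprime, so u g + w h = N(X), and w h / N
    is an idempotent of the function ring. It is integral of degree 0, hence a
    constant by [good_chart_normal], that is 0 or 1; then g or h is a constant. *)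
Lemma good_chart_prime d f (A B : {poly {poly K}}) :
  (0 < d)%N -> good_chart d f -> mult f (A * B) -> mult f A \/ mult f B.
Proof.
move=> dpos gc hAB; have [mf szf sm tf sepT] := gc.
have fn0 : f != 0 by apply: monic_neq0.
pose g := gcdp f A.
have gn0 : g != 0 by rewrite gcdp_eq0 negb_and fn0.
have [cop|ncop] := boolP (coprimep f A).
  right; have [u [v [N Nn0 eN]]] := bezout2 cop.
  apply: (mult_cancelC mf Nn0); rewrite -eN.
  have -> : (u * f + v * A) * B = f * (u * B) + v * (A * B) by ring.
  by apply: multD; [apply: mult_self | apply: multMl].
have [c [h cn0 ef]] := dvdp2P (dvdp_gcdl f A).
have [c' [A' c'n0 eA]] := dvdp2P (dvdp_gcdr f A).
rewrite -/g in ef eA.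
have hn0 : h != 0.
  by apply: contraNneq (mulf_neq0 (_ : c%:P != 0) fn0) => [h0|]; rewrite ?polyC_eq0 // ef h0 mul0r.
case: (leqP (size h) 1) => [szh|szh].
  left; have /size_poly1P [a an0 eh] : size h == 1%N.
    by rewrite eqn_leq szh lt0n size_poly_eq0.
  apply: (@mult_cancelC _ f (a * c')) => //; first by rewrite mulf_neq0.
  have -> : (a * c')%:P * A = f * (c%:P * A').
    rewrite polyCM -mulrA eA; have -> : f * (c%:P * A') = (c%:P * f) * A' by ring.
    rewrite ef eh; ring.
  exact: mult_self.
have szg : (1 < size g)%N.
  rewrite ltn_neqAle lt0n size_poly_eq0 gn0 andbT eq_sym.
  by move: ncop; rewrite /coprimep.
have cop : coprimep g h.
  apply/coprimepP => k kg kh; rewrite -size_poly_eq1.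
  case: (ltngtP (size k) 1) => // [|big].
    rewrite ltnS leqn0 size_poly_eq0 => /eqP k0.
    by move: kg; rewrite k0 dvd0p (negPf gn0).
  exfalso; apply: (smooth_no_common sm big).
    by apply: dvdp_trans kg _; apply: dvdp_gcdl.
  have -> : k %| f^`() = (k %| c%:P * f^`()) by rewrite mul_polyC dvdpZr.
  have := congr1 deriv ef; rewrite !derivM derivC mul0r add0r => ->.
  by apply: dvdp_add; [apply: dvdp_mull | apply: dvdp_mulr].
have [u [w [N Nn0 eN]]] := bezout2 cop.
(* The equation z^2 - z = 0 of an idempotent. *)
pose ci (i : nat) : {poly {poly K}} := (if i == 0%N then 1 else if i == 1%N then -1 else 0)%:P%:P.
have hint : mult f (int_form 2 ci N%:P (w * h)).
  rewrite /int_form !big_ord_recl big_ord0 /= /bump /= /ci /= rmorph0 mul0r.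
  rewrite !expr0 !mulr1 !expr1 !polyCN !polyC1 -eN.
  exists (- (w * u * c%:P)).
  have -> : f * - (w * u * c%:P) = - (w * u) * (c%:P * f) by ring.
  rewrite ef; ring.
have ctd i : (i <= 2)%N -> tdeg_le (0 * i) (ci i) by move=> _; apply: tdeg_leC.
have [R cR tR] := good_chart_normal gc (erefl : ci 0%N = 1) ctd Nn0 hint.
have [a eR] := tdeg0P tR; rewrite {R tR}eR in cR.
exfalso.
have n1 : mult f (N%:P * (a%:P%:P * (a%:P%:P - 1))).
  apply: (@mult_cancelC _ f N) => //.
  have -> : N%:P * (N%:P * (a%:P%:P * (a%:P%:P - 1))) =
    N%:P * a%:P%:P * (N%:P * a%:P%:P - N%:P) by ring.
  apply: (@cong_mult _ f _ (w * h * (w * h - N%:P))).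
    apply: congM; first exact: cong_sym.
    by apply: congD (cong_refl _ _); apply: cong_sym.
  case: hint => Z hZ; exists Z; rewrite -hZ.
  rewrite /int_form !big_ord_recl big_ord0 /= /bump /= /ci /= rmorph0 mul0r.
  rewrite !expr0 !mulr1 !expr1 !polyCN !polyC1; ring.
have {n1} : a * (a - 1) = 0.
  have : mult f (a * (a - 1))%:P%:P.
    by have := mult_cancelC mf Nn0 n1; rewrite !polyCM !polyCB.
  move/(mult_small mf) => H; apply/eqP; rewrite -(polyC_eq0 (a * (a - 1))) -polyC_eq0.
  apply/eqP/H; apply: leq_ltn_trans (size_polyC_leq1 _) _.
  by rewrite szf ltnS.
move/eqP; rewrite mulf_eq0 subr_eq0 => /orP[/eqP a0|/eqP a1].
  have [Z] : mult f (w * h) by move: cR; rewrite a0 /cong rmorph0 mulr0 subr0.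
  move=> hZ; have e1 : c%:P * w = g * Z.
    apply: (mulIf hn0); have -> : c%:P * w * h = c%:P * (w * h) by ring.
    rewrite hZ; have -> : c%:P * (f * Z) = (c%:P * f) * Z by ring.
    rewrite ef; ring.
  have e2 : (c * N)%:P = g * (c%:P * u + Z * h).
    rewrite polyCM -eN; have -> : c%:P * (u * g + w * h) = g * (c%:P * u) + (c%:P * w) * h by ring.
    rewrite e1; ring.
  have : g %| (c * N)%:P by rewrite e2 dvdp_mulr.
  move/dvdp_leq; rewrite polyC_eq0 mulf_neq0 // => /(_ isT).
  by rewrite size_polyC mulf_neq0 // leqNgt szg.
have [Z] : mult f (w * h - N%:P) by move: cR; rewrite a1 /cong rmorph1 mulr1.
move=> hZ; have e1 : c%:P * u = - (h * Z).
  apply: (mulIf gn0); have -> : c%:P * u * g = c%:P * (u * g + w * h - w * h) by ring.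
  rewrite eN; have -> : c%:P * (N%:P - w * h) = - (c%:P * (w * h - N%:P)) by ring.
  rewrite hZ; have -> : c%:P * (f * Z) = (c%:P * f) * Z by ring.
  rewrite ef; ring.
have e2 : (c * N)%:P = h * (c%:P * w - Z * g).
  rewrite polyCM -eN; have -> : c%:P * (u * g + w * h) = (c%:P * u) * g + h * (c%:P * w) by ring.
  rewrite e1; ring.
have : h %| (c * N)%:P by rewrite e2 dvdp_mulr.
move/dvdp_leq; rewrite polyC_eq0 mulf_neq0 // => /(_ isT).
by rewrite size_polyC mulf_neq0 // leqNgt szh.
Qed.

End Prime.

(** * Forms on lines and in affine charts *)

Section TopCoef.
Variable R : comNzRingType.

(** Only an upper bound on the degree is asked for, so that top coefficients
    multiply even when they vanish. *)
Definition top_coef (n : nat) (p : {poly R}) (a : R) : Prop :=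
  (size p <= n.+1)%N /\ p`_n = a.

Lemma top_coefM n m p q a b :
  top_coef n p a -> top_coef m q b -> top_coef (n + m) (p * q) (a * b).
Proof.
move=> [sp <-] [sq <-]; split.
  apply: (leq_trans (size_polyMleq _ _)).
  by case: (size p + size q)%N (leq_add sp sq) => //= s; rewrite addSn addnS ltnS.
rewrite coefM (bigD1 (inord n)) //= inordK ?ltnS ?leq_addr // addKn big1 ?addr0 //.
move=> i; rewrite -val_eqE /= inordK ?ltnS ?leq_addr // => ne.
case: (ltngtP i n) => [lt|gt|eq]; last by rewrite eq eqxx in ne.
  rewrite (nth_default 0 (leq_trans sq _)) ?mulr0 //.
  by rewrite ltn_subRL ltn_add2r.
by rewrite (nth_default 0 (leq_trans sp _)) ?mul0r.
Qed.

Lemma top_coefX n k p a : top_coef n p a -> top_coef (n * k) (p ^+ k) (a ^+ k).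
Proof.
move=> h; elim: k => [|k IH]; last by rewrite !exprS mulnS; apply: top_coefM.
by rewrite muln0 !expr0; split; rewrite ?size_poly1 // coef1.
Qed.

Lemma top_coef_sum (I : eqType) (r : seq I) n (p : I -> {poly R}) (a : I -> R) :
  (forall i, i \in r -> top_coef n (p i) (a i)) ->
  top_coef n (\sum_(i <- r) p i) (\sum_(i <- r) a i).
Proof.
elim: r => [|i r IH] h; first by rewrite !big_nil; split; rewrite ?size_poly0 // coef0.
rewrite !big_cons; have [s1 <-] := h i (mem_head _ _).
have [|s2 <-] := IH; first by move=> j jr; apply: h; rewrite inE jr orbT.
split; last by rewrite coefD.
by apply: leq_trans (size_polyD _ _) _; rewrite geq_max s1 s2.
Qed.
End TopCoef.

Section MPoly.
Variables (n : nat) (K : comNzRingType).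
Implicit Types (F : {mpoly K[n]}).

Lemma mmap_morph (S T : comNzRingType) (phi : {rmorphism S -> T})
    (f : {rmorphism K -> S}) (g : 'I_n -> S) (f' : K -> T) (g' : 'I_n -> T) F :
  (forall c, phi (f c) = f' c) -> (forall i, phi (g i) = g' i) ->
  phi (mmap f g F) = mmap f' g' F.
Proof.
move=> hf hg; rewrite /mmap rmorph_sum; apply: eq_bigr => m _.
rewrite rmorphM hf /mmap1 rmorph_prod; congr (_ * _); apply: eq_bigr => i _.
by rewrite rmorphXn hg.
Qed.

Lemma mmap_ext (S : comNzRingType) (f f' : K -> S) (g g' : 'I_n -> S) F :
  f =1 f' -> g =1 g' -> mmap f g F = mmap f' g' F.
Proof.
move=> hf hg; rewrite /mmap; apply: eq_bigr => m _.
by rewrite hf /mmap1; congr (_ * _); apply: eq_bigr => i _; rewrite hg.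
Qed.

(** F(u + w T) with the coefficients sent into R. The choice R = K restricts F
    to a line, R = K[X] gives its equation in an affine chart, and a polynomial
    ring R its Taylor expansion. *)
Definition lineR (R : comNzRingType) (h : {rmorphism K -> R}) (u w : 'I_n -> R) F
    : {poly R} :=
  mmap (polyC \o h) (fun i => (u i)%:P + (w i)%:P * 'X) F.

Lemma lineR_top (R : comNzRingType) (h : {rmorphism K -> R}) u w F d :
  F \is d.-homog -> top_coef d (lineR h u w F) (mmap h w F).
Proof.
move=> /dhomogP hF; rewrite /lineR /mmap; apply: top_coef_sum => m mF.
rewrite -[d]add0n; apply: top_coefM.
  by split; rewrite ?size_polyC_leq1 // coefC.
have <- : mdeg m = d := hF m mF; rewrite mdegE /mmap1; elim/big_ind3: _ => [|x1 p1 a1 x2 p2 a2|i _].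
- by split; rewrite ?size_poly1 // coef1.
- exact: top_coefM.
have h1 : top_coef 1 ((u i)%:P + (w i)%:P * 'X) (w i).
  split; last by rewrite coefD coefC coefMX coefC /= add0r.
  apply: leq_trans (size_polyD _ _) _; rewrite geq_max (leq_trans (size_polyC_leq1 _)) //=.
  apply: leq_trans (size_polyMleq _ _) _; rewrite size_polyX addn2 /= ltnS.
  exact: size_polyC_leq1.
by have := top_coefX (m i) h1; rewrite mul1n.
Qed.

Lemma lineR_mulX (R : comNzRingType) (h : {rmorphism K -> R}) u w F G :
  lineR h u w (F * G) = lineR h u w F * lineR h u w G.
Proof. exact: rmorphM. Qed.

Lemma lineR_deriv (R : comNzRingType) (h : {rmorphism K -> R}) u w F :
  (lineR h u w F)^`() = \sum_i (w i)%:P * lineR h u w (F^`M(i)).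
Proof.
pose P G := (lineR h u w G)^`() = \sum_i (w i)%:P * lineR h u w (G^`M(i)).
have PM G H : P G -> P H -> P (G * H).
  rewrite /P => hG hH; rewrite lineR_mulX derivM hG hH big_distrl big_distrr /= -big_split /=.
  apply: eq_bigr => i _; rewrite mderivM /lineR !rmorphD !rmorphM; ring.
have PC c : P c%:MP.
  rewrite /P /lineR mmapC derivC big1 // => i _.
  by rewrite mderivC rmorph0 mulr0.
have PXi j : P 'X_j.
  rewrite /P /lineR mmapX mmap1U derivD derivC add0r derivM derivC mul0r add0r derivX mulr1.
  rewrite (bigD1 j) //= mderivX mnmE eqxx /= mulr1n.
  have -> : (U_(j) - U_(j))%MM = 0%MM by apply/mnmP => i; rewrite !mnmE subnn.
  rewrite mpolyX0 scale1r rmorph1 mulr1 big1 ?addr0 // => i ne.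
  by rewrite mderivX mnmE eq_sym (negPf ne) mulr0n scale0r rmorph0 mulr0.
have PX m : P 'X_[m].
  rewrite mpolyXE_id; elim/big_rec: _ => [|i G _ hG]; first by rewrite -mpolyC1; apply: PC.
  apply: (PM) hG; elim: (m i) => [|k IH]; first by rewrite expr0 -mpolyC1; apply: PC.
  by rewrite exprS; apply: PM.
have PD G H : P G -> P H -> P (G + H).
  rewrite /P => hG hH; rewrite /lineR rmorphD derivD -/(lineR _ _ _ _) hG.
  rewrite -/(lineR _ _ _ _) hH -big_split /=; apply: eq_bigr => i _.
  by rewrite mderivD rmorphD mulrDr.
elim/mpolyind: F => [|c m G _ _ hG]; first by rewrite -mpolyC0; apply: PC.
by apply: PD hG; rewrite -mul_mpolyC; apply: PM.
Qed.

Lemma meval_scale F d (c : K) (v : 'I_n -> K) :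
  F \is d.-homog -> F.@[fun i => c * v i] = c ^+ d * F.@[v].
Proof.
move=> /dhomogP hF; rewrite /meval /mmap big_distrr /= big_seq [RHS]big_seq.
apply: eq_bigr => m mF; have <- : mdeg m = d := hF m mF; rewrite /mmap1 mdegE.
have -> : \prod_(i < n) (c * v i) ^+ m i = c ^+ (\sum_(i < n) m i) * \prod_(i < n) v i ^+ m i.
  rewrite -prodrXr -big_split /=; apply: eq_bigr => i _; exact: exprMn.
by rewrite mulrCA.
Qed.

End MPoly.

Section Plane.
Variable K : closedFieldType.
Local Notation vec := 'rV[K]_3.
Implicit Types (F : {mpoly K[3]}) (u v w p q o : vec).

Definition i1 : 'I_3 := @Ordinal 3 1 isT.
Definition i2 : 'I_3 := @Ordinal 3 2 isT.

Lemma sum3 (V : nmodType) (f : 'I_3 -> V) : \sum_i f i = f ord0 + f i1 + f i2.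
Proof.
rewrite !big_ord_recl big_ord0 addr0 addrA.
by congr (_ + f _ + f _); apply: val_inj.
Qed.

Lemma row3P u v : u ord0 ord0 = v ord0 ord0 -> u ord0 i1 = v ord0 i1 ->
  u ord0 i2 = v ord0 i2 -> u = v.
Proof.
move=> h0 h1 h2; apply/rowP => -[[|[|[|//]]] h].
- by rewrite (_ : Ordinal h = ord0) //; apply: val_inj.
- by rewrite (_ : Ordinal h = i1) //; apply: val_inj.
by rewrite (_ : Ordinal h = i2) //; apply: val_inj.
Qed.

Definition evf F v : K := F.@[v ord0].

Definition line F u w : {poly K} := lineR idfun (u ord0) (w ord0) F.

Lemma line_ev F u w t : (line F u w).[t] = evf F (u + t *: w).
Proof.
have -> : (line F u w).[t] = horner_eval t (line F u w) by [].
apply: (mmap_morph (f := polyC \o idfun)) => [c|i] /=; rewrite /horner_eval ?hornerC //.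
by rewrite hornerD hornerM !hornerC hornerX !mxE mulrC.
Qed.

Definition grad F v w : K := \sum_i w ord0 i * evf (F^`M(i)) v.

Lemma line_deriv F u w t : ((line F u w)^`()).[t] = grad F (u + t *: w) w.
Proof.
rewrite /line lineR_deriv horner_sum; apply: eq_bigr => i _.
by rewrite hornerM hornerC -/(line _ _ _) line_ev.
Qed.

Lemma line_deriv0 F u w : ((line F u w)^`()).[0] = grad F u w.
Proof. by rewrite line_deriv scale0r addr0. Qed.

Lemma gradD F v w w' : grad F v (w + w') = grad F v w + grad F v w'.
Proof. by rewrite /grad -big_split /=; apply: eq_bigr => i _; rewrite mxE mulrDl. Qed.

Lemma gradZ F v w c : grad F v (c *: w) = c * grad F v w.
Proof. by rewrite /grad big_distrr /=; apply: eq_bigr => i _; rewrite mxE mulrA. Qed.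

Lemma evfM F G v : evf (F * G) v = evf F v * evf G v.
Proof. exact: rmorphM. Qed.

Lemma evfB F G v : evf (F - G) v = evf F v - evf G v.
Proof. exact: rmorphB. Qed.

Lemma evfD F G v : evf (F + G) v = evf F v + evf G v.
Proof. exact: rmorphD. Qed.

Lemma evf_scale F d c v : F \is d.-homog -> evf F (c *: v) = c ^+ d * evf F v.
Proof.
move=> hF; rewrite -(meval_scale c (v ord0) hF); apply: mmap_ext => // i.
by rewrite mxE.
Qed.

Lemma evf0 F d : (0 < d)%N -> F \is d.-homog -> evf F 0 = 0.
Proof. by move=> d0 hF; rewrite -(scale0r (0 : vec)) (evf_scale _ _ hF) expr0n gtn_eqF // mul0r. Qed.

Lemma poly_all_eq0 (q : {poly K}) : (forall t, q.[t] = 0) -> q = 0.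
Proof. by move=> h; apply: (poly_eq0_generic (oner_neq0 _)) => t _; apply: h. Qed.

Lemma poly_all_eq (q r : {poly K}) : (forall t, q.[t] = r.[t]) -> q = r.
Proof.
move=> h; apply/eqP; rewrite -subr_eq0; apply/eqP/poly_all_eq0 => t.
by rewrite hornerD hornerN h subrr.
Qed.

Lemma grad_self0 F d v : F \is d.-homog -> evf F v = 0 -> grad F v v = 0.
Proof.
move=> hF v0; rewrite -line_deriv0 (_ : line F v v = 0) ?deriv0 ?horner0 //.
apply: poly_all_eq0 => t; rewrite line_ev -{1}(scale1r v) -scalerDl.
by rewrite (evf_scale _ _ hF) v0 mulr0.
Qed.

Definition det3 p q o : K :=
  p ord0 ord0 * (q ord0 i1 * o ord0 i2 - q ord0 i2 * o ord0 i1) -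
  p ord0 i1 * (q ord0 ord0 * o ord0 i2 - q ord0 i2 * o ord0 ord0) +
  p ord0 i2 * (q ord0 ord0 * o ord0 i1 - q ord0 i1 * o ord0 ord0).

Lemma cramer3 p q o v : det3 p q o != 0 ->
  v = (det3 v q o / det3 p q o) *: p + (det3 p v o / det3 p q o) *: q
    + (det3 p q v / det3 p q o) *: o.
Proof.
move=> D; have e x y : det3 p q o * (x / det3 p q o * y) = x * y.
  by rewrite mulrA mulrCA divff // mulr1.
by apply: row3P; rewrite !mxE; apply: (mulfI D); rewrite !mulrDr !e /det3; ring.
Qed.

Lemma det3_lin3 p q o a b c :
  det3 (a *: p + b *: q + c *: o) q o = a * det3 p q o.
Proof. rewrite /det3 !mxE; ring. Qed.

Lemma det3_lin2 p q o a b c :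
  det3 p (a *: p + b *: q + c *: o) o = b * det3 p q o.
Proof. rewrite /det3 !mxE; ring. Qed.

Lemma det3_lin1 p q o a b c :
  det3 p q (a *: p + b *: q + c *: o) = c * det3 p q o.
Proof. rewrite /det3 !mxE; ring. Qed.

Lemma basis_span p q o v : det3 p q o != 0 ->
  exists a b c, v = a *: p + b *: q + c *: o.
Proof. by move=> D; do 3 eexists; apply: (cramer3 v D). Qed.

(** Used to detect singular points: the gradient vanishes once three
    independent directional derivatives do. *)
Lemma grad_basis0 F v p q o : det3 p q o != 0 ->
  grad F v p = 0 -> grad F v q = 0 -> grad F v o = 0 ->
  forall i, evf (F^`M(i)) v = 0.
Proof.
move=> D hp hq ho i.
have H w : grad F v w = 0.
  have [a [b [c ->]]] := basis_span w D.
  by rewrite !gradD !gradZ hp hq ho !mulr0 !addr0.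
have := H (delta_mx ord0 i); rewrite /grad (bigD1 i) //= mxE !eqxx mul1r.
by rewrite big1 ?addr0 // => j ne; rewrite mxE (negPf ne) andbF mul0r.
Qed.

Lemma row3_neq0 v : v != 0 -> [|| v ord0 ord0 != 0, v ord0 i1 != 0 | v ord0 i2 != 0].
Proof.
apply: contraNT; rewrite !negb_or !negbK => /and3P[/eqP a /eqP b /eqP c].
by apply/eqP/row3P; rewrite mxE.
Qed.

Lemma complete_basis o : o != 0 -> exists p q, det3 p q o != 0.
Proof.
move=> /row3_neq0 /or3P[h|h|h].
- exists (delta_mx ord0 i1), (delta_mx ord0 i2).
  by rewrite /det3 !mxE /= !(mul0r, mul1r, mulr0, subr0, sub0r, addr0, add0r, opprK) ?oppr_eq0.
- exists (delta_mx ord0 ord0), (delta_mx ord0 i2).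
  by rewrite /det3 !mxE /= !(mul0r, mul1r, mulr0, subr0, sub0r, addr0, add0r, opprK) ?oppr_eq0.
exists (delta_mx ord0 ord0), (delta_mx ord0 i1).
by rewrite /det3 !mxE /= !(mul0r, mul1r, mulr0, subr0, sub0r, addr0, add0r, opprK) ?oppr_eq0.
Qed.

(** The equation of F in the affine chart (X, Y) |-> p + X q + Y o. *)
Definition chart F p q o : {poly {poly K}} :=
  lineR polyC (fun i => (p ord0 i)%:P + (q ord0 i)%:P * 'X) (fun i => (o ord0 i)%:P) F.

Lemma fib_ch F p q o x : fib x (chart F p q o) = line F (p + x *: q) o.
Proof.
have aux c : fib x (c%:P)%:P = c%:P by rewrite fibC hornerC.
apply: mmap_morph => [c|i] /=; first exact: aux.
rewrite rmorphD rmorphM /= !fibC hornerD hornerM !hornerC hornerX.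
rewrite (_ : fib x 'X = 'X); last exact: map_polyX.
by rewrite !mxE mulrC.
Qed.

Lemma ch_horner F p q o y : (chart F p q o).[y%:P] = line F (p + y *: o) q.
Proof.
have -> : (chart F p q o).[y%:P] = horner_eval y%:P (chart F p q o) by [].
apply: mmap_morph => [c|i] /=; rewrite /horner_eval ?hornerC //.
rewrite hornerD hornerM !hornerC hornerX !mxE polyCD polyCM; ring.
Qed.

Lemma ev2_ch F p q o x y : ev2 x y (chart F p q o) = evf F (p + x *: q + y *: o).
Proof. by rewrite ev2_fib fib_ch line_ev. Qed.

Lemma chM F G p q o : chart (F * G) p q o = chart F p q o * chart G p q o.
Proof. exact: lineR_mulX. Qed.

(** The total degree of a chart equation is read off on the lines through p. *)
Lemma flat_ch F p q o : flat (chart F p q o) =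
  lineR polyC (fun i => (p ord0 i)%:P) (fun i => (q ord0 i)%:P + (o ord0 i)%:P * 'X) F.
Proof.
have flC (c : {poly K}) : flat c%:P = clift c.
  have -> : flat c%:P = (map_poly (@clift K) c%:P).['X%:P * 'X] by [].
  by rewrite map_polyC hornerC.
have liC (c : K) : clift c%:P = c%:P%:P by exact: map_polyC.
have liX : clift 'X = 'X :> {poly {poly K}} by exact: map_polyX.
have flX : flat ('X : {poly {poly K}}) = 'X%:P * 'X.
  have -> : flat ('X : {poly {poly K}}) = (map_poly (@clift K) 'X).['X%:P * 'X] by [].
  by rewrite map_polyX hornerX.
apply: mmap_morph => [c|i]; rewrite /comp; first by rewrite flC liC.
rewrite rmorphD rmorphM !flC flX rmorphD rmorphM liX !liC polyCD polyCM.
by rewrite mulrDl -addrA -!mulrA.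
Qed.

Lemma ch_top F p q o d : F \is d.-homog ->
  (size (chart F p q o) <= d.+1)%N /\ (chart F p q o)`_d = (evf F o)%:P.
Proof.
move=> hF; have [sz e] := lineR_top polyC (fun i => (p ord0 i)%:P + (q ord0 i)%:P * 'X)
  (fun i => (o ord0 i)%:P) hF; split; first exact: sz.
by apply: etrans e _; apply: esym; apply: (mmap_morph (f := idfun)).
Qed.

Lemma ch_tdeg F p q o d : F \is d.-homog -> tdeg_le d (chart F p q o).
Proof.
by move=> hF; rewrite /tdeg_le flat_ch; have [] := lineR_top polyC (fun i => (p ord0 i)%:P)
  (fun i => (q ord0 i)%:P + (o ord0 i)%:P * 'X) hF.
Qed.

Lemma ch_flat_top F p q o d : F \is d.-homog -> (flat (chart F p q o))`_d = line F q o.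
Proof.
move=> hF; rewrite flat_ch; have [_ ->] := lineR_top polyC (fun i => (p ord0 i)%:P)
  (fun i => (q ord0 i)%:P + (o ord0 i)%:P * 'X) hF.
exact: mmap_ext.
Qed.

End Plane.

Section LinearForms.
Variable K : closedFieldType.
Local Notation vec := 'rV[K]_3.
Implicit Types (F : {mpoly K[3]}) (u v w p q o : vec).

Definition dot (a v : vec) : K := \sum_i a ord0 i * v ord0 i.

Definition linf (a : vec) : {mpoly K[3]} := \sum_i a ord0 i *: 'X_i.

Lemma evf_linf a v : evf (linf a) v = dot a v.
Proof.
by rewrite /evf /linf raddf_sum; apply: eq_bigr => i _; rewrite /= mevalZ mevalXU.
Qed.

Lemma linf_homog a : linf a \is 1.-homog.
Proof. by apply: rpred_sum => i _; apply: rpredZ; rewrite dhomogX /= mdeg1. Qed.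

Lemma dotD a v w : dot a (v + w) = dot a v + dot a w.
Proof. by rewrite /dot -big_split; apply: eq_bigr => i _; rewrite mxE mulrDr. Qed.

Lemma dotZ a c v : dot a (c *: v) = c * dot a v.
Proof. by rewrite /dot big_distrr; apply: eq_bigr => i _; rewrite mxE mulrCA. Qed.

Lemma dotDl a b v : dot (a + b) v = dot a v + dot b v.
Proof. by rewrite /dot -big_split; apply: eq_bigr => i _; rewrite mxE mulrDl. Qed.

Lemma dotZl a c v : dot (c *: a) v = c * dot a v.
Proof. by rewrite /dot big_distrr; apply: eq_bigr => i _; rewrite mxE -mulrA. Qed.

Lemma dot0r a : dot a 0 = 0.
Proof. by rewrite -(scale0r (0 : vec)) dotZ mul0r. Qed.

Definition cross (q o : vec) : vec := \row_i
  (if i == ord0 then q ord0 i1 * o ord0 i2 - q ord0 i2 * o ord0 i1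
   else if i == i1 then q ord0 i2 * o ord0 ord0 - q ord0 ord0 * o ord0 i2
   else q ord0 ord0 * o ord0 i1 - q ord0 i1 * o ord0 ord0).

Lemma dot_cross q o v : dot (cross q o) v = det3 v q o.
Proof. rewrite /dot sum3 !mxE /= /det3; ring. Qed.

Definition coord1 p q o : vec := (det3 p q o)^-1 *: cross q o.
Definition coord2 p q o : vec := (det3 p q o)^-1 *: cross o p.
Definition coord3 p q o : vec := (det3 p q o)^-1 *: cross p q.

Lemma dot_coord1 p q o a b c : det3 p q o != 0 ->
  dot (coord1 p q o) (a *: p + b *: q + c *: o) = a.
Proof. by move=> D; rewrite dotZl dot_cross det3_lin3 mulrCA mulVf // mulr1. Qed.

Lemma dot_coord2 p q o a b c : det3 p q o != 0 ->
  dot (coord2 p q o) (a *: p + b *: q + c *: o) = b.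
Proof.
move=> D; rewrite dotZl dot_cross.
have -> : forall v, det3 v o p = det3 p v o by move=> v; rewrite /det3; ring.
by rewrite det3_lin2 mulrCA mulVf // mulr1.
Qed.

Lemma dot_coord3 p q o a b c : det3 p q o != 0 ->
  dot (coord3 p q o) (a *: p + b *: q + c *: o) = c.
Proof.
move=> D; rewrite dotZl dot_cross.
have -> : forall v, det3 v p q = det3 p q v by move=> v; rewrite /det3; ring.
by rewrite det3_lin1 mulrCA mulVf // mulr1.
Qed.

Lemma dot_coords p q o v : det3 p q o != 0 ->
  v = dot (coord1 p q o) v *: p + dot (coord2 p q o) v *: q + dot (coord3 p q o) v *: o.
Proof.
move=> D; have [a [b [c e]]] := basis_span v D.
by rewrite {2 3 4}e dot_coord1 // dot_coord2 // dot_coord3.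
Qed.

Lemma dot_neq0 a : a != 0 -> exists v, dot a v != 0.
Proof.
move=> /row3_neq0 /or3P[h|h|h].
- by exists (delta_mx ord0 ord0); rewrite /dot sum3 !mxE /= !mulr0 !addr0 mulr1.
- by exists (delta_mx ord0 i1); rewrite /dot sum3 !mxE /= !mulr0 addr0 add0r mulr1.
by exists (delta_mx ord0 i2); rewrite /dot sum3 !mxE /= !mulr0 !add0r mulr1.
Qed.

Lemma evf_sum (I : Type) (r : seq I) (P : pred I) (G : I -> {mpoly K[3]}) v :
  evf (\sum_(i <- r | P i) G i) v = \sum_(i <- r | P i) evf (G i) v.
Proof. exact: raddf_sum. Qed.

Lemma evfZ c F v : evf (c *: F) v = c * evf F v.
Proof. exact: mevalZ. Qed.

Lemma evfX F k v : evf (F ^+ k) v = evf F v ^+ k.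
Proof. exact: rmorphXn. Qed.

(** X and Y are replaced by the quotients of the second and the third
    coordinate by the first one, whose powers clear the denominators. *)
Lemma homogenize n p q o (R : {poly {poly K}}) : det3 p q o != 0 -> tdeg_le n R ->
  exists2 Q : {mpoly K[3]}, Q \is n.-homog &
    forall x y, evf Q (p + x *: q + y *: o) = ev2 x y R.
Proof.
move=> D /tdeg_leP tR.
pose Q : {mpoly K[3]} := \sum_(i < n.+1) \sum_(j < n.+1 | (i + j <= n)%N) R`_i`_j *:
  (linf (coord1 p q o) ^+ (n - (i + j)) * linf (coord2 p q o) ^+ j
   * linf (coord3 p q o) ^+ i).
have hX (a : vec) k : linf a ^+ k \is k.-homog.
  by have := dhomogMn k (linf_homog a); rewrite mul1n.
exists Q.
  apply: rpred_sum => i _; apply: rpred_sum => j le; apply: rpredZ.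
  have e : n = (n - (i + j) + j + i)%N by rewrite -addnA [(j + i)%N]addnC subnK.
  by have := dhomogM (dhomogM (hX (coord1 p q o) (n - (i + j))%N) (hX (coord2 p q o) j))
    (hX (coord3 p q o) i); rewrite -e.
move=> x y; rewrite /Q evf_sum ev2_horner.
have szR : (size R <= n.+1)%N.
  apply/leq_sizeP => i lt; apply/polyP => j; rewrite coef0 tR //.
  by apply: leq_trans lt _; apply: leq_addr.
have szRi i : (size (R`_i)%R <= n.+1)%N.
  by apply/leq_sizeP => j lt; rewrite tR // (leq_trans lt) // leq_addl.
rewrite (horner_coef_wide _ szR) horner_sum; apply: eq_bigr => i _.
rewrite evf_sum hornerM -polyC_exp hornerC (horner_coef_wide _ (szRi i)) big_distrl /=.
rewrite [RHS](bigID (fun j : 'I_n.+1 => i + j <= n)%N) /= [X in _ = _ + X]big1 ?addr0.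
  apply: eq_bigr => j _; rewrite evfZ !evfM !evfX !evf_linf.
  have e : p + x *: q + y *: o = 1 *: p + x *: q + y *: o by rewrite scale1r.
  by rewrite e dot_coord1 // dot_coord2 // dot_coord3 // expr1n mul1r mulrA.
by move=> j; rewrite -ltnNge => lt; rewrite tR // !mul0r.
Qed.

(** The values off the line at infinity determine a form on every line
    transversal to it. *)
Lemma form_chart0 k p q o A : A \is k.-homog -> det3 p q o != 0 ->
  (forall x y, evf A (p + x *: q + y *: o) = 0) -> forall v, evf A v = 0.
Proof.
move=> hA D h v.
have H u : dot (coord1 p q o) u != 0 -> evf A u = 0.
  move=> un0; have e := dot_coords u D; set a := dot (coord1 p q o) u in un0 e.
  set b := dot _ u in e; set c := dot (coord3 _ _ _) u in e.
  have -> : u = a *: (p + (b / a) *: q + (c / a) *: o).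
    by rewrite {1}e !scalerDr !scalerA !mulrA ![a * _]mulrC !mulfK.
  by rewrite (evf_scale _ _ hA) h mulr0.
have : line A v p = 0.
  apply: (@poly_eq0_generic _ ((dot (coord1 p q o) v)%:P + 'X)).
    by rewrite -size_poly_eq0 addrC size_XaddC.
  move=> t; rewrite hornerD hornerC hornerX line_ev => tn0.
  apply: H; rewrite dotD dotZ.
  have -> : dot (coord1 p q o) p = 1.
    have -> : dot (coord1 p q o) p = dot (coord1 p q o) (1 *: p + 0 *: q + 0 *: o).
      by rewrite scale1r !scale0r !addr0.
    by rewrite dot_coord1.
  by rewrite mulr1.
by move/(congr1 (fun r => r.[0])); rewrite line_ev scale0r addr0 horner0.
Qed.

End LinearForms.

(** * Irreducibility and projective normality of the curve *)

Section Curve.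
Variable K : closedFieldType.
Hypothesis charK0 : [pchar K] =i pred0.
Variables (d : nat) (F : {mpoly K[3]}).
Hypothesis hd : (1 < d)%N.
Hypothesis hF : smooth_plane_curve d F.
Local Notation vec := 'rV[K]_3.
Implicit Types (u v w p q o : vec).

Let homF : F \is d.-homog := hF.1.
Let d0 : (0 < d)%N := ltnW hd.

Lemma smooth_grad v : v != 0 -> evf F v = 0 -> exists i, evf (F^`M(i)) v != 0.
Proof. by move=> v0 Fv; apply: (hF.2 v). Qed.

Lemma chart_neq0 p q o x y : det3 p q o != 0 -> p + x *: q + y *: o != 0.
Proof.
move=> D; apply: contraTneq D => e; rewrite negbK.
have := det3_lin3 p q o 1 x y; rewrite scale1r e mul1r => <-.
by rewrite /det3 !mxE !mul0r subrr addr0.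
Qed.

Lemma smooth2_ch p q o : det3 p q o != 0 -> smooth2 (chart F p q o).
Proof.
move=> D x y; rewrite ev2_ch fib_ch ch_horner !line_deriv => Fv.
rewrite [p + y *: o + _]addrAC; set v := p + x *: q + y *: o in Fv *.
have [go0|go0] := eqVneq (grad F v o) 0; last by left.
have [gq0|gq0] := eqVneq (grad F v q) 0; last by right.
have := grad_self0 homF Fv; rewrite {2}/v !gradD !gradZ go0 gq0 !mulr0 !addr0 => gp0.
have [i] := smooth_grad (chart_neq0 x y D) Fv.
by rewrite (grad_basis0 D gp0 gq0 go0) eqxx.
Qed.

Lemma curve_unit_point : exists o, evf F o = 1.
Proof.
have [v Fv] : exists v, evf F v != 0.
  apply: NNPP => h; have Fv v : evf F v = 0.
    by apply/eqP/negPn/negP => n; apply: h; exists v.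
  have v0 : (delta_mx ord0 ord0 : vec) != 0.
    by apply/eqP => /rowP /(_ ord0); rewrite !mxE /= => /eqP; rewrite oner_eq0.
  have [i] := smooth_grad v0 (Fv _).
  have gr w : grad F (delta_mx ord0 ord0) w = 0.
    rewrite -line_deriv0 (_ : line F _ w = 0) ?deriv0 ?horner0 //.
    by apply: poly_all_eq0 => t; rewrite line_ev.
  have [p [q D]] := complete_basis v0.
  by rewrite (grad_basis0 D (gr _) (gr _) (gr _)) eqxx.
have /closed_rootP [c] : size ('X^d - ((evf F v)^-1)%:P : {poly K}) != 1%N.
  by rewrite size_XnsubC // eqSS -lt0n.
rewrite rootE !hornerE subr_eq0 => /eqP hc.
by exists (c *: v); rewrite (evf_scale _ _ homF) hc mulVf.
Qed.

Lemma ch_monic p q o : evf F o = 1 -> chart F p q o \is monic /\ size (chart F p q o) = d.+1.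
Proof.
move=> o1; have [sz top] := ch_top p q o homF; rewrite o1 in top.
have szE : size (chart F p q o) = d.+1.
  apply/eqP; rewrite eqn_leq sz ltnNge; apply/negP => /leq_sizeP /(_ d (leqnn d)) /eqP.
  by rewrite top polyC1 oner_eq0.
by split=> //; rewrite monicE lead_coefE szE top.
Qed.

(** The point o is taken off the curve, so that the equation is monic in Y. The
    line at infinity is spanned by o and p + x0 q; for a general x0 it is
    transversal to the curve, because the general line through o is, and it
    avoids the given points. *)
Lemma good_chart_exists (vs : seq vec) :
  exists p q o, [/\ det3 p q o != 0, good_chart d (chart F p q o) &
    forall v, v \in vs -> v != 0 -> evf F v = 0 ->
      exists a b c, a != 0 /\ v = a *: p + b *: q + c *: o].
Proof.
have [o o1] := curve_unit_point.
have on0 : o != 0.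
  by apply: contra_eq_neq o1 => ->; rewrite (evf0 d0 homF) eq_sym oner_neq0.
have [p [q D]] := complete_basis on0.
have [mf szf] := ch_monic p q o1.
have [W Wn0 hW] := generic_separable charK0 mf (smooth2_ch D).
(* A root of [bad v] is a value of x0 for which v is at infinity. *)
pose bad (v : vec) : {poly K} :=
  (dot (coord2 p q o) v)%:P - (dot (coord1 p q o) v)%:P * 'X.
pose V := \prod_(v <- vs | bad v != 0) bad v.
have Vn0 : V != 0 by rewrite prodf_seq_neq0; apply/allP => v _; apply/implyP.
have /closed_nonrootP [x0] : W * V != 0 by rewrite mulf_neq0.
rewrite rootE hornerM mulf_eq0 negb_or => /andP[Wx Vx].
have D' : det3 q (p + x0 *: q) o != 0.
  by rewrite (_ : det3 _ _ _ = - det3 p q o) ?oppr_eq0 // /det3 !mxE; ring.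
exists q, (p + x0 *: q), o; split=> //.
  have [mf' szf'] := ch_monic q (p + x0 *: q) o1.
  split=> //; [exact: smooth2_ch | exact: ch_tdeg |].
  by rewrite (ch_flat_top _ _ _ homF) -fib_ch; apply: hW.
move=> v vin v0 Fv; have e := dot_coords v D.
set a := dot (coord1 p q o) v in e; set b := dot (coord2 p q o) v in e.
set c := dot _ _ in e.
exists (b - a * x0), a, c; split; last first.
  by rewrite e scalerDr !scalerA scalerBl; congr (_ + _); rewrite addrCA addrC subrK addrC.
have bn0 : bad v != 0.
  apply: contraNneq v0 => bad0.
  have b0 : b = 0.
    by have := congr1 (fun r : {poly K} => r.[0]) bad0; rewrite /bad hornerD hornerN hornerM !hornerC hornerX mulr0 subr0.
  have a0 : a = 0.
    have := congr1 (fun r : {poly K} => r.[1]) bad0; rewrite /bad hornerD hornerN hornerM !hornerC hornerX -/a -/b b0 mulr1 sub0r.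
    by move/eqP; rewrite oppr_eq0 => /eqP.
  move: e Fv; rewrite a0 b0 !scale0r !add0r => ->.
  rewrite (evf_scale _ _ homF) o1 mulr1 => /eqP.
  by rewrite expf_eq0 d0 /= => /eqP ->; rewrite scale0r.
have : (bad v).[x0] != 0.
  move: Vx; rewrite /V horner_prod prodf_seq_neq0 => /allP /(_ v vin).
  by move/implyP; apply.
by rewrite /bad !hornerE.
Qed.

Lemma chart_on_curve p q o x y : det3 p q o != 0 -> ev2 x y (chart F p q o) = 0 ->
  on_curve F (p + x *: q + y *: o).
Proof. by move=> D; rewrite ev2_ch => Fv; split=> //; apply: chart_neq0. Qed.

Lemma chart_scale p q o x y z : x != 0 ->
  x *: p + y *: q + z *: o = x *: (p + (y / x) *: q + (z / x) *: o).
Proof. by move=> xn0; rewrite !scalerDr !scalerA !mulrA ![x * _]mulrC !mulfK. Qed.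

Lemma chart_mult0 p q o x y z k (A : {mpoly K[3]}) : A \is k.-homog -> x != 0 ->
  evf F (x *: p + y *: q + z *: o) = 0 -> mult (chart F p q o) (chart A p q o) ->
  evf A (x *: p + y *: q + z *: o) = 0.
Proof.
move=> hA xn0; rewrite chart_scale // (evf_scale _ _ homF) (evf_scale _ _ hA) -!ev2_ch.
move=> /eqP + [Z ->]; rewrite rmorphM mulf_eq0 expf_eq0 (negPf xn0) andbF => /eqP ->.
by rewrite mul0r mulr0.
Qed.

(** A point where A is nonzero and one where B is nonzero are placed in the
    same good chart, where [good_chart_prime] applies. *)
Lemma curve_irreducible k l (A B : {mpoly K[3]}) :
  A \is k.-homog -> B \is l.-homog ->
  (forall v, on_curve F v -> evf A v * evf B v = 0) ->
  (forall v, on_curve F v -> evf A v = 0) \/ (forall v, on_curve F v -> evf B v = 0).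
Proof.
move=> hA hB hAB; apply: NNPP => /not_or_and [/not_all_ex_not [v1 h1] /not_all_ex_not [v2 h2]].
have {h1} [[v1n0 Fv1] /eqP A1] := imply_to_and _ _ h1.
have {h2} [[v2n0 Fv2] /eqP B2] := imply_to_and _ _ h2.
have [p [q [o [D gc hv]]]] := good_chart_exists [:: v1; v2].
have [mf szf sm _ _] := gc.
have : mult (chart F p q o) (chart A p q o * chart B p q o).
  apply: (vanishing_mult charK0 mf sm (oner_neq0 _)) => x y _ /(chart_on_curve D) cv.
  by rewrite -chM ev2_ch evfM hAB.
have key v e (E : {mpoly K[3]}) : E \is e.-homog -> v \in [:: v1; v2] -> v != 0 ->
    evf F v = 0 -> mult (chart F p q o) (chart E p q o) -> evf E v = 0.
  move=> hE vin vn0 Fv hm; have [x [y [z [xn0 ev]]]] := hv v vin vn0 Fv.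
  by rewrite ev in Fv *; apply: (chart_mult0 hE xn0 Fv hm).
case/(good_chart_prime charK0 d0 gc) => hm.
  by move/eqP: A1; apply; apply: (key v1 k) => //; rewrite inE eqxx.
by move/eqP: B2; apply; apply: (key v2 l) => //; rewrite !inE eqxx orbT.
Qed.

Lemma curve_irreducible' k l (A B : {mpoly K[3]}) :
  A \is k.-homog -> B \is l.-homog -> (exists2 v, on_curve F v & evf A v != 0) ->
  (forall v, on_curve F v -> evf A v * evf B v = 0) ->
  forall v, on_curve F v -> evf B v = 0.
Proof.
move=> hA hB [v cv Av] h; have [h'|//] := curve_irreducible hA hB h.
by rewrite h' ?eqxx in Av.
Qed.

(** In a chart with o off the curve, the degree in Y is lower than that of the
    equation. *)
Lemma low_degree_form k (A : {mpoly K[3]}) : (k < d)%N -> A \is k.-homog ->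
  (forall v, on_curve F v -> evf A v = 0) -> forall v, evf A v = 0.
Proof.
move=> lt hA h.
have [p [q [o [D [mf szf sm _ _] _]]]] := good_chart_exists [::].
apply: (form_chart0 hA D) => x y; rewrite -ev2_ch.
rewrite (@mult_small _ (chart F p q o) (chart A p q o)) ?rmorph0 //.
  by rewrite szf; apply: leq_ltn_trans (ch_top p q o hA).1 _; rewrite ltnS.
apply: (vanishing_mult charK0 mf sm (oner_neq0 _)) => x' y' _ /(chart_on_curve D) cv.
by rewrite ev2_ch h.
Qed.

Lemma low_degree_nonzero k (A : {mpoly K[3]}) : (k < d)%N -> A \is k.-homog ->
  (exists v, evf A v != 0) -> exists2 v, on_curve F v & evf A v != 0.
Proof.
move=> lt hA [v Av]; apply: NNPP => h; move: Av; rewrite (low_degree_form lt hA) ?eqxx //.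
by move=> w cw; apply/eqP/negPn/negP => n; apply: h; exists w.
Qed.

(** The points at infinity are handled by multiplying with the equation of the
    line at infinity, which does not vanish identically on the curve. *)
Lemma curve_from_chart p q o k (A : {mpoly K[3]}) : det3 p q o != 0 -> A \is k.-homog ->
  (forall x y, on_curve F (p + x *: q + y *: o) -> evf A (p + x *: q + y *: o) = 0) ->
  forall v, on_curve F v -> evf A v = 0.
Proof.
move=> D hA h; pose xi := linf (coord1 p q o).
have hxi : xi \is 1.-homog := linf_homog _.
apply: (curve_irreducible' hxi hA) => [|v [vn0 Fv]].
  apply: (low_degree_nonzero hd hxi); exists p.
  have -> : p = 1 *: p + 0 *: q + 0 *: o by rewrite scale1r !scale0r !addr0.
  by rewrite evf_linf dot_coord1 // oner_neq0.
rewrite evf_linf; have e := dot_coords v D; set x := dot (coord1 p q o) v in e *.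
have [->|xn0] := eqVneq x 0; first by rewrite mul0r.
set y := dot _ v in e; set z := dot (coord3 _ _ _) v in e.
rewrite chart_scale // in e; rewrite e (evf_scale _ _ hA) h ?mulr0 ?mulr0 //; split.
  exact: chart_neq0.
move: Fv; rewrite -/(evf F v) e (evf_scale _ _ homF) => /eqP.
by rewrite mulf_eq0 expf_eq0 (negPf xn0) andbF => /eqP.
Qed.

(** Projective normality: an element b / a of degree n that is integral over
    the homogeneous coordinate ring is the restriction of a form. In a good
    chart the irreducibility of the curve makes a prime to f, so that a divides
    some N(X) modulo f; [good_chart_normal] divides by N and bounds the total
    degree of the quotient, which can then be homogenised. *)
Lemma coordinate_ring_normal r n m (a b : {mpoly K[3]}) (c : nat -> {mpoly K[3]}) :
  a \is r.-homog -> b \is (n + r).-homog ->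
  (exists2 v, on_curve F v & evf a v != 0) ->
  c 0%N = 1 -> (forall i, (i <= m)%N -> c i \is (n * i).-homog) ->
  (forall v, on_curve F v -> evf (int_form m c a b) v = 0) ->
  exists2 Q : {mpoly K[3]}, Q \is n.-homog &
    forall v, on_curve F v -> evf a v * evf Q v = evf b v.
Proof.
move=> ha hb [v0 [v0n0 Fv0] av0] c0 hc hint.
have [p [q [o [D gc hv]]]] := good_chart_exists [:: v0].
have [mf szf sm _ _] := gc; set f := chart F p q o in gc mf szf sm.
have fn0 := monic_neq0 mf.
have hintf : mult f (int_form m (fun i => chart (c i) p q o) (chart a p q o) (chart b p q o)).
  apply: (vanishing_mult charK0 mf sm (oner_neq0 _)) => x y _ /(chart_on_curve D) cv.
  have := hint _ cv; rewrite -ev2_ch.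
  rewrite (_ : chart (int_form m c a b) p q o = int_form m (fun i => chart (c i) p q o) (chart a p q o) (chart b p q o)) //.
  exact: rmorph_int_form.
have na : ~ mult f (chart a p q o).
  move=> hm; have [x [y [z [xn0 e]]]] := hv v0 (mem_head _ _) v0n0 Fv0.
  by move: Fv0 av0; rewrite e => Fv /eqP; apply; apply: (chart_mult0 ha xn0 Fv hm).
have cop : coprimep f (chart a p q o).
  apply/coprimepP => g gf ga; rewrite -size_poly_eq1.
  have [c1 [h c1n0 ef]] := dvdp2P gf; have [c2 [a' c2n0 ea]] := dvdp2P ga.
  have gn0 : g != 0.
    apply: contraNneq (mulf_neq0 (_ : c1%:P != 0) fn0) => [g0|]; last by rewrite polyC_eq0.
    by rewrite ef g0 mulr0.
  have hn0 : h != 0.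
    apply: contraNneq (mulf_neq0 (_ : c1%:P != 0) fn0) => [g0|]; last by rewrite polyC_eq0.
    by rewrite ef g0 mul0r.
  have szgh : (size h + size g).-1 = size f.
    by rewrite -size_mul // -ef mul_polyC size_scale.
  have : mult f (h * g) by rewrite -ef; apply: multMl; exists 1; rewrite mulr1.
  case/(good_chart_prime charK0 d0 gc) => hm.
    have hsz : (size f <= size h)%N.
      by rewrite leqNgt; apply/negP => lt; move: hn0; rewrite (mult_small mf lt hm) eqxx.
    rewrite eqn_leq lt0n size_poly_eq0 gn0 andbT.
    by move: hsz; rewrite -szgh -subn1 leq_subLR addnC leq_add2r.
  case: na; apply: (mult_cancelC mf c2n0); rewrite ea; exact: multMl.
have [u [w [N Nn0 eN]]] := bezout2 cop.
have hG : mult f (int_form m (fun i => chart (c i) p q o) N%:P (w * chart b p q o)).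
  apply: cong_mult (multMl (w ^+ m) hintf); rewrite int_formM.
  apply: int_form_cong; last exact: cong_refl.
  by exists u; rewrite -eN; ring.
have c0' : chart (c 0%N) p q o = 1 by rewrite c0; apply: rmorph1.
have tc i : (i <= m)%N -> tdeg_le (n * i) (chart (c i) p q o).
  by move=> le; apply: ch_tdeg; apply: hc.
have [R cR tR] := good_chart_normal gc c0' tc Nn0 hG.
have haR : cong f (chart b p q o) (chart a p q o * R).
  apply: (mult_cancelC mf Nn0).
  have -> : N%:P * (chart b p q o - chart a p q o * R) =
     (u * f + w * chart a p q o) * chart b p q o - chart a p q o * (N%:P * R) by rewrite eN; ring.
  have -> : (u * f + w * chart a p q o) * chart b p q o - chart a p q o * (N%:P * R) =
    f * (u * chart b p q o) + chart a p q o * (w * chart b p q o - N%:P * R) by ring.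
  by apply: multD; [apply: mult_self | apply: multMl].
have [Q hQ eQ] := homogenize D tR.
exists Q => //.
have haQ : a * Q - b \is (n + r).-homog.
  by apply: rpredB => //; rewrite addnC; apply: dhomogM.
have h1 : forall v, on_curve F v -> evf (a * Q - b) v = 0.
  apply: (curve_from_chart D haQ) => x y [_ Fv].
  case: haR => Z hZ; have := congr1 (ev2 x y) hZ.
  rewrite rmorphB !rmorphM !ev2_ch [evf F _]Fv mul0r -eQ => /eqP; rewrite subr_eq0 => /eqP e.
  by rewrite evfB evfM e subrr.
by move=> v cv; apply/eqP; rewrite -subr_eq0 -evfM -evfB h1.
Qed.

(** Irreducibility is carried over to charts that are not transversal at
    infinity, such as those having a point of the curve at infinity. *)
Lemma chart_prime p q o (A B : {poly {poly K}}) : det3 p q o != 0 ->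
  chart F p q o \is monic -> mult (chart F p q o) (A * B) ->
  mult (chart F p q o) A \/ mult (chart F p q o) B.
Proof.
move=> D mf hAB; set f := chart F p q o in mf hAB *.
have sm : smooth2 f by apply: smooth2_ch.
have tdeg_ex (E : {poly {poly K}}) : exists n, tdeg_le n E.
  by exists (size (flat E)); apply: leqnSn.
have [na tA] := tdeg_ex A; have [nb tB] := tdeg_ex B.
have [A' hA eA] := homogenize D tA; have [B' hB eB] := homogenize D tB.
have hAB' : forall v, on_curve F v -> evf (A' * B') v = 0.
  apply: (curve_from_chart D (dhomogM hA hB)) => x y [_ Fv]; rewrite evfM eA eB -rmorphM.
  by case: hAB => Z ->; rewrite rmorphM ev2_ch [evf F _]Fv mul0r.
have [h|h] : (forall v, on_curve F v -> evf A' v = 0) \/ (forall v, on_curve F v -> evf B' v = 0).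
- by apply: (curve_irreducible hA hB) => v /hAB'; rewrite evfM.
- left; apply: (vanishing_mult charK0 mf sm (oner_neq0 _)) => x y _ /(chart_on_curve D) cv.
  by rewrite -eA h.
right; apply: (vanishing_mult charK0 mf sm (oner_neq0 _)) => x y _ /(chart_on_curve D) cv.
by rewrite -eB h.
Qed.

(** A graph Y = rho(X) inside the curve would be a proper component. *)
Lemma chart_no_section p q o (rho : {poly K}) : det3 p q o != 0 ->
  chart F p q o \is monic -> (2 < size (chart F p q o))%N -> (chart F p q o).[rho] != 0.
Proof.
move=> D mf; set f := chart F p q o in mf *; move=> szf.
apply/eqP => h; have /factor_theorem [g eg] : root f rho by apply/eqP.
have fn0 := monic_neq0 mf.
have gn0 : g != 0 by apply: contraNneq fn0 => g0; rewrite eg g0 mul0r.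
have ln0 : 'X - rho%:P != 0 by rewrite polyXsubC_eq0.
have szg : (size g).+1 = size f.
  by rewrite eg size_Mmonic ?monicXsubC // size_XsubC addn2.
have : mult f (g * ('X - rho%:P)) by exists 1; rewrite mulr1 -eg.
case/(chart_prime D mf) => /(mult_small mf).
  by rewrite -/f -szg ltnSn => /(_ isT) /eqP; rewrite (negPf gn0).
by rewrite size_XsubC szf => /(_ isT) /eqP; rewrite (negPf ln0).
Qed.

End Curve.

(** * Expansions along the lines through a point *)

Section Lines.
Variable K : closedFieldType.
Variables (d : nat) (F : {mpoly K[3]}).
Hypothesis homF : F \is d.-homog.
Local Notation vec := 'rV[K]_3.
Implicit Types (u v w p q o e : vec).

Definition gradv e : vec := \row_i evf (F^`M(i)) e.

Lemma dot_gradv e w : dot (gradv e) w = grad F e w.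
Proof. by apply: eq_bigr => i _; rewrite mxE mulrC. Qed.

Lemma size_line u w : (size (line F u w) <= d.+1)%N.
Proof. by have [] := lineR_top idfun (u ord0) (w ord0) homF. Qed.

Lemma line_recip u w j : (j <= d)%N -> (line F u w)`_(d - j) = (line F w u)`_j.
Proof.
move=> le; suff -> : line F w u = \poly_(i < d.+1) (line F u w)`_(d - i).
  by rewrite coef_poly ltnS le.
apply/eqP; rewrite -subr_eq0; apply/eqP.
apply: (poly_eq0_generic (negbT (polyX_eq0 K))) => t; rewrite hornerX => tn0.
apply/eqP; rewrite hornerD hornerN subr_eq0 line_ev horner_poly.
have -> : w + t *: u = t *: (u + t^-1 *: w).
  by rewrite scalerDr scalerA divff // scale1r addrC.
rewrite (evf_scale _ _ homF) -line_ev (horner_coef_wide _ (size_line u w)).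
rewrite big_distrr /= (reindex_inj rev_ord_inj) /=; apply/eqP; apply: eq_bigr => i _.
rewrite subSS mulrCA; congr (_ * _).
have le_i : (i <= d)%N by rewrite -ltnS.
have -> : t ^+ d = t ^+ i * t ^+ (d - i) by rewrite -exprD subnKC.
by rewrite exprVn mulfK ?expf_neq0.
Qed.

Lemma line_coef_grad e u : (0 < d)%N -> (line F u e)`_(d.-1) = grad F e u.
Proof.
move=> d0; rewrite -subn1 line_recip // -line_deriv0 horner_coef0 coef_deriv mulr1n //.
Qed.

Lemma line_coef_top e u : (line F u e)`_d = evf F e.
Proof.
have := @line_recip u e 0 (leq0n d); rewrite subn0 => ->.
by rewrite -horner_coef0 line_ev scale0r addr0.
Qed.

Lemma evf_pencil e u a b :
  evf F (a *: e + b *: u) = \sum_(j < d.+1) (line F e u)`_j * (b ^+ j * a ^+ (d - j)).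
Proof.
have [->|an0] := eqVneq a 0.
  rewrite scale0r add0r (evf_scale _ _ homF) big_ord_recr /= big1 => [|j _].
    by rewrite subnn expr0 mulr1 add0r line_coef_top mulrC.
  by rewrite expr0n subn_eq0 leqNgt ltn_ord /= !mulr0.
have -> : a *: e + b *: u = a *: (e + (b / a) *: u).
  by rewrite scalerDr scalerA mulrC divfK.
rewrite (evf_scale _ _ homF) -line_ev (horner_coef_wide _ (size_line e u)) big_distrr /=.
apply: eq_bigr => j _; rewrite mulrCA expr_div_n; congr (_ * _).
have le : (j <= d)%N by rewrite -ltnS.
have -> : a ^+ d = a ^+ j * a ^+ (d - j) by rewrite -exprD subnKC.
by field; rewrite expf_neq0.
Qed.

(** Taylor coefficients of z |-> F(v + z e), as forms in v. *)
Definition taylor e : {poly {mpoly K[3]}} :=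
  lineR (@mpolyC 3 K) (fun i => 'X_i) (fun i => (e ord0 i)%:MP) F.

Lemma tay_line e v j : evf (taylor e)`_j v = (line F v e)`_j.
Proof.
have <- : map_poly (meval (v ord0)) (taylor e) = line F v e.
  apply: mmap_morph => [c|i] /=; first by rewrite map_polyC /= mevalC.
  rewrite rmorphD rmorphM /= !map_polyC map_polyX /=.
  by congr (_%:P + _%:P * _); rewrite ?mevalXU ?mevalC.
by rewrite coef_map.
Qed.

Lemma tay_homog e j : (j <= d)%N -> (taylor e)`_j \is (d - j).-homog.
Proof.
pose H n (p : {poly {mpoly K[3]}}) := forall j, if (j <= n)%N then p`_j \is (n - j).-homog else p`_j == 0.
have HM n1 n2 g1 g2 : H n1 g1 -> H n2 g2 -> H (n1 + n2)%N (g1 * g2).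
  move=> h1 h2 k; case: leqP => le.
    rewrite coefM; apply: rpred_sum => i _.
    have := h1 i; have := h2 (k - i)%N.
    case: leqP => le2; last by move/eqP => -> _; rewrite mulr0 rpred0.
    case: leqP => le1; last by move=> _ /eqP ->; rewrite mul0r rpred0.
    move=> hom2 hom1.
    have -> : (n1 + n2 - k)%N = (n1 - i + (n2 - (k - i)))%N.
      have lik : (i <= k)%N by rewrite -ltnS.
      by move: le le1 le2 lik; clear; lia.
    exact: dhomogM.
  rewrite coefM big1 // => i _; have := h1 i; have := h2 (k - i)%N.
  case: (leqP i n1) => l1; last by move=> _ /eqP ->; rewrite mul0r.
  case: leqP => l2; last by move/eqP => -> _; rewrite mulr0.
  exfalso; move: le; rewrite ltnNge => /negP; apply.
  by move: l1 l2; clear; lia.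
have H1 : H 0%N 1.
  by move=> k; rewrite leqn0 coef1; case: eqP => [->|] //=; rewrite subnn dhomog1.
have HX n g k : H n g -> H (n * k)%N (g ^+ k).
  by move=> h; elim: k => [|k IH]; rewrite ?muln0 ?expr0 // exprS mulnS; apply: HM.
suff h : H d (taylor e) by move=> le; have := h j; rewrite le.
rewrite /taylor /lineR /mmap => k.
have HS : forall m, m \in msupp F -> H d ((polyC \o (@mpolyC 3 K)) F@_m *
    mmap1 (fun i => ('X_i)%:P + ((e ord0 i)%:MP)%:P * 'X) m).
  move=> m mF; rewrite -[d]add0n; apply: (HM).
    move=> i; rewrite leqn0 /= coefC; case: eqP => [->|] //=; rewrite subnn.
    by rewrite -[X in X%:MP]mulr1 mpolyCM mul_mpolyC rpredZ // mpolyC1 dhomog1.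
  have <- : mdeg m = d := dhomogP _ _ _ homF m mF.
  rewrite mdegE /mmap1; elim/big_ind2: _ => [|? ? ? ? h1 h2|i _]; [exact: H1|exact: (HM)|].
  have h1 : H 1%N (('X_i)%:P + ((e ord0 i)%:MP)%:P * 'X).
    move=> [|[|i']] /=.
    - by rewrite coefD coefC coefMX addr0 subn0 dhomogX /= mdeg1.
    - rewrite coefD coefC coefMX coefC add0r /= subnn.
      by rewrite -[X in X%:MP]mulr1 mpolyCM mul_mpolyC rpredZ // mpolyC1 dhomog1.
    by rewrite coefD coefC coefMX coefC add0r.
  by have := HX 1%N _ (m i) h1; rewrite mul1n.
elim: (msupp F : seq _) HS => [|m s IH] HS.
  by rewrite big_nil coef0; case: ifP; rewrite ?rpred0.
rewrite big_cons coefD; have h1 := HS m (mem_head _ _) k.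
have := IH (fun m' h => HS m' (mem_behead (s := m :: s) h)).
by case: leqP h1 => _ h1 h2; [apply: rpredD | rewrite (eqP h1) (eqP h2) addr0].
Qed.

End Lines.

(** * Rational maps preserving the lines through a point of the curve *)

Lemma perm_map_stable (T : eqType) (g : T -> T) (s : seq T) :
  injective g -> uniq s -> {in s, forall x, g x \in s} -> perm_eq (map g s) s.
Proof.
move=> inj us h; have um : uniq (map g s) by rewrite map_inj_uniq.
have sub : {subset map g s <= s} by move=> _ /mapP [x xs ->]; apply: h.
by apply: uniq_perm => //; have [] := uniq_min_size um sub; rewrite ?size_map.
Qed.

Section RootPermutation.
Variable K : closedFieldType.

(** The roots of p permuted by z |-> a z + b have the same discriminant and the
    same sum as before, which gives the first two equalities. *)
Lemma affine_root_map (p : {poly K}) (n : nat) (a b : K) :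
  (0 < n)%N -> p \is monic -> coprimep p p^`() -> size p = n.+1 -> a != 0 ->
  (forall z, p.[z] = 0 -> p.[a * z + b] = 0) ->
  [/\ a ^+ (n * n.-1) = 1,
      b *+ n = (a - 1) * p`_n.-1
    & forall z, p.[a * z + b] = a ^+ n * p.[z]].
Proof.
move=> n0 mp cop szp an0 h; have [rs urs ep] := separable_splits mp cop.
have szrs : size rs = n by move: szp; rewrite ep size_prod_XsubC => -[].
pose phi z := a * z + b.
have phi_inj : injective phi by move=> z w /addIr /(mulfI an0).
have zin z : (z \in rs) = (p.[z] == 0).
  by rewrite -rootE ep root_prod_XsubC.
have perm : perm_eq (map phi rs) rs.
  by apply: perm_map_stable => // z; rewrite !zin => /eqP /h ->.
split.
(* The discriminant, up to sign. *)
- pose P s := \prod_(z <- s) \prod_(w <- s | w != z) (z - w) : K.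
  have eP : P (map phi rs) = P rs.
    rewrite /P (perm_big _ perm) /=; apply: eq_bigr => z _; exact: perm_big.
  have Pn0 : P rs != 0.
    rewrite prodf_seq_neq0; apply/allP => z _ /=.
    by rewrite prodf_seq_neq0; apply/allP => w _; apply/implyP; rewrite subr_eq0 eq_sym.
  apply: (mulIf Pn0); rewrite mul1r -{2}eP /P big_map.
  have -> : a ^+ (n * n.-1) = \prod_(z <- rs) a ^+ n.-1.
    by rewrite big_const_seq count_predT szrs iter_mulr_1 -exprM mulnC.
  rewrite -big_split /= big_seq [RHS]big_seq; apply: eq_bigr => z zrs.
  rewrite big_map [in RHS](eq_bigl (fun w => w != z)); last by move=> w /=; rewrite (inj_eq phi_inj).
  have -> : a ^+ n.-1 = \prod_(w <- rs | w != z) a.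
    rewrite big_const_seq iter_mulr_1; congr (_ ^+ _).
    by have := count_predC (pred1 z) rs; rewrite count_uniq_mem // zrs szrs => <-.
  rewrite -big_split /=; apply: eq_bigr => w _; rewrite /phi; ring.
- case: n n0 szp szrs => [//|n] _ szp szrs /=.
  have -> : p`_n = - \sum_(z <- rs) z.
    by have := coefPn_prod_XsubC (ps := rs); rewrite szrs -ep => ->.
  have : \sum_(z <- rs) phi z = \sum_(z <- rs) z by rewrite -(big_map phi predT id) (perm_big _ perm).
  rewrite /phi big_split /= -big_distrr /= big_const_seq count_predT szrs iter_addr_0 => e.
  by apply: (addrI (a * \sum_(z <- rs) z)); rewrite e; ring.
move=> z; rewrite ep !horner_prod.
have -> : \prod_(w <- rs) ('X - w%:P).[a * z + b] = \prod_(w <- rs) ('X - (phi w)%:P).[a * z + b].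
  by rewrite -(perm_big _ perm) big_map.
have -> : a ^+ n = \prod_(w <- rs) a by rewrite big_const_seq count_predT szrs iter_mulr_1.
rewrite -big_split /=; apply: eq_bigr => w _; rewrite !hornerXsubC /phi; ring.
Qed.
End RootPermutation.

Section Tangent.
Variable K : closedFieldType.
Hypothesis charK0 : [pchar K] =i pred0.
Variables (d : nat) (F : {mpoly K[3]}).
Hypothesis hd : (4 <= d)%N.
Hypothesis hF : smooth_plane_curve d F.
Local Notation vec := 'rV[K]_3.
Variable e : vec.
Hypothesis he : on_curve F e.
Implicit Types (u v w : vec).

Let homF : F \is d.-homog := hF.1.
Let hd1 : (1 < d)%N := ltnW (ltnW hd).
Let d0 : (0 < d)%N := ltnW hd1.
Let Fe : evf F e = 0 := he.2.

Lemma tangent_basis : exists e1 e2 : vec,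
  [/\ det3 e1 e2 e != 0, grad F e e1 = 1 & grad F e e2 = 0].
Proof.
have [p [q D]] := complete_basis he.1.
have ge : grad F e e = 0 := grad_self0 homF Fe.
have [gp|gp] := eqVneq (grad F e p) 0; last first.
  exists ((grad F e p)^-1 *: p), (q - (grad F e q / grad F e p) *: p); split.
  - rewrite (_ : det3 _ _ _ = (grad F e p)^-1 * det3 p q e) ?mulf_neq0 ?invr_neq0 //.
    rewrite /det3 !mxE; ring.
  - by rewrite gradZ mulVf.
  by rewrite -scaleNr gradD gradZ mulNr mulfVK // subrr.
have gq : grad F e q != 0.
  apply: contraTneq isT => gq; have [i] := smooth_grad hF he.1 Fe.
  by rewrite (grad_basis0 D gp gq ge) eqxx.
exists ((grad F e q)^-1 *: q), p; split=> //; last by rewrite gradZ mulVf.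
rewrite (_ : det3 _ _ _ = - ((grad F e q)^-1 * det3 p q e)) ?oppr_eq0 ?mulf_neq0 ?invr_neq0 //.
rewrite /det3 !mxE; ring.
Qed.

Variables e1 e2 : vec.
Hypothesis D : det3 e1 e2 e != 0.
Hypothesis ge1 : grad F e e1 = 1.
Hypothesis ge2 : grad F e e2 = 0.

(* The coordinates dual to e1, e2, e: the tangent at e is xx = 0, and the lines
   through e are the vertical lines of the chart. *)
Notation xx := (coord1 e1 e2 e).
Notation yy := (coord2 e1 e2 e).
Notation zz := (coord3 e1 e2 e).
Notation f := (chart F e1 e2 e).

Lemma dot_xx_grad v : dot xx v = grad F e v.
Proof.
have := dot_coords v D; set a := dot xx v; set b := dot yy v; set c := dot zz v => ->.
by rewrite !gradD !gradZ ge1 ge2 (grad_self0 homF Fe) !mulr0 !addr0 mulr1.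
Qed.

Lemma chart1 t z : e1 + t *: e2 + z *: e = 1 *: e1 + t *: e2 + z *: e.
Proof. by rewrite scale1r. Qed.

Lemma xx_chart t z : dot xx (e1 + t *: e2 + z *: e) = 1.
Proof. by rewrite chart1 dot_coord1. Qed.

Lemma yy_chart t z : dot yy (e1 + t *: e2 + z *: e) = t.
Proof. by rewrite chart1 dot_coord2. Qed.

Lemma zz_chart t z : dot zz (e1 + t *: e2 + z *: e) = z.
Proof. by rewrite chart1 dot_coord3. Qed.

(** The vertical lines of this chart are the lines through e. Since e is on the
    curve the degree drops by one, and the next coefficient is the equation of
    the tangent at e, which takes the value 1 on e1 + t e2. *)
Lemma point_f_monic : f \is monic /\ size f = d.
Proof.
have [sz top] := ch_top e1 e2 e homF; rewrite Fe polyC0 in top.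
have szd : (size f <= d)%N.
  apply/leq_sizeP => j; rewrite leq_eqVlt => /orP[/eqP <- //|lt].
  by rewrite nth_default // (leq_trans sz).
have cD : f`_(d.-1) = 1.
  apply: poly_all_eq => t; have := line_coef_grad homF e (e1 + t *: e2) d0.
  by rewrite -fib_ch coef_map /= gradD gradZ ge1 ge2 mulr0 addr0 /horner_eval => ->; rewrite hornerC.
have szE : size f = d.
  apply/eqP; rewrite eqn_leq szd leqNgt; apply/negP => lt.
  have : (size f <= d.-1)%N by rewrite -ltnS prednK.
  by move/leq_sizeP /(_ _ (leqnn _)) /eqP; rewrite cD oner_eq0.
by split=> //; rewrite monicE lead_coefE szE cD.
Qed.

Let mf : f \is monic := point_f_monic.1.
Let szf : size f = d := point_f_monic.2.

Lemma no_section (rho : {poly K}) : f.[rho] != 0.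
Proof.
by apply: (chart_no_section charK0 hd1 hF rho D mf); rewrite szf; apply: ltnW.
Qed.

Let X : {mpoly K[3]} := linf xx.
Let homX : X \is 1.-homog := linf_homog _.

Lemma X_nonzero_on_curve : exists2 v, on_curve F v & evf X v != 0.
Proof.
apply: (low_degree_nonzero charK0 hd1 hF hd1 homX); exists (e1 + 0 *: e2 + 0 *: e).
by rewrite evf_linf xx_chart oner_neq0.
Qed.

(** Identities on the curve need only be checked off the tangent at e. *)
Lemma X_cancel k (B : {mpoly K[3]}) : B \is k.-homog ->
  (forall v, on_curve F v -> dot xx v * evf B v = 0) ->
  forall v, on_curve F v -> evf B v = 0.
Proof.
move=> hB h; apply: (curve_irreducible' charK0 hd1 hF homX hB X_nonzero_on_curve).
by move=> v cv; rewrite evf_linf h.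
Qed.

(** If v + theta e is on the curve, q = x theta satisfies an equation of degree
    d - 1 with these coefficients: the i-th one is x^(i-1) times the (d-1-i)-th
    Taylor coefficient of F at v along e. The equation is monic because the
    (d-1)-st Taylor coefficient is x itself. *)
Definition tcoef (i : nat) : {mpoly K[3]} :=
  if i is j.+1 then (taylor F e)`_(d.-1 - i) * X ^+ j else 1.

Lemma tcoef_homog i : (i <= d.-1)%N -> tcoef i \is (2 * i).-homog.
Proof.
case: i => [|j] le; first by rewrite muln0 dhomog1.
have h1 : (taylor F e)`_(d.-1 - j.+1) \is (d - (d.-1 - j.+1)).-homog.
  apply: tay_homog => //; lia.
have h2 : X ^+ j \is (1 * j).-homog by apply: dhomogMn.
have := dhomogM h1 h2; rewrite (_ : (d - (d.-1 - j.+1) + 1 * j)%N = (2 * j.+1)%N) //; lia.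
Qed.

Lemma evf_tcoef i v : evf (tcoef i) v =
  if i is j.+1 then (line F v e)`_(d.-1 - i) * dot xx v ^+ j else 1.
Proof.
case: i => [|j]; first exact: rmorph1.
by rewrite /tcoef evfM evfX evf_linf tay_line.
Qed.

Lemma tcoef_eval v q : dot xx v != 0 ->
  int_form d.-1 (fun i => evf (tcoef i) v) 1 q =
  dot xx v ^+ (d.-2) * evf F (v + (q / dot xx v) *: e).
Proof.
move=> xn0; set x := dot xx v in xn0 *.
have [D' eD] : exists D', d = D'.+2 by exists d.-2; move: hd; lia.
have szl : (size (line F v e) <= d)%N.
  apply/leq_sizeP => j; rewrite leq_eqVlt => /orP[/eqP <-|lt].
    by rewrite line_coef_top.
  by rewrite nth_default // (leq_trans (size_line homF _ _)).
rewrite -line_ev (horner_coef_wide _ szl) {1}eD /= big_distrr /=.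
rewrite /int_form; have -> : d.-2 = D' by rewrite eD.
rewrite (_ : \sum_(i < d) _ = \sum_(i < D'.+2) x ^+ D' * ((line F v e)`_i * (q / x) ^+ i)); last first.
  by rewrite eD.
rewrite [RHS](reindex_inj rev_ord_inj) /=; apply: eq_bigr => -[[|j] lt] _; rewrite evf_tcoef /=.
  rewrite expr0 mulr1 subn0 mul1r !subSS subn0.
  have -> : (line F v e)`_D'.+1 = x.
    by have := line_coef_grad homF e v d0; rewrite eD /= => ->; rewrite /x dot_xx_grad.
  by rewrite expr_div_n !exprS; field; rewrite expf_neq0.
rewrite expr1n mulr1 -/x eD /= !subSS.
have -> : x ^+ D' = x ^+ j * x ^+ (D' - j) by rewrite -exprD subnKC //; move: lt; lia.
by rewrite expr_div_n; field; rewrite expf_neq0.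
Qed.

Definition tangent_relation (Q : {mpoly K[3]}) v : K :=
  int_form d.-1 (fun i => evf (tcoef i) v) 1 (evf Q v).

Definition formA (A : 'I_3 -> {mpoly K[3]}) (a : vec) : {mpoly K[3]} :=
  \sum_i a ord0 i *: A i.

Lemma evf_formA A a v : evf (formA A a) v = dot a (eval3 A v).
Proof. by rewrite evf_sum; apply: eq_bigr => i _; rewrite evfZ mxE. Qed.

Lemma formA_homog A a r : (forall i, A i \is r.-homog) -> formA A a \is r.-homog.
Proof. by move=> h; apply: rpred_sum => i _; apply: rpredZ. Qed.

Lemma evf_int_form m (c : nat -> {mpoly K[3]}) x g v :
  evf (int_form m c x g) v = int_form m (fun i => evf (c i) v) (evf x v) (evf g v).
Proof. exact: rmorph_int_form. Qed.

Section Quadric.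
Variables (A : 'I_3 -> {mpoly K[3]}) (r : nat).
Hypothesis homA : forall i, A i \is r.-homog.
Hypothesis A_on : forall v, on_curve F v -> evf F (eval3 A v) = 0.
Hypothesis A_fib : forall v, on_curve F v ->
  dot xx (eval3 A v) * dot yy v = dot yy (eval3 A v) * dot xx v.
Hypothesis A_nc : exists2 v, on_curve F v & dot xx (eval3 A v) != 0.

(** The point A(v) is proportional to v + theta e with theta = (x z(A) - z
    x(A)) / x(A). As F vanishes at A(v), the function x theta is integral by
    [tcoef_eval], hence the restriction of a form of degree 2. *)
Lemma quadric_exists : exists Q : {mpoly K[3]}, [/\ Q \is 2.-homog,
  forall v, on_curve F v -> dot xx (eval3 A v) * evf Q v =
    dot xx v * (dot xx v * dot zz (eval3 A v) - dot zz v * dot xx (eval3 A v))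
  & forall v, on_curve F v -> tangent_relation Q v = 0].
Proof.
pose a := formA A xx.
pose b := X * (X * formA A zz - linf zz * a).
have ha : a \is r.-homog := formA_homog _ homA.

have hb : b \is (2 + r).-homog.
  rewrite -[(2 + r)%N]/(1 + (1 + r))%N; apply: dhomogM => //; apply: rpredB.
    by apply: dhomogM => //; apply: formA_homog.
  by apply: dhomogM => //; apply: linf_homog.
have an0 : exists2 v, on_curve F v & evf a v != 0.
  by have [v cv h] := A_nc; exists v => //; rewrite evf_formA.
have evb v : evf b v = dot xx v * (dot xx v * dot zz (eval3 A v) - dot zz v * dot xx (eval3 A v)).
  by rewrite evfM evfB !evfM !evf_linf !evf_formA.
have hc i : (i <= d.-1)%N -> tcoef i \is (2 * i).-homog by apply: tcoef_homog.
have homI (p q : {mpoly K[3]}) k : p \is k.-homog -> q \is (2 + k).-homog ->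
    int_form d.-1 tcoef p q \is ((2 + k) * d.-1).-homog.
  move=> hp hq; apply: rpred_sum => i _.
  have le : (i <= d.-1)%N by rewrite -ltnS.
  have := dhomogM (dhomogM (hc i le) (dhomogMn i hp)) (dhomogMn (d.-1 - i) hq).
  rewrite (_ : (2 * i + k * i + (2 + k) * (d.-1 - i))%N = ((2 + k) * d.-1)%N) //.
  by rewrite -mulnDl -mulnDr subnKC.
have hint v : on_curve F v -> evf (int_form d.-1 tcoef a b) v = 0.
  have homXa : X * a \is (1 + r).-homog by apply: dhomogM.
  have homab := homI a b r ha hb.
  have Xan0 : exists2 v, on_curve F v & evf (X * a) v != 0.
    apply: NNPP => h.
    have h0 u : on_curve F u -> evf a u = 0.
      apply: (X_cancel ha) => {}u cu; apply/eqP/negPn/negP => nz.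
      by apply: h; exists u => //; rewrite evfM evf_linf.
    by have [u cu] := an0; rewrite h0 ?eqxx.
  move: v; apply: (curve_irreducible' charK0 hd1 hF homXa homab Xan0) => v cv.
  rewrite evfM evf_linf evf_formA evf_int_form evf_formA evb.
  set x := dot xx v; set y := dot yy v; set z := dot zz v.
  set ax := dot xx (eval3 A v); set az := dot zz (eval3 A v).
  have [->|xn0] := eqVneq x 0; first by rewrite !mul0r.
  have [->|an0'] := eqVneq ax 0; first by rewrite mulr0 mul0r.
  have -> : x * (x * az - z * ax) = ax * (x * (x * az - z * ax) / ax) by rewrite [RHS]mulrC divfK.
  rewrite -[X in int_form _ _ X _]mulr1 -int_formM.
  rewrite tcoef_eval // -/x.
  have -> : v + (x * (x * az - z * ax) / ax / x) *: e = (x / ax) *: eval3 A v.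
    have ev := dot_coords v D; have eA := dot_coords (eval3 A v) D.
    rewrite -/x -/y -/z in ev; rewrite -/ax -/az in eA.
    rewrite {1}ev {1}eA !scalerDr !scalerA divfK // -addrA -scalerDl.
    have -> : x / ax * dot yy (eval3 A v) = y.
      rewrite mulrAC; apply: (mulIf an0'); rewrite divfK // mulrC -A_fib //.
      by rewrite mulrC.
    by congr (_ + _ + _ *: _); field; apply/andP.
  by rewrite (evf_scale _ _ homF) A_on // !mulr0.
have [Q hQ eQ] := coordinate_ring_normal charK0 hd1 hF ha hb an0 (erefl : tcoef 0%N = 1) hc hint.
exists Q; split=> // [v cv|].
  by rewrite -evb -eQ // evf_formA.
have homE : int_form d.-1 tcoef 1 Q \is (2 * d.-1).-homog.
  by have := homI 1 Q 0%N (dhomog1 _ _) hQ; rewrite addn0.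
have homam : a ^+ d.-1 \is (r * d.-1).-homog by apply: dhomogMn.
move=> v cv; have : evf (int_form d.-1 tcoef 1 Q) v = 0.
  move: v cv; apply: (curve_irreducible' charK0 hd1 hF homam homE).
    by have [v cv av] := an0; exists v => //; rewrite evfX expf_neq0.
  move=> v cv; rewrite -evfM int_formM mulr1 evf_int_form evfM eQ //.
  by rewrite -evf_int_form hint.
have ev1 : evf (1 : {mpoly K[3]}) v = 1 by exact: rmorph1.
by rewrite evf_int_form ev1.
Qed.
End Quadric.

Variable Q : {mpoly K[3]}.
Hypothesis hQ : Q \is 2.-homog.
Hypothesis EQ0 : forall v, on_curve F v -> tangent_relation Q v = 0.

(** At v = e every coefficient of the equation but the leading one vanishes. *)
Lemma Q_centre : evf Q e = 0.
Proof.
have l0 : line F e e = 0.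
  apply: poly_all_eq0 => t; rewrite line_ev -{1}(scale1r e) -scalerDl.
  by rewrite (evf_scale _ _ homF) Fe mulr0.
have := EQ0 he; rewrite /tangent_relation /int_form big_ord_recl big1 ?addr0 => [|i _].
  rewrite evf_tcoef expr0 !mul1r subn0 => /eqP.
  by rewrite expf_eq0 => /andP[_ /eqP].
by rewrite lift0 evf_tcoef l0 coef0 !mul0r.
Qed.

Let cQ := chart Q e1 e2 e.
(* On the line through e with parameter t the map is z |-> L(t) z + m(t). *)
Let m : {poly K} := cQ`_0.
Let L : {poly K} := 1 + cQ`_1.

Lemma size_cQ : (size cQ <= 2)%N.
Proof.
have [sz top] := ch_top e1 e2 e hQ; rewrite Q_centre polyC0 in top.
apply/leq_sizeP => j; rewrite leq_eqVlt => /orP[/eqP <- //|lt].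
by rewrite nth_default // (leq_trans sz).
Qed.

Lemma Q_chart t z : evf Q (e1 + t *: e2 + z *: e) = m.[t] + (cQ`_1).[t] * z.
Proof.
rewrite -ev2_ch ev2_horner -/cQ (horner_coef_wide _ size_cQ) !big_ord_recl big_ord0 /=.
by rewrite expr0 mulr1 addr0 /bump /= expr1 hornerD hornerM hornerC.
Qed.

Lemma root_map t z : ev2 t z f = 0 -> ev2 t (L.[t] * z + m.[t]) f = 0.
Proof.
move=> fz; have cv := chart_on_curve D fz; have := EQ0 cv.
rewrite /tangent_relation tcoef_eval; last by rewrite xx_chart // oner_neq0.
rewrite xx_chart // expr1n mul1r divr1 Q_chart -addrA -scalerDl => <-.
by rewrite ev2_ch; congr (evf F (_ + _ *: e)); rewrite /L hornerD hornerC; ring.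
Qed.

Lemma ev2_section (rho : {poly K}) t : f.[rho].[t] = ev2 t rho.[t] f.
Proof.
rewrite /ev2 /= /horner_eval.
by have := horner_map (horner_eval t) f rho; rewrite /= /horner_eval => <-.
Qed.

(** Otherwise the graph z = m(t) would lie on the curve. *)
Lemma L_neq0 : L != 0.
Proof.
apply/eqP => L0; move: (no_section m); rewrite -/f.
apply/negP; rewrite negbK; apply/eqP/poly_all_eq0 => t; rewrite ev2_section.
have /closed_rootP [z rz] : size (fib t f) != 1%N.
  by rewrite size_fib_monic // szf; move: hd; lia.
have fz : ev2 t z f = 0 by apply/eqP.
by have := root_map fz; rewrite L0 horner0 mul0r add0r.
Qed.

(** A general line through e meets the curve in d - 1 further points, which the
    map permutes. *)
Lemma fibre_map : exists2 W : {poly K}, W != 0 & forall t, W.[t] != 0 ->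
  [/\ L.[t] ^+ (d.-1 * d.-2) = 1,
      m.[t] *+ d.-1 = (L.[t] - 1) * (f`_d.-2).[t]
    & forall z, ev2 t (L.[t] * z + m.[t]) f = L.[t] ^+ d.-1 * ev2 t z f].
Proof.
have [W Wn0 hW] := generic_separable charK0 mf (smooth2_ch hF D).
exists (W * L); first by rewrite mulf_neq0 // L_neq0.
move=> t; rewrite hornerM mulf_eq0 negb_or => /andP[Wt Lt].
have n0 : (0 < d.-1)%N by move: hd; lia.
have sz : size (fib t f) = d.-1.+1 by rewrite size_fib_monic // szf prednK.
have [h1 h2 h3] := affine_root_map n0 (fib_monic t mf) (hW t Wt) sz Lt
  (fun z => @root_map t z).
split=> //; first by rewrite h2 coef_map.
Qed.

(** A polynomial with a power equal to 1 is a constant. *)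
Lemma L_const : exists2 a : K, L = a%:P & a ^+ (d.-1 * d.-2) = 1.
Proof.
have [W Wn0 hW] := fibre_map; set k := (d.-1 * d.-2)%N in hW *.
have k0 : (0 < k)%N by rewrite muln_gt0; move: hd; lia.
have Lk : L ^+ k = 1.
  apply/eqP; rewrite -subr_eq0; apply/eqP; apply: (poly_eq0_generic Wn0) => t /hW [h _ _].
  by rewrite hornerD hornerN horner_exp hornerC h subrr.
have sL : size L == 1%N.
  have := size_exp L k; rewrite Lk size_poly1 /= => /esym/eqP.
  rewrite muln_eq0 (gtn_eqF k0) orbF => /eqP h.
  by move: L_neq0; rewrite -size_poly_eq0; case: (size L) h => [|[]].
have /size_poly1P [a an0 eL] := sL; exists a => //.
by have := congr1 (fun p : {poly K} => p.[0]) Lk; rewrite eL horner_exp !hornerC.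
Qed.

Lemma m_eq : m *+ d.-1 = (L - 1) * f`_d.-2.
Proof.
have [W Wn0 hW] := fibre_map.
apply/eqP; rewrite -subr_eq0; apply/eqP; apply: (poly_eq0_generic Wn0) => t /hW [_ h _].
by rewrite hornerD hornerN hornerMn h hornerM (hornerD L) hornerN hornerC subrr.
Qed.

Lemma natK_unit n : (1 < n)%N -> forall k, (0 < k)%N -> (n%:R : K) ^+ k != 1.
Proof.
move=> n1 k k0; rewrite -natrX -[X in _ != X]/(1%:R) -subr_eq0 -natrB ?expn_gt0 ?(ltnW n1) // natK_eq0 //.
by rewrite subn_eq0 -ltnNge -(exp1n k) ltn_exp2r.
Qed.

(** The quadratic coefficient of m is the value of q at the further points of
    the tangent at e. There the equation of q reduces to q + c = 0, where c is
    the leading coefficient of F on the tangent, while the sum of the roots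
    gives (d - 1) q = (a - 1) c. Then a = 2 - d, which is not a root of unity. *)
Lemma m_coef2 : m`_2 = 0.
Proof.
have [a eL ak] := L_const; have em := m_eq; rewrite eL in em.
apply/eqP/negPn/negP => m2n0.
set c := f`_d.-2`_2.
have em2 : m`_2 *+ d.-1 = (a - 1) * c.
  have := congr1 (fun p : {poly K} => p`_2) em.
  by rewrite coefMn -polyC1 -polyCB coefCM.
have cn0 : c != 0.
  apply: contraNneq m2n0 => c0; move: em2; rewrite c0 mulr0 -mulr_natr => /eqP.
  by rewrite mulf_eq0 natK_eq0 // => /orP[//|]; move: hd; lia.
have lcoef j : (j <= d)%N -> (line F e2 e)`_j = f`_j`_(d - j).
  by move=> le; rewrite -(ch_flat_top e1 e2 e homF) coef_flat le.
(* The line through e2 and e is tangent: F has degree d - 2 on it. *)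
have szl : size (line F e2 e) = d.-1.
  apply/eqP; rewrite eqn_leq; apply/andP; split.
    apply/leq_sizeP => j; rewrite leq_eqVlt => /orP[/eqP <-|lt].
      by rewrite line_coef_grad // ge2.
    case: (ltngtP j d) => [lt2|lt2|->]; last by rewrite line_coef_top.
      by move: lt lt2; lia.
    by rewrite nth_default // (leq_trans (size_line homF _ _)).
  rewrite leqNgt; apply/negP => lt.
  have dd : d.-1 = d.-2.+1 by move: hd; lia.
  have : (line F e2 e)`_d.-2 = 0 by apply: nth_default; rewrite -ltnS -dd.
  rewrite lcoef; last by move: hd; lia.
  rewrite (_ : (d - d.-2 = 2)%N); last by move: hd; lia.
  by move/eqP; rewrite (negPf cn0).
have /closed_rootP [z] : size (line F e2 e) != 1%N by rewrite szl; move: hd; lia.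
rewrite rootE line_ev => /eqP Fv; set v := e2 + z *: e in Fv.
have vE : v = 0 *: e1 + 1 *: e2 + z *: e by rewrite scale0r scale1r add0r.
have xv : dot xx v = 0 by rewrite vE dot_coord1.
have vn0 : v != 0.
  apply: contraTneq isT => v0; have := dot_coord2 0 1 z D; rewrite -vE v0 dot0r => /eqP.
  by rewrite eq_sym oner_eq0.
have Qv : evf Q v = m`_2.
  rewrite /v -line_ev -(ch_flat_top e1 e2 e hQ).
  have -> : (flat (chart Q e1 e2 e))`_2 = (m`_2)%:P.
    apply/polyP => j; rewrite coef_flat coefC -/cQ; case: j => [|[|[|j]]] //=.
      have -> : cQ`_1 = (a - 1)%:P by rewrite polyCB -eL /L addrAC subrr add0r.
      by rewrite coefC.
    by rewrite (nth_default 0 size_cQ) coef0.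
  by rewrite hornerC.
have lc : (line F v e)`_d.-2 = c.
  have -> : line F v e = line F e2 e \Po ('X + z%:P).
    apply: poly_all_eq => t; rewrite horner_comp line_ev hornerD hornerX hornerC line_ev.
    by rewrite /v scalerDl [t *: e + _]addrC addrA.
  have sz2 : size (line F e2 e \Po ('X + z%:P)) = d.-1.
    by rewrite size_comp_poly2 ?szl // size_XaddC.
  have -> : d.-2 = (size (line F e2 e \Po ('X + z%:P))).-1 by rewrite sz2.
  rewrite -lead_coefE lead_coef_comp ?size_XaddC // lead_coefXaddC expr1n mulr1.
  rewrite lead_coefE szl lcoef; last by move: hd; lia.
  by rewrite (_ : (d - d.-2 = 2)%N) //; move: hd; lia.
have := EQ0 (conj vn0 Fv).
rewrite /tangent_relation /int_form (_ : d.-1.+1 = d.-2.+2); last by move: hd; lia.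
rewrite !big_ord_recl big1 ?addr0 => [|i _]; last first.
  by rewrite !lift0 evf_tcoef xv expr0n /= mulr0 !mul0r.
rewrite lift0 !evf_tcoef !subn0 !expr0 expr1n !mulr1 mul1r Qv subn1 -/(d.-2) lc.
have -> : d.-1 = d.-2.+1 by move: hd; lia.
rewrite exprS /= -mulrDl => /eqP; rewrite mulf_eq0 expf_eq0 (negPf m2n0) andbF orbF addr_eq0.
move/eqP => ec.
have ea : a = - (d.-2)%:R.
  have dd : (d.-1)%:R = (d.-2)%:R + 1 :> K.
    by rewrite natr1; congr (_%:R); move: hd; lia.
  apply: (mulIf cn0); have -> : a * c = (a - 1) * c + c by ring.
  rewrite -em2 ec -(mulr_natl (- c) d.-1) dd; ring.
have n1 : (1 < d.-2)%N by move: hd; lia.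
have k0 : (0 < 2 * (d.-1 * d.-2))%N by rewrite !muln_gt0; move: hd; lia.
by have := natK_unit n1 k0; rewrite exprM -sqrrN -ea -exprM mulnC exprM ak expr1n eqxx.
Qed.

(** L = a and m has degree at most 1, so that q = x mu for a linear form mu.
    The map v |-> v + mu(v) e multiplies F by a^(d-1). This factor is 1: if a
    <> 1, the points with mu = 0 are fixed, and they do not all lie on the
    curve. *)
Lemma quadric_shape : exists mu : vec,
  [/\ forall v, evf Q v = dot xx v * dot mu v,
      forall v, evf F (v + dot mu v *: e) = evf F v
    & 1 + dot mu e != 0].
Proof.
have [a eL ak] := L_const.
have an0 : a != 0 by have := L_neq0; rewrite eL polyC_eq0.
have eL1 : cQ`_1 = (a - 1)%:P by rewrite polyCB -eL /L addrAC subrr add0r.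
have mt t : m.[t] = m`_0 + m`_1 * t.
  have sz : (size m <= 2)%N.
    apply/leq_sizeP => j; rewrite leq_eqVlt => /orP[/eqP <-|lt]; first exact: m_coef2.
    by have /tdeg_leP := ch_tdeg e1 e2 e hQ; apply; rewrite add0n.
  by rewrite (horner_coef_wide _ sz) !big_ord_recl big_ord0 /= expr0 mulr1 addr0.
pose mu : vec := (a - 1) *: zz + m`_0 *: xx + m`_1 *: yy.
have muE v : dot mu v = (a - 1) * dot zz v + m`_0 * dot xx v + m`_1 * dot yy v.
  by rewrite !dotDl !dotZl.
have mu_chart t z : dot mu (e1 + t *: e2 + z *: e) = (a - 1) * z + m.[t].
  by rewrite muE xx_chart // yy_chart // zz_chart // mt; ring.
have mue : dot mu e = a - 1.
  have ee : 0 *: e1 + 0 *: e2 + 1 *: e = e by rewrite !scale0r scale1r !add0r.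
  have := dot_coord3 0 0 1 D; have := dot_coord2 0 0 1 D; have := dot_coord1 0 0 1 D.
  by rewrite ee muE => -> -> ->; rewrite !mulr0 !addr0 mulr1.
have Qmu v : evf Q v = dot xx v * dot mu v.
  have hom2 : Q - linf xx * linf mu \is 2.-homog.
    by apply: rpredB => //; apply: (dhomogM (linf_homog xx) (linf_homog mu)).
  apply/eqP; rewrite -subr_eq0 -!evf_linf -evfM -evfB; apply/eqP.
  apply: (form_chart0 hom2 D) => t z.
  by rewrite evfB evfM !evf_linf xx_chart // mu_chart Q_chart eL1 hornerC; ring.
have [W Wn0 hW] := fibre_map.
have key1 t z : evf F (e1 + t *: e2 + z *: e + ((a - 1) * z + m.[t]) *: e) =
    a ^+ d.-1 * evf F (e1 + t *: e2 + z *: e).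
  rewrite -addrA -scalerDl; have -> : z + ((a - 1) * z + m.[t]) = a * z + m.[t] by ring.
  have : f.[(a * z)%:P + m] - (a ^+ d.-1)%:P * f.[z%:P] = 0.
    apply: (poly_eq0_generic Wn0) => t' /hW [_ _ h3].
    rewrite hornerD hornerN (hornerM _%:P) hornerC !ev2_section (hornerD _%:P) !hornerC.
    by have := h3 z; rewrite eL hornerC => ->; rewrite subrr.
  move/(congr1 (fun q : {poly K} => q.[t])).
  rewrite hornerD hornerN (hornerM _%:P) !hornerC !ev2_section (hornerD _%:P) !hornerC.
  by move/eqP; rewrite subr_eq0 -!ev2_ch => /eqP.
have key2 v : dot xx v != 0 -> evf F (v + dot mu v *: e) = a ^+ d.-1 * evf F v.
  move=> xn0; have ev := dot_coords v D; set x := dot xx v in xn0 ev.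
  set w := e1 + (dot yy v / x) *: e2 + (dot zz v / x) *: e.
  have evw : v = x *: w.
    by rewrite {1}ev /w !scalerDr !scalerA !mulrA ![x * _]mulrC !mulfK.
  rewrite evw dotZ -scalerA -scalerDr !(evf_scale _ _ homF) /w mu_chart key1; ring.
(* Both sides are polynomials on the line through v and e1, which is not
   contained in the tangent at e. *)
have key v : evf F (v + dot mu v *: e) = a ^+ d.-1 * evf F v.
  have : line F (v + dot mu v *: e) (e1 + dot mu e1 *: e) - a ^+ d.-1 *: line F v e1 = 0.
    have Vn0 : (dot xx v)%:P + 'X != 0 :> {poly K}.
      by rewrite -size_poly_eq0 addrC size_XaddC.
    apply: (poly_eq0_generic Vn0) => t.
    rewrite hornerD hornerC hornerX => tn0; rewrite hornerD hornerN hornerZ !line_ev.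
    have xe1 : dot xx e1 = 1.
      by have := xx_chart 0 0; rewrite !scale0r !addr0.
    have -> : v + dot mu v *: e + t *: (e1 + dot mu e1 *: e) =
       (v + t *: e1) + dot mu (v + t *: e1) *: e.
      by rewrite dotD dotZ scalerDr scalerA scalerDl addrACA.
    by rewrite key2 ?subrr // dotD dotZ xe1 mulr1.
  move/(congr1 (fun q : {poly K} => q.[0])).
  by rewrite hornerD hornerN hornerZ !line_ev horner0 !scale0r !addr0 => /eqP; rewrite subr_eq0 => /eqP.
have aD : a ^+ d.-1 = 1.
  have [->|a1] := eqVneq a 1; first by rewrite expr1n.
  have an1 : a - 1 != 0 by rewrite subr_eq0.
  have /closed_nonrootP [t] := no_section (- ((a - 1)^-1 *: m)).
  rewrite rootE ev2_section ev2_ch => Fn0.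
  set w := (X in evf F X) in Fn0.
  have := key w; rewrite {1}/w mu_chart hornerN hornerZ mulrN mulrA divff // mul1r addNr.
  rewrite scale0r addr0 -hornerZ -hornerN -/w => /esym/eqP.
  by rewrite -subr_eq0 -{2}[evf F w]mul1r -mulrBl mulf_eq0 (negPf Fn0) orbF subr_eq0 => /eqP.
exists mu; split=> // [v|]; first by rewrite key aD mul1r.
by rewrite mue addrC subrK.
Qed.

End Tangent.

Section FibreMaps.
Variable K : closedFieldType.
Hypothesis charK0 : [pchar K] =i pred0.
Variables (d : nat) (F : {mpoly K[3]}).
Hypothesis hd : (4 <= d)%N.
Hypothesis hF : smooth_plane_curve d F.
Local Notation vec := 'rV[K]_3.
Variable e : vec.
Hypothesis he : on_curve F e.
Implicit Types (u v w : vec).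

(** By [quadric_shape] the map agrees with v |-> v + mu(v) e off the tangent at
    e. As identities between forms, the proportionality of A(v) and v + mu(v) e
    extends to the whole curve. *)
Theorem fibre_map_linear (A : 'I_3 -> {mpoly K[3]}) (r : nat) :
  (forall i, A i \is r.-homog) ->
  (forall v, on_curve F v -> evf F (eval3 A v) = 0) ->
  (forall v, on_curve F v -> det3 (eval3 A v) v e = 0) ->
  (exists2 v, on_curve F v & forall k, eval3 A v <> k *: e) ->
  exists mu : vec,
    [/\ forall v, evf F (v + dot mu v *: e) = evf F v, 1 + dot mu e != 0 &
        forall v, on_curve F v -> exists k, eval3 A v = k *: (v + dot mu v *: e)].
Proof.
move=> homA A_on A_det A_ne.
have homF : F \is d.-homog := hF.1.
have hd1 : (1 < d)%N by move: hd; lia.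
have [e1 [e2 [D ge1 ge2]]] := tangent_basis hF he.
set xx := coord1 e1 e2 e; set yy := coord2 e1 e2 e; set zz := coord3 e1 e2 e.
have A_fib v : on_curve F v ->
    dot xx (eval3 A v) * dot yy v = dot yy (eval3 A v) * dot xx v.
  move=> cv; have := A_det v cv.
  have eA := dot_coords (eval3 A v) D; have ev := dot_coords v D.
  have gen (a1 a2 a3 b1 b2 b3 : K) : det3 (a1 *: e1 + a2 *: e2 + a3 *: e)
     (b1 *: e1 + b2 *: e2 + b3 *: e) e = det3 e1 e2 e * (a1 * b2 - a2 * b1).
    rewrite /det3 !mxE; ring.
  have := gen (dot xx (eval3 A v)) (dot yy (eval3 A v)) (dot zz (eval3 A v))
    (dot xx v) (dot yy v) (dot zz v).
  rewrite -eA -ev => -> /eqP.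
  by rewrite mulf_eq0 (negPf D) subr_eq0 => /eqP.
have homxA := formA_homog xx homA; have homyA := formA_homog yy homA.
have homzA := formA_homog zz homA.
have A_nc : exists2 v, on_curve F v & dot xx (eval3 A v) != 0.
  apply: NNPP => h.
  have x0 v : on_curve F v -> dot xx (eval3 A v) = 0.
    by move=> cv; apply/eqP/negPn/negP => n; apply: h; exists v.
  have y0 v : on_curve F v -> dot yy (eval3 A v) = 0.
    move=> cv; rewrite -evf_formA; move: v cv.
    apply: (X_cancel charK0 hd hF D homyA) => v cv.
    by rewrite evf_formA mulrC -A_fib // x0 // mul0r.
  have [v cv] := A_ne; apply; rewrite {1}(dot_coords (eval3 A v) D).
  by rewrite -/xx -/yy x0 // y0 // !scale0r !add0r.
have [Q [hQ eQ EQ]] := quadric_exists charK0 hd hF he D ge1 ge2 homA A_on A_fib A_nc.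
have [mu [Qmu Fmu mue]] := quadric_shape charK0 hd hF he D ge1 ge2 hQ EQ.
exists mu; split=> // v cv.
have homX := linf_homog xx; have homY := linf_homog yy.
pose T1 := linf xx * formA A zz - formA A xx * (linf zz + linf mu).
have homT1 : T1 \is (1 + r).-homog.
  apply: rpredB; first exact: dhomogM.
  rewrite addnC; apply: dhomogM => //; apply: rpredD; exact: linf_homog.
have evT1 u : evf T1 u = dot xx u * dot zz (eval3 A u)
    - dot xx (eval3 A u) * (dot zz u + dot mu u).
  by rewrite evfB !evfM evfD !evf_linf !evf_formA.
have T10 : forall u, on_curve F u -> evf T1 u = 0.
  apply: (X_cancel charK0 hd hF D homT1) => u cu; rewrite evT1 -/xx.
  have := eQ u cu; rewrite Qmu -/xx -/zz => h.
  have -> : dot xx u * (dot xx u * dot zz (eval3 A u) -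
     dot xx (eval3 A u) * (dot zz u + dot mu u)) =
     dot xx u * (dot xx u * dot zz (eval3 A u) - dot zz u * dot xx (eval3 A u))
     - dot xx (eval3 A u) * (dot xx u * dot mu u) by ring.
  by rewrite -h subrr.
pose T3 := linf yy * formA A zz - formA A yy * (linf zz + linf mu).
have homT3 : T3 \is (1 + r).-homog.
  apply: rpredB; first exact: dhomogM.
  rewrite addnC; apply: dhomogM => //; apply: rpredD; exact: linf_homog.
have evT3 u : evf T3 u = dot yy u * dot zz (eval3 A u)
    - dot yy (eval3 A u) * (dot zz u + dot mu u).
  by rewrite evfB !evfM evfD !evf_linf !evf_formA.
have T30 : forall u, on_curve F u -> evf T3 u = 0.
  apply: (X_cancel charK0 hd hF D homT3) => u cu; rewrite evT3 -/xx.
  have := T10 u cu; rewrite evT1 => /eqP; rewrite subr_eq0 => /eqP h1.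
  have -> : dot xx u * (dot yy u * dot zz (eval3 A u) -
     dot yy (eval3 A u) * (dot zz u + dot mu u)) =
     dot yy u * (dot xx u * dot zz (eval3 A u))
     - (dot yy (eval3 A u) * dot xx u) * (dot zz u + dot mu u) by ring.
  by rewrite h1 -A_fib //; ring.
have := T10 v cv; have := T30 v cv; rewrite evT1 evT3 => /eqP; rewrite subr_eq0 => /eqP h3.
move=> /eqP; rewrite subr_eq0 => /eqP h1; have h2 := A_fib v cv.
have eA := dot_coords (eval3 A v) D; have ev := dot_coords v D.
rewrite -/xx -/yy -/zz in eA ev.
set x := dot xx v in h1 h2 ev; set y := dot yy v in h2 h3 ev.
set z := dot zz v in h1 h3 ev; set m := dot mu v in h1 h3 *.
have ew : v + m *: e = x *: e1 + y *: e2 + (z + m) *: e by rewrite {1}ev scalerDl addrA.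
(* The factor is a quotient of first coordinates off the tangent at e, of second
   ones at its other points, of third ones at e. *)
have [x0|xn0] := eqVneq x 0; last first.
  exists (dot xx (eval3 A v) / x); rewrite ew {1}eA !scalerDr !scalerA.
  congr (_ *: _ + _ *: _ + _ *: _); first by rewrite divfK.
    by rewrite mulrAC h2 mulfK.
  by rewrite mulrAC -h1 mulrAC mulfV // mul1r.
have [y0|yn0] := eqVneq y 0; last first.
  exists (dot yy (eval3 A v) / y); rewrite ew {1}eA !scalerDr !scalerA.
  congr (_ *: _ + _ *: _ + _ *: _).
  - by rewrite mulrAC -h2 mulfK.
  - by rewrite divfK.
  by rewrite mulrAC -h3 mulrAC mulfV // mul1r.
have zn0 : z != 0.
  by apply: contraNneq cv.1 => z0; rewrite ev x0 y0 z0 !scale0r !addr0.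
have em : m = z * dot mu e.
  by rewrite /m ev x0 y0 !scale0r !add0r dotZ.
have zm : z + m != 0 by rewrite em -{1}[z]mulr1 -mulrDr mulf_neq0.
have ax : dot xx (eval3 A v) = 0.
  by move: h1; rewrite x0 mul0r => /esym/eqP; rewrite mulf_eq0 (negPf zm) orbF => /eqP.
have ay : dot yy (eval3 A v) = 0.
  by move: h3; rewrite y0 mul0r => /esym/eqP; rewrite mulf_eq0 (negPf zm) orbF => /eqP.
exists (dot zz (eval3 A v) / (z + m)).
by rewrite ew {1}eA ax ay x0 y0 !scale0r !add0r scalerA divfK.
Qed.

End FibreMaps.

(** * Finite sets invariant under a rotation about each of their points *)

Section Configuration.
Variable K : closedFieldType.
Hypothesis charK0 : [pchar K] =i pred0.

Lemma bin2K i : 'C(i, 2)%:R * 2 = i%:R * (i%:R - 1) :> K.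
Proof.
elim: i => [|i IH]; first by rewrite mul0r mul0r.
by rewrite binS bin1 natrD mulrDl IH -natr1; ring.
Qed.

Lemma bin3K i : 'C(i, 3)%:R * 6 = i%:R * (i%:R - 1) * (i%:R - 2) :> K.
Proof.
elim: i => [|i IH]; first by rewrite !mul0r.
rewrite binS natrD mulrDl IH (_ : 6 = 2 * 3) ?mulrA ?bin2K; last by ring.
by rewrite -natr1; ring.
Qed.

Lemma bin4K i : 'C(i, 4)%:R * 24 = i%:R * (i%:R - 1) * (i%:R - 2) * (i%:R - 3) :> K.
Proof.
elim: i => [|i IH]; first by rewrite !mul0r.
rewrite binS natrD mulrDl IH (_ : 24 = 6 * 4) ?mulrA ?bin3K; last by ring.
by rewrite -natr1; ring.
Qed.

Lemma nat_neq0 n : (0 < n)%N -> n%:R != 0 :> K.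
Proof. by move=> n0; rewrite natK_eq0 // -lt0n. Qed.

Lemma coef_shift (p : {poly K}) (c : K) k : (p \Po ('X + c%:P))`_k = p^`N(k).[c].
Proof.
have -> : p \Po ('X + c%:P) = \poly_(i < size p) (p^`N(i)).[c].
  apply: poly_all_eq => t; rewrite horner_comp hornerD hornerX hornerC addrC.
  by rewrite nderiv_taylor ?horner_poly //; exact: mulrC.
rewrite coef_poly; case: ltnP => // le.
by rewrite nderivn_poly0 ?horner0.
Qed.

Lemma deriv_nderivn (p : {poly K}) k : (p^`N(k))^`() = p^`N(k.+1) *+ k.+1.
Proof.
apply/polyP => i; rewrite coef_deriv coefMn !coef_nderivn addnS addSn.
rewrite -!mulrnA; congr (_ *+ _).
have := mul_bin_left (k + i).+1 k; rewrite subSn ?leq_addr // addKn.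
by rewrite mulnC [RHS]mulnC => ->.
Qed.

Lemma coef_comp_scale (p : {poly K}) (c : K) i : (p \Po (c *: 'X))`_i = c ^+ i * p`_i.
Proof.
rewrite coef_comp_poly; case: (ltnP i (size p)) => [lt|le].
  rewrite (bigD1 (Ordinal lt)) //= big1 => [|j ne].
    by rewrite exprZn coefZ coefXn eqxx mulr1 addr0 mulrC.
  rewrite exprZn coefZ coefXn; rewrite -val_eqE /= eq_sym in ne.
  by rewrite (negPf ne) !mulr0.
rewrite nth_default // mulr0 big1 // => j _.
by rewrite exprZn coefZ coefXn gtn_eqF ?mulr0 // (leq_trans (ltn_ord j)).
Qed.

(** The polynomial satisfies chi(om X) = om^M chi(X), where M is the number of
    roots. *)
Lemma rotation_coef (n : nat) (om : K) (S : seq K) : n.-primitive_root om -> uniq S ->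
  0 \notin S -> {in S, forall x, om * x \in S} ->
  let chi := \prod_(x <- S) ('X - x%:P) in
  [/\ chi`_0 != 0, (n %| size S)%N & forall i, chi`_i != 0 -> (n %| i)%N].
Proof.
move=> prim uS S0 rot chi.
have om0 : om != 0.
  apply: contraTneq (prim_order_gt0 prim) => o0.
  have := prim_expr_order prim; rewrite o0 expr0n.
  by case: (n) => // k /eqP; rewrite eq_sym oner_eq0.
have perm : perm_eq [seq om * x | x <- S] S.
  by apply: perm_map_stable => //; apply: mulfI.
have chi0 : chi`_0 != 0.
  rewrite -horner_coef0 horner_prod prodf_seq_neq0; apply/allP => x xS /=.
  by rewrite hornerXsubC sub0r oppr_eq0; apply: contraNneq S0 => <-.
have scal : chi \Po (om *: 'X) = om ^+ size S *: chi.
  apply: poly_all_eq => t; rewrite horner_comp hornerZ hornerX hornerZ.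
  rewrite /chi {1}(perm_big _ (etrans (perm_sym _ _) perm)) big_map /= !horner_prod.
  have -> : om ^+ size S = \prod_(x <- S) om by rewrite big_const_seq count_predT iter_mulr_1.
  rewrite -big_split /=; apply: eq_bigr => x _; rewrite !hornerXsubC; ring.
have coefs i : om ^+ i * chi`_i = om ^+ size S * chi`_i.
  by rewrite -[RHS]coefZ -scal coef_comp_scale.
have rootS : om ^+ size S = 1.
  by have := coefs 0%N; rewrite expr0 => /esym; exact: mulIf.
split=> [//||i ci]; first by rewrite (prim_order_dvd prim) rootS eqxx.
have := coefs i; rewrite rootS => /(mulIf ci) h.
by rewrite (prim_order_dvd prim) h eqxx.
Qed.

End Configuration.

Section ConfigurationBound.
Variable K : closedFieldType.
Hypothesis charK0 : [pchar K] =i pred0.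

Lemma coef_lin_pow (a b : K) m k :
  ((a%:P + b *: 'X) ^+ m)`_k = (a ^+ (m - k) * b ^+ k) *+ 'C(m, k).
Proof.
rewrite exprDn coef_sum; case: (leqP k m) => [le|lt]; last first.
  rewrite bin_small // mulr0n big1 // => i _.
  rewrite -polyC_exp exprZn -scalerAr -mul_polyC coefMn coefCM coefCM coefXn.
  by rewrite gtn_eqF ?mulr0 ?mul0rn // (leq_ltn_trans _ lt) // -ltnS.
have lt : (k < m.+1)%N by [].
rewrite (bigD1 (Ordinal lt)) //= big1 ?addr0 => [|i ne].
  by rewrite -polyC_exp exprZn coefMn coefCM coefZ coefXn eqxx mulr1.
rewrite -polyC_exp exprZn coefMn coefCM coefZ coefXn eq_sym.
by rewrite -val_eqE /= in ne; rewrite (negPf ne) !mulr0 mul0rn.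
Qed.

Variables (n : nat) (om : K) (T : seq K) (beta : K -> K).
Hypothesis prim : n.-primitive_root om.
Hypothesis n3 : (2 < n)%N.
Hypothesis uT : uniq T.
Hypothesis T_gt0 : (0 < size T)%N.
Hypothesis T0 : 0 \notin T.
Hypothesis Trot : {in T, forall x, om * x \in T}.

(** The points of T and infinity, seen from t in T: in the coordinate beta t +
    1 / (u - t) the point t is at infinity, and 0 is the other fixed point of
    the rotation about t. *)
Definition seen_from t : seq K := beta t :: [seq beta t + (u - t)^-1 | u <- T & u != t].

Hypothesis S0 : {in T, forall t, 0 \notin seen_from t}.
Hypothesis Srot : {in T, forall t, {in seen_from t, forall x, om * x \in seen_from t}}.

Let M := size T.
Let psi : {poly K} := \prod_(x <- T) ('X - x%:P).

Lemma psi_facts : [/\ psi`_0 != 0, (n %| M)%N & forall i, psi`_i != 0 -> (n %| i)%N].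
Proof. exact: rotation_coef prim uT T0 Trot. Qed.

Lemma size_psi : size psi = M.+1. Proof. exact: size_prod_XsubC. Qed.

Lemma psiM : psi`_M = 1.
Proof.
have := monic_prod_XsubC T xpredT (fun x : K => x).
by rewrite monicE lead_coefE size_psi => /eqP.
Qed.

Lemma M_ge : (n <= M)%N.
Proof. by have [_ h _] := psi_facts; apply: dvdn_leq. Qed.

Lemma seen_uniq t : t \in T -> uniq (seen_from t) /\ size (seen_from t) = M.
Proof.
move=> tT; split.
  rewrite /= map_inj_uniq ?filter_uniq // ?andbT; last first.
    by move=> u v /addrI /invr_inj /addIr.
  apply/mapP => -[u]; rewrite mem_filter => /andP[ne _] /eqP.
  by rewrite -subr_eq0 opprD addrA subrr sub0r oppr_eq0 invr_eq0 subr_eq0 (negPf ne).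
rewrite /= size_map size_filter -[M](count_predC (pred1 t)) count_uniq_mem // tT.
by [].
Qed.

Let h t : {poly K} := \prod_(x <- seen_from t) ('X - x%:P).
Let Ct t := \prod_(u <- T | u != t) (t - u).

Lemma Ct_neq0 t : Ct t != 0.
Proof.
by rewrite prodf_seq_neq0; apply/allP => u _; apply/implyP; rewrite subr_eq0 eq_sym.
Qed.

Lemma h_facts t : t \in T -> [/\ (h t)`_0 != 0, (h t)`_M = 1,
  forall i, (h t)`_i != 0 -> (n %| i)%N & size (h t) = M.+1].
Proof.
move=> tT; have [us ss] := seen_uniq tT.
have [h0 _ hi] := rotation_coef prim us (S0 tT) (Srot tT).
have sz : size (h t) = M.+1 by rewrite /h size_prod_XsubC ss.
split=> //; have := monic_prod_XsubC (seen_from t) xpredT (fun x : K => x).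
by rewrite -/(h t) monicE lead_coefE sz => /eqP.
Qed.

(** The product over T, written in the coordinate of [seen_from]. *)
Lemma psi_from t e : t \in T -> psi.[t + e] =
  Ct t * \sum_(i < M.+1) (h t)`_i * (e ^+ (M.+1 - i) * (1 + beta t * e) ^+ i).
Proof.
move=> tT; have [us ss] := seen_uniq tT; have [_ _ _ sz] := h_facts tT.
have [->|en0] := eqVneq e 0.
  rewrite addr0 big1 ?mulr0 => [|i _]; last first.
    by rewrite expr0n subn_eq0 leqNgt ltn_ord /= mul0r mulr0.
  by apply/eqP; rewrite -rootE root_prod_XsubC.
have -> : \sum_(i < M.+1) (h t)`_i * (e ^+ (M.+1 - i) * (1 + beta t * e) ^+ i) =
    e ^+ M.+1 * (h t).[beta t + e^-1].
  rewrite (@horner_coef_wide _ M.+1) ?sz // big_distrr /=; apply: eq_bigr => i _.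
  have -> : 1 + beta t * e = e * (beta t + e^-1) by rewrite mulrDr divff // mulrC addrC.
  have le : (i <= M.+1)%N by apply: ltnW.
  have -> : e ^+ M.+1 = e ^+ (M.+1 - i) * e ^+ i by rewrite -exprD subnK.
  by rewrite exprMn mulrCA -!mulrA; congr (_ * _); rewrite mulrCA.
rewrite /psi (perm_big _ (perm_to_rem tT)) /= big_cons hornerM hornerXsubC.
have -> : t + e - t = e by rewrite addrC addKr.
rewrite (rem_filter _ uT) big_filter horner_prod /h /seen_from big_cons hornerM hornerXsubC.
have -> : beta t + e^-1 - beta t = e^-1 by rewrite addrC addKr.
rewrite big_map big_filter horner_prod.
have -> : \prod_(u <- T | predC1 t u) ('X - u%:P).[t + e] =
  \prod_(u <- T | u != t) ((t - u) * e * ('X - (beta t + (u - t)^-1)%:P).[beta t + e^-1]).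
  apply: eq_bigr => u ne; rewrite !hornerXsubC.
  have ne' : u - t != 0 by rewrite subr_eq0.
  field; by rewrite en0 ne'.
rewrite !big_split /= -/(Ct t).
have -> : \prod_(u <- T | u != t) e = e ^+ M.-1.
  rewrite big_const_seq iter_mulr_1; congr (_ ^+ _).
  by rewrite -[M](count_predC (pred1 t)) count_uniq_mem // tT.
have -> : M.+1 = M.-1.+2 by rewrite prednK.
by rewrite !exprS; field.
Qed.

(** The polynomial of the points seen from t only contains powers of exponent M
    modulo n, so that psi(t + e) agrees with C e (1 + beta e)^M up to the order
    n. *)
Lemma psi_local t k : t \in T -> (0 < k <= n)%N ->
  (psi^`N(k)).[t] = Ct t * (beta t ^+ k.-1 *+ 'C(M, k.-1)).
Proof.
move=> tT /andP[k0 kn]; have [_ hM hdvd _] := h_facts tT.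
have [_ nM _] := psi_facts.
rewrite -coef_shift.
have -> : psi \Po ('X + t%:P) =
  Ct t *: \sum_(i < M.+1) (h t)`_i *: ('X^(M.+1 - i) * (1%:P + beta t *: 'X) ^+ i).
  apply: poly_all_eq => e; rewrite horner_comp hornerD hornerX hornerC addrC psi_from //.
  rewrite hornerZ horner_sum; congr (_ * _); apply: eq_bigr => i _.
  by rewrite hornerZ hornerM !horner_exp hornerX hornerD hornerC hornerZ hornerX.
rewrite coefZ coef_sum; congr (_ * _).
rewrite big_ord_recr /= big1 => [|i _].
  rewrite add0r hM scale1r subSnn coefXM gtn_eqF // coef_lin_pow.
  by rewrite expr1n mul1r.
rewrite coefZ coefXnM; case: ltnP => [_|le]; first by rewrite mulr0.
have [->|hi] := eqVneq (h t)`_i 0; first by rewrite mul0r.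
exfalso; have di := hdvd _ hi; have lti := ltn_ord i.
have : (n <= M - i)%N by apply: dvdn_leq; rewrite ?subn_gt0 // dvdn_subr // ltnW.
move=> l1; have := leq_trans le kn; rewrite subSn ?(ltnW lti) //.
by rewrite ltnNge l1.
Qed.

Let m : K := M%:R.
Let cA := 2 * m * (m + 1).
Let cB := - 2 * m * (m - 2).
Let cC := (m - 1) * (m - 2).

(** The fourth transvectant of psi with itself, psi being considered as a
    binary form of degree M + 1 with a root at infinity. It vanishes
    identically on forms l l'^M, to which psi is close at every t of T. *)
Definition transvectant : {poly K} :=
  cA *: (psi * psi^`N(4)) + cB *: (psi^`N(1) * psi^`N(3)) + cC *: (psi^`N(2) * psi^`N(2)).

Lemma size_transvectant : (size transvectant <= 2 * M - 3)%N.
Proof.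
have sN k : (size (psi^`N(k)) <= M.+1 - k)%N.
  apply/leq_sizeP => j le; rewrite coef_nderivn nth_default ?mul0rn // size_psi.
  by move: le; lia.
have M3 : (3 <= M)%N := leq_trans n3 M_ge.
have sP k l : (k + l = 4)%N -> (size (psi^`N(k) * psi^`N(l))%R <= 2 * M - 3)%N.
  move=> e; have [->|p0] := eqVneq (psi^`N(k)) 0; first by rewrite mul0r size_poly0.
  have [->|q0] := eqVneq (psi^`N(l)) 0; first by rewrite mulr0 size_poly0.
  rewrite size_mul //; have := sN k; have := sN l.
  move: p0 q0; rewrite -!size_poly_eq0.
  by case: (size _) => [//|x] _; case: (size _) => [//|y] _ /= l1 l2; move: l1 l2 e M3; lia.
have s0 := sP 0%N 4 erefl; rewrite nderivn0 in s0.
apply: leq_trans (size_polyD _ _) _; rewrite geq_max; apply/andP; split; last first.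
  by apply: leq_trans (size_scale_leq _ _) _; apply: sP.
apply: leq_trans (size_polyD _ _) _; rewrite geq_max; apply/andP; split.
  exact: leq_trans (size_scale_leq _ _) s0.
by apply: leq_trans (size_scale_leq _ _) _; apply: sP.
Qed.

Lemma psi_root t : t \in T -> psi.[t] = 0.
Proof. by move=> tT; apply/eqP; rewrite -rootE root_prod_XsubC. Qed.

Lemma bin2E i : 'C(i, 2)%:R = i%:R * (i%:R - 1) / 2 :> K.
Proof. by rewrite -bin2K mulfK // (nat_neq0 charK0 (n := 2)). Qed.

Lemma bin3E i : 'C(i, 3)%:R = i%:R * (i%:R - 1) * (i%:R - 2) / 6 :> K.
Proof. by rewrite -bin3K mulfK // (nat_neq0 charK0 (n := 6)). Qed.

Lemma bin4E i : 'C(i, 4)%:R = i%:R * (i%:R - 1) * (i%:R - 2) * (i%:R - 3) / 24 :> K.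
Proof. by rewrite -bin4K mulfK // (nat_neq0 charK0 (n := 24)). Qed.

Let n2 : (2 : K) != 0 := nat_neq0 charK0 (n := 2) isT.
Let n6 : (6 : K) != 0 := nat_neq0 charK0 (n := 6) isT.
Let n24 : (24 : K) != 0 := nat_neq0 charK0 (n := 24) isT.

Lemma transvectant_root t : t \in T -> transvectant.[t] = 0.
Proof.
move=> tT; rewrite /transvectant !hornerD !hornerZ !hornerM psi_root //.
have k1 : (0 < 1 <= n)%N by rewrite /= (ltnW (ltnW n3)).
have k2 : (0 < 2 <= n)%N by rewrite /= (ltnW n3).
have k3 : (0 < 3 <= n)%N by [].
rewrite (psi_local tT k1) (psi_local tT k2) (psi_local tT k3) /=.
rewrite bin0 bin1 expr0 expr1 mulr1n -(mulr_natl _ M) -(mulr_natl _ 'C(M, 2)) -/m.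
by rewrite bin2E -/m /cB /cC; field.
Qed.

Lemma transvectant_double_root t : (3 < n)%N -> t \in T -> transvectant^`().[t] = 0.
Proof.
move=> n4 tT.
have k1 : (0 < 1 <= n)%N by rewrite /= (ltnW (ltnW n3)).
have k2 : (0 < 2 <= n)%N by rewrite /= (ltnW n3).
have k3 : (0 < 3 <= n)%N by [].
have k4 : (0 < 4 <= n)%N by [].
rewrite /transvectant !derivD !derivZ !derivM !deriv_nderivn -poly.nderivn1.
rewrite !hornerD !hornerZ !hornerD !hornerM !hornerMn psi_root // mul0r addr0.
rewrite (psi_local tT k1) (psi_local tT k2) (psi_local tT k3) (psi_local tT k4) /=.
rewrite bin0 bin1 expr0 expr1 mulr1n -(mulr_natl _ M) -(mulr_natl _ 'C(M, 2)).
rewrite -(mulr_natl _ 'C(M, 3)) bin2E bin3E -/m.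
by rewrite /cA /cB /cC; field; rewrite n2 n6.
Qed.

(** The second fixed point of the rotation about t. *)
Definition antipode t : K := t - (beta t)^-1.

Lemma beta_neq0 t : t \in T -> beta t != 0.
Proof. by move/S0; rewrite inE negb_or eq_sym => /andP[]. Qed.

Lemma psi_antipode_coef t k : t \in T -> (k <= M.+1)%N ->
  (psi^`N(k)).[antipode t] = Ct t * \sum_(i < M.+1) (h t)`_i * beta t ^+ i *
   (if (k < i)%N then 0 else (antipode t - t) ^+ (M.+1 - k) *+ 'C(M.+1 - i, k - i)).
Proof.
move=> tT kM; have bn0 := beta_neq0 tT; set s := antipode t - t.
rewrite -coef_shift.
have -> : psi \Po ('X + (antipode t)%:P) = Ct t *: \sum_(i < M.+1)
    ((h t)`_i * beta t ^+ i) *: ('X^i * (s%:P + 1 *: 'X) ^+ (M.+1 - i)).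
  apply: poly_all_eq => e; rewrite horner_comp hornerD hornerX hornerC.
  have -> : e + antipode t = t + (e + s) by rewrite /s; ring.
  rewrite psi_from // hornerZ horner_sum; congr (_ * _); apply: eq_bigr => i _.
  rewrite hornerZ hornerM !horner_exp hornerX hornerD hornerC hornerZ hornerX mul1r.
  have -> : 1 + beta t * (e + s) = beta t * e by rewrite /s /antipode; field.
  by rewrite exprMn [s + e]addrC; ring.
rewrite coefZ coef_sum; congr (_ * _); apply: eq_bigr => i _.
rewrite coefZ coefXnM; case: ltnP => [_|le]; first by rewrite mulr0.
rewrite coef_lin_pow expr1n mulr1; congr (_ * (_ ^+ _ *+ _)).
by rewrite subnBA // subnK //; apply: ltnW.
Qed.

Lemma antipode_low t k : t \in T -> (k < 3)%N -> (psi^`N(k)).[antipode t] =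
  Ct t * (h t)`_0 * ((antipode t - t) ^+ (M.+1 - k) *+ 'C(M.+1, k)).
Proof.
move=> tT k3; have [_ _ hdvd _] := h_facts tT; have M3 := leq_trans n3 M_ge.
rewrite psi_antipode_coef //; last by move: k3 M3; clear; lia.
rewrite big_ord_recl big1 ?addr0 => [|i _]; first by rewrite /= !subn0 expr0 mulr1 mulrA.
rewrite lift0; case: ltnP => [_|le]; first by rewrite mulr0.
have [->|hi] := eqVneq (h t)`_i.+1 0; first by rewrite !mul0r.
exfalso; have := dvdn_leq (ltn0Sn i) (hdvd _ hi).
by move/(leq_trans n3); rewrite ltnNge -ltnS (leq_ltn_trans le k3).
Qed.

Lemma psi_antipode_neq0 t : t \in T -> psi.[antipode t] != 0.
Proof.
move=> tT; have [h0 _ _ _] := h_facts tT.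
have := antipode_low tT (k := 0) isT; rewrite nderivn0 bin0 mulr1n => ->.
rewrite !mulf_neq0 ?Ct_neq0 // expf_neq0 // /antipode addrAC subrr add0r.
by rewrite oppr_eq0 invr_eq0 beta_neq0.
Qed.

Lemma antipode_logderiv t : t \in T ->
  (psi^`N(1)).[antipode t] * (antipode t - t) = (m + 1) * psi.[antipode t].
Proof.
move=> tT; rewrite -[psi in RHS]nderivn0 !antipode_low // bin0 bin1 subn1 subn0 /= exprS.
by rewrite -(mulr_natl _ M.+1) -natr1 -/m mulr1n; ring.
Qed.

(** The logarithmic derivative of psi at the antipode of t is (M + 1) /
    (antipode t - t). *)
Lemma antipode_inj : {in T &, injective antipode}.
Proof.
move=> t u tT uT' e; have := antipode_logderiv tT; have := antipode_logderiv uT'.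
rewrite -e => <- /eqP; rewrite -subr_eq0 -mulrBr mulf_eq0 => /orP[/eqP d0|].
  have /eqP := antipode_logderiv tT; rewrite d0 mul0r eq_sym mulf_eq0.
  by rewrite (negPf (psi_antipode_neq0 tT)) orbF natr1 natK_eq0.
by rewrite subr_eq0 => /eqP /addrI /oppr_inj ->.
Qed.

(** Near the antipode and up to the fourth order, psi is a combination of
    l^(M+1) and e^3 l^(M-2), with e the local coordinate and l linear; both
    contributions to the transvectant vanish at e = 0. *)
Lemma transvectant_antipode t : n = 3%N -> t \in T -> transvectant.[antipode t] = 0.
Proof.
move=> en tT; have [_ _ hdvd _] := h_facts tT; have M3 : (3 <= M)%N := leq_trans n3 M_ge.
set s := antipode t - t; set p := Ct t * (h t)`_0; set q := Ct t * ((h t)`_3 * beta t ^+ 3).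
have low := antipode_low tT; rewrite -/s -/p in low.
have high k : (2 < k < 5)%N -> (psi^`N(k)).[antipode t] =
    p * (s ^+ (M.+1 - k) *+ 'C(M.+1, k)) + q * (s ^+ (M.+1 - k) *+ 'C(M.-2, k - 3)).
  move=> /andP[k3 k5]; rewrite psi_antipode_coef //; last by move: k5 M3; clear; lia.
  have l0 : (0 < M.+1)%N by []. have l3 : (3 < M.+1)%N by [].
  rewrite (bigD1 (Ordinal l0)) //= (bigD1 (Ordinal l3)) //= big1 ?addr0 => [|i /andP[i0 i3]].
    have -> : (M.+1 - 3 = M.-2)%N by move: M3; clear; lia.
    by rewrite ltnNge k3 /= !subn0 expr0 mulr1 -/s mulrDr /p /q !mulrA.
  case: ltnP => [_|le]; first by rewrite mulr0.
  have [->|hi] := eqVneq (h t)`_i 0; first by rewrite !mul0r.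
  exfalso; have := hdvd _ hi; rewrite en; move: i0 i3; rewrite -!val_eqE /=.
  by move: (i : nat) le k5 => {hi}i; clear; case: i => [|[|[|[|[|i]]]]] //; lia.
have e0 := low 0%N isT; have e1 := low 1%N isT; have e2 := low 2%N isT.
have e3 := high 3%N isT; have e4 := high 4%N isT.
have eM : (M.+1)%:R = m + 1 :> K by rewrite -natr1.
have [N eN] : exists N, M = N.+3 by exists (M - 3)%N; move: M3; clear; lia.
have eM2 : (M.-2)%:R = m - 2 :> K by rewrite /m eN /= -addn2 natrD addrK.
rewrite nderivn0 bin0 mulr1n subn0 in e0.
rewrite bin1 -(mulr_natl _ M.+1) eM in e1.
rewrite -(mulr_natl _ 'C(M.+1, 2)) bin2E eM in e2.
rewrite -(mulr_natl _ 'C(M.+1, 3)) bin3E eM subnn bin0 mulr1n in e3.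
rewrite -(mulr_natl _ 'C(M.+1, 4)) bin4E eM (_ : (4 - 3 = 1)%N) // bin1 -(mulr_natl _ M.-2) eM2 in e4.
rewrite /transvectant !hornerD !hornerZ !hornerM e0 e1 e2 e3 e4 eN !subSS !subn0 !exprS.
by rewrite /cA /cB /cC; move: (s ^+ N) => sN; field; rewrite n2 n6 n24.
Qed.

(** Its degree is at most 2 M - 4, but it has 2 M zeros: the points of T
    counted twice if n > 3, those of T and their antipodes if n = 3. *)
Lemma transvectant0 : transvectant = 0.
Proof.
have M3 : (3 <= M)%N := leq_trans n3 M_ge.
apply/eqP/negPn/negP => tn0.
have [en|en] := eqVneq n 3%N.
  have := @max_poly_roots _ transvectant (T ++ map antipode T) tn0.
  rewrite all_cat cat_uniq uT map_inj_in_uniq ?uT ?andbT; last exact: antipode_inj.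
  rewrite (_ : all _ T); last by apply/allP => t tT; rewrite rootE transvectant_root.
  rewrite (_ : all _ (map _ _)); last first.
    by apply/allP => _ /mapP [t tT ->]; rewrite rootE transvectant_antipode.
  rewrite (_ : ~~ has _ _); last first.
    apply/hasPn => _ /mapP [t tT ->]; apply: contra (psi_antipode_neq0 tT).
    by rewrite -root_prod_XsubC.
  move=> /(_ isT isT); rewrite size_cat size_map -/M.
  move/leq_trans /(_ size_transvectant); move: M3; clear; lia.
have n4 : (3 < n)%N by rewrite ltn_neqAle eq_sym en.
have /dvdpP [q eq] : psi %| transvectant.
  by apply: dvdp_of_roots => // t; apply: transvectant_root.
have : psi %| q.
  apply: dvdp_of_roots => // t tT; have := transvectant_double_root n4 tT.
  rewrite eq derivM hornerD !hornerM psi_root // mulr0 add0r -poly.nderivn1.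
  have k1 : (0 < 1 <= n)%N by rewrite /= (ltnW (ltnW n3)).
  rewrite (psi_local tT k1) /= bin0 expr0 mulr1n mulr1 => /eqP.
  by rewrite mulf_eq0 (negPf (Ct_neq0 t)) orbF => /eqP.
have qn0 : q != 0 by apply: contraNneq tn0 => q0; rewrite eq q0 mul0r.
move/(dvdp_leq qn0); rewrite size_psi => szq.
have := size_transvectant; rewrite eq size_mul //; last by rewrite -size_poly_eq0 size_psi.
rewrite size_psi; move: szq M3; move: (size q) => x; clear; lia.
Qed.

Lemma natK_inj i j : i%:R = j%:R :> K -> i = j.
Proof.
wlog le : i j / (i <= j)%N => [hw|/esym/eqP].
  by case/orP: (leq_total i j) => le e; [apply: hw | apply/esym/hw].
rewrite -subr_eq0 -natrB // natK_eq0 // subn_eq0 => le'.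
by apply/eqP; rewrite eqn_leq le.
Qed.

(** With psi = X^M + c X^J + lower terms, only these two terms contribute to
    the coefficient of X^(M + J - 4) in the transvectant, and j = M - J. *)
Lemma leading_relation : exists j, [/\ (0 < j)%N, (n %| j)%N, (j <= M)%N
  & (M.+1 * 6 = M.+1 * j + 12)%N].
Proof.
have [psi0 nM hdvd] := psi_facts; have M3 : (3 <= M)%N := leq_trans n3 M_ge.
have exP : exists i, (i < M)%N && (psi`_i != 0) by exists 0%N; rewrite psi0 andbT; move: M3; lia.
have ubP i : (i < M)%N && (psi`_i != 0) -> (i <= M)%N by case/andP => /ltnW.
have [J /andP[JM cJ] maxJ] := ex_maxnP exP ubP; set c := psi`_J in cJ.
have le_jM : (M - J <= M)%N by apply: leq_subr.
exists (M - J)%N; rewrite subn_gt0 JM.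
have dj : (n %| M - J)%N by rewrite dvdn_subr ?(ltnW JM) // hdvd.
have j3 : (3 <= M - J)%N.
  by apply: leq_trans n3 _; apply: dvdn_leq => //; rewrite subn_gt0.
split=> //.
have theta a i : ('X^a * psi^`N(a))`_i = psi`_i * ('C(i, a))%:R.
  rewrite coefXnM; case: ltnP => [lt|le]; first by rewrite bin_small // mulr0.
  by rewrite coef_nderivn subnKC // mulr_natr.
have supp i : psi`_i != 0 -> psi`_(M + J - i) != 0 -> (i <= M + J)%N -> i = M \/ i = J.
  move=> ci ci' lei.
  have iM : (i <= M)%N.
    by rewrite leqNgt; apply/negP => lt; move: ci; rewrite nth_default ?size_psi // eqxx.
  have [->|ne] := eqVneq i M; [by left | right].
  have iJ : (i <= J)%N by apply: maxJ; rewrite ci andbT ltn_neqAle ne.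
  have i'M : (M + J - i <= M)%N.
    by rewrite leqNgt; apply/negP => lt; move: ci'; rewrite nth_default ?size_psi // eqxx.
  by move: iJ i'M lei; clear; lia.
have prod a b : ('X^a * psi^`N(a) * ('X^b * psi^`N(b)))`_(M + J) =
    c * ('C(J, a)%:R * 'C(M, b)%:R + 'C(M, a)%:R * 'C(J, b)%:R).
  rewrite coefM.
  have lM : (M < (M + J).+1)%N by rewrite ltnS leq_addr.
  have lJ : (J < (M + J).+1)%N by rewrite ltnS leq_addl.
  rewrite (bigD1 (Ordinal lM)) //= (bigD1 (Ordinal lJ)) /=; last first.
    by rewrite -val_eqE /= (ltn_eqF JM).
  rewrite big1 ?addr0 => [|i /andP[iM iJ]]; last first.
    rewrite !theta; have [->|ci] := eqVneq (psi`_i) 0; first by rewrite !mul0r.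
    have [->|ci'] := eqVneq (psi`_(M + J - i)) 0; first by rewrite mul0r mulr0.
    have [e|e] := supp i ci ci' (leq_ord i).
      by move: iM; rewrite -val_eqE /= e eqxx.
    by move: iJ; rewrite -val_eqE /= e eqxx.
  rewrite addKn addnK !theta psiM -/c; ring.
have rel : 'X^4 * transvectant =
    cA *: ('X^0 * psi^`N(0) * ('X^4 * psi^`N(4))) +
    cB *: ('X^1 * psi^`N(1) * ('X^3 * psi^`N(3))) +
    cC *: ('X^2 * psi^`N(2) * ('X^2 * psi^`N(2))).
  by rewrite /transvectant nderivn0 -!mul_polyC !exprS expr0; ring.
have := congr1 (fun p : {poly K} => p`_(M + J)) rel.
rewrite transvectant0 mulr0 coef0 !coefD !coefZ !prod => /esym.
rewrite !bin0 !bin1 !bin2E !bin3E !bin4E.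
pose j : K := (M - J)%:R.
have -> : J%:R = m - j :> K by rewrite /j natrB ?(ltnW JM) //; rewrite -/m; ring.
rewrite -/m => e.
have {e} : c * (m * (j + 1) * j * (j - 1) * ((m + 1) * (j - 6) + 12)) = 0.
  rewrite -[RHS](mulr0 12) -e /cA /cB /cC; field.
  by rewrite n2 n6 n24.
have jn0 : j != 0 by apply: nat_neq0 => //; apply: leq_trans j3.
have j1 : j - 1 != 0.
  by rewrite /j -(natrB _ (_ : (1 <= M - J)%N)) ?nat_neq0 ?subn_gt0 //; move: j3; lia.
have j2 : j + 1 != 0 by rewrite natr1 nat_neq0.
have mn0 : m != 0 by apply: nat_neq0 => //; apply: leq_trans M3.
move/eqP; rewrite !mulf_eq0 (negPf cJ) (negPf mn0) (negPf j2) (negPf jn0) (negPf j1) /= => /eqP e.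
apply: natK_inj; rewrite natrD !natrM -natr1 -/m -/j.
by apply/eqP; rewrite -subr_eq0; apply/eqP; rewrite -[RHS]oppr0 -e; ring.
Qed.

(** The relation (M + 1) (6 - j) = 12 leaves three values of j, and the
    divisibilities by n exclude two of them. In the remaining case psi = X^3 +
    c, and beta t is read off from its second derivative. *)
Theorem configuration_four :
  [/\ n = 3%N, M = 3%N & forall t, t \in T -> 3 * (beta t * t) = 1].
Proof.
have [psi0 nM hdvd] := psi_facts; have M3 : (3 <= M)%N := leq_trans n3 M_ge.
have [j [j0 nj jM e]] := leading_relation.
have nlj : (n <= j)%N by apply: dvdn_leq.
have j5 : (j <= 5)%N.
  by rewrite leqNgt; apply/negP => j6; have := leq_mul (leqnn M.+1) j6; lia.
have [en eM] : n = 3%N /\ M = 3%N.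
  have [ej|[ej|ej]] : j = 3%N \/ j = 4%N \/ j = 5%N by move: n3 nlj j5; lia.
  - by rewrite ej in e nlj; split; move: n3 nlj e; lia.
  - have e5 : M = 5%N by rewrite ej in e; move: e; lia.
    rewrite ej e5 in nj nM; exfalso; move: nj nM n3 nlj; rewrite ej.
    by case: (n) => [|[|[|[|[|k]]]]] //; lia.
  have e11 : M = 11%N by rewrite ej in e; move: e; lia.
  rewrite ej e11 in nj nM; exfalso; move: nj nM n3 nlj; rewrite ej.
  by case: (n) => [|[|[|[|[|[|k]]]]]] //; lia.
split=> // t tT.
have k1 : (0 < 1 <= n)%N by rewrite en.
have k2 : (0 < 2 <= n)%N by rewrite en.
have e1 := psi_local tT k1; have e2 := psi_local tT k2.
rewrite /= bin0 expr0 mulr1n mulr1 in e1; rewrite /= bin1 expr1 eM -(mulr_natl _ 3) in e2.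
have psiE : psi = (psi`_0)%:P + 'X^3.
  apply/polyP => i; rewrite coefD coefC coefXn.
  case: i => [|[|[|[|i]]]] /=; rewrite ?addr0 ?add0r //.
  - by apply/eqP/negPn/negP => /hdvd; rewrite en.
  - by apply/eqP/negPn/negP => /hdvd; rewrite en.
  - by have := psiM; rewrite eM.
  by rewrite nth_default // size_psi eM.
have d1 : (psi^`N(1)).[t] = 3 * t ^+ 2.
  by rewrite psiE nderivnD nderivnC nderivnXn add0r hornerMn hornerXn -mulr_natl.
have d2 : (psi^`N(2)).[t] = 3 * t.
  by rewrite psiE nderivnD nderivnC nderivnXn add0r hornerMn hornerX -mulr_natl.
have tn0 : t != 0 by apply: contraNneq T0 => <-.
have n3' : (3 : K) != 0 by apply: (nat_neq0 charK0 (n := 3)).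
have e3 : 3 * t * (3 * (beta t * t)) = 3 * t * 1.
  by rewrite mulr1 -{2}d2 e2 -e1 d1; ring.
by apply: mulfI e3; rewrite mulf_neq0.
Qed.

End ConfigurationBound.

(** * Homologies with centre on the curve *)

Lemma classical_filter (T : eqType) (P : T -> Prop) (s : seq T) :
  exists2 s', uniq s' & forall x, x \in s' <-> x \in s /\ P x.
Proof.
elim: s => [|y s [s' us hs]]; first by exists [::] => // x; split=> [|[]].
have [py|npy] := classic (P y /\ y \notin s'); last first.
  exists s' => // x; rewrite hs in_cons; split=> [[-> px]|[/orP[/eqP->|->]]] //.
    by rewrite orbT.
  by move=> px; apply/hs/negPn/negP => h; case: npy.
exists (y :: s') => [|x]; first by rewrite /= us py.2.
rewrite !in_cons; split.
  by case/orP=> [/eqP->|/hs[-> px]]; rewrite ?eqxx ?orbT //; split=> //; case: py.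
by case=> /orP[->|xs px] //; apply/orP; right; apply/hs.
Qed.

Lemma seq_choice (T : eqType) (U : Type) (u0 : U) (R : T -> U -> Prop) (s : seq T) :
  (forall x, x \in s -> exists y, R x y) -> exists f, forall x, x \in s -> R x (f x).
Proof.
elim: s => [|y s ih] h; first by exists (fun=> u0).
have [|f hf] := ih; first by move=> x xs; apply: h; rewrite in_cons xs orbT.
have [z yz] := h y (mem_head y s).
exists (fun x => if x == y then z else f x) => x; rewrite in_cons.
by case: eqP => [->|_] //= /hf.
Qed.

(** Multiplication by a permutes s and does not change the product of its
    elements. *)
Lemma finite_mul_roots (K : fieldType) (s : seq K) : uniq s -> (forall a, a \in s -> a != 0) ->
  (forall a b, a \in s -> b \in s -> a * b \in s) ->
  forall a, a \in s -> a ^+ size s = 1.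
Proof.
move=> us s0 sM a ain.
have perm : perm_eq [seq a * x | x <- s] s.
  by apply: perm_map_stable => // [|x xs]; [apply/mulfI/s0 | apply: sM].
have Pn0 : \prod_(x <- s) x != 0.
  by rewrite prodf_seq_neq0; apply/allP => x xs; apply: s0.
apply: (mulIf Pn0); rewrite mul1r -[RHS](perm_big _ perm) big_map /= big_split /=.
by rewrite big_const_seq count_predT iter_mulr_1.
Qed.

Section SmoothCurve.
Variable K : closedFieldType.
Hypothesis charK0 : [pchar K] =i pred0.
Variables (d : nat) (F : {mpoly K[3]}).
Hypothesis hd : (4 <= d)%N.
Hypothesis hF : smooth_plane_curve d F.
Local Notation vec := 'rV[K]_3.
Implicit Types (e u v w mu f g h : vec) (P Q : point K).

Let homF : F \is d.-homog := hF.1.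
Let hd1 : (1 < d)%N := ltnW (ltnW hd).
Let d0 : (0 < d)%N := ltnW hd1.

Lemma dot_prod0 (a b : vec) : (forall u, dot a u * dot b u = 0) -> a = 0 \/ b = 0.
Proof.
move=> h; have [->|an0] := eqVneq a 0; first by left.
have [->|bn0] := eqVneq b 0; first by right.
have [v av] := dot_neq0 an0; have [w bw] := dot_neq0 bn0.
have bv : dot b v = 0 by have /eqP := h v; rewrite mulf_eq0 (negPf av) => /eqP.
have aw : dot a w = 0 by have /eqP := h w; rewrite mulf_eq0 (negPf bw) orbF => /eqP.
have := h (v + w); rewrite !dotD aw bv addr0 add0r => /eqP.
by rewrite mulf_eq0 (negPf av) (negPf bw).
Qed.

(** These maps are the homologies and the elations with centre e. *)
Definition preserves e mu : Prop := forall v, evf F (v + dot mu v *: e) = evf F v.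

(** The expansions of F(e + t u) before and after the map are compared up to
    the second order in t. *)
Lemma preserves_coefs e mu u : evf F e = 0 -> preserves e mu ->
  let a := 1 + dot mu e in let g := line F e u in
  a ^+ d.-1 * g`_1 = g`_1 /\
  a ^+ d.-2 * (g`_2 + (dot mu u * g`_1) *+ d.-1) = g`_2.
Proof.
move=> Fe inv a g; set b := dot mu u.
have g0 : g`_0 = 0 by rewrite -horner_coef0 line_ev scale0r addr0.
(* The map sends e + t u to l(t) e + t u. *)
pose l : {poly K} := a%:P + b%:P * 'X.
have id : \sum_(j < d.+1) g`_j *: ('X^j * l ^+ (d - j)) = g.
  apply: poly_all_eq => t; rewrite /g line_ev horner_sum.
  have <- : evf F ((a + b * t) *: e + t *: u) = evf F (e + t *: u).
    rewrite -[RHS]inv dotD dotZ; congr (evf F _).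
    by rewrite [RHS]addrAC -[X in _ = X + _ + _]scale1r -scalerDl; congr (_ *: _ + _); rewrite /a /b; ring.
  rewrite (evf_pencil homF); apply: eq_bigr => j _.
  by rewrite hornerZ hornerM !horner_exp hornerD hornerM !hornerX !hornerC.
have l0 k : (l ^+ k)`_0 = a ^+ k.
  by rewrite -horner_coef0 horner_exp hornerD hornerM hornerX mulr0 addr0 hornerC.
have l1 k : (l ^+ k)`_1 = (a ^+ k.-1 * b) *+ k.
  have <- : (l ^+ k)^`().[0] = (l ^+ k)`_1 by rewrite horner_coef0 coef_deriv mulr1n.
  rewrite deriv_exp hornerMn hornerM horner_exp /l derivD derivM !derivC derivX mul0r !add0r mulr1.
  by rewrite hornerD hornerM hornerX !hornerC mulr0 addr0 mulrC.
have sum_low k : (k <= 2)%N -> \sum_(j < d.+1) (g`_j *: ('X^j * l ^+ (d - j)))`_k =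
    \sum_(j < 3) (g`_j *: ('X^j * l ^+ (d - j)))`_k.
  move=> k2; have le3 : (3 <= d.+1)%N by move: hd; lia.
  rewrite (big_ord_widen_cond _ xpredT (fun j => (g`_j *: ('X^j * l ^+ (d - j)))`_k) le3).
  rewrite [LHS](bigID (fun j : 'I_d.+1 => (j < 3)%N)) /= [X in _ + X]big1 ?addr0 // => j.
  by rewrite -leqNgt => lt; rewrite coefZ coefXnM (leq_ltn_trans k2) ?mulr0.
have c k : (k <= 2)%N -> \sum_(j < 3) (g`_j *: ('X^j * l ^+ (d - j)))`_k = g`_k.
  by move=> k2; rewrite -sum_low // -coef_sum id.
have := c 1%N isT; have := c 2%N isT.
rewrite !big_ord_recr !big_ord0 /= !coefZ !coefXnM /= g0 !mul0r !add0r mulr0 addr0.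
rewrite l0 l1 subn1 subn2 l0 => e2 e1; split; first by rewrite mulrC.
rewrite -[RHS]e2; have -> : (a ^+ d.-2 * b) *+ d.-1 = a ^+ d.-2 * (b *+ d.-1) by rewrite mulrnAr.
by rewrite mulrDr -mulrnAl; ring.
Qed.

Lemma centre_grad_neq0 e : on_curve F e -> gradv F e != 0.
Proof.
move=> ce; apply: contraTneq isT => g0; have [i] := smooth_grad hF ce.1 ce.2.
by have := congr1 (fun v : vec => v ord0 i) g0; rewrite !mxE => ->; rewrite eqxx.
Qed.

Lemma line_coef1 e u : (line F e u)`_1 = grad F e u.
Proof. by rewrite -line_deriv0 horner_coef0 coef_deriv mulr1n. Qed.

Lemma preserves_root1 e mu : on_curve F e -> preserves e mu -> (1 + dot mu e) ^+ d.-1 = 1.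
Proof.
move=> ce inv; have [u gu] := dot_neq0 (centre_grad_neq0 ce).
have [h _] := preserves_coefs u ce.2 inv; move: h.
rewrite line_coef1 -dot_gradv -{2}[dot _ u]mul1r; exact: mulIf.
Qed.

(** The second order determines mu up to the factor mu(e), since a^(d-1) = 1 by
    the first order. *)
Lemma preserves_polar e mu u : on_curve F e -> preserves e mu ->
  (dot mu u * grad F e u) *+ d.-1 = dot mu e * (line F e u)`_2.
Proof.
move=> ce inv; have aD := preserves_root1 ce inv.
have [_] := preserves_coefs u ce.2 inv; rewrite line_coef1 /= => h.
have := congr1 (fun t => (1 + dot mu e) * t) h.
rewrite mulrA -exprS (_ : d.-2.+1 = d.-1) ?aD ?mul1r; last by move: hd; lia.
move=> h2; apply: (addrI (line F e u)`_2); rewrite h2; ring.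
Qed.

Lemma preserves_unique e mu mu' : on_curve F e -> preserves e mu -> preserves e mu' ->
  dot mu' e *: mu = dot mu e *: mu'.
Proof.
move=> ce h h'; apply/eqP; rewrite -subr_eq0.
have n0 : (d.-1)%:R != 0 :> K by rewrite natK_eq0 //; move: hd; lia.
have H u : dot (dot mu' e *: mu - dot mu e *: mu') u * dot (gradv F e) u = 0.
  rewrite -scaleNr dotDl !dotZl dot_gradv mulrDl.
  apply: (mulIf n0); rewrite mul0r mulr_natr mulrnDl -!mulrA -(mulrnAr (dot mu' e))
    -(mulrnAr (- dot mu e)).
  by rewrite (preserves_polar u ce h) (preserves_polar u ce h'); ring.
case: (dot_prod0 H) => [->|g0] //.
by have := centre_grad_neq0 ce; rewrite g0 eqxx.
Qed.

Lemma preserves_id e mu : on_curve F e -> preserves e mu -> dot mu e = 0 -> mu = 0.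
Proof.
move=> ce h m0.
have n0 : (d.-1)%:R != 0 :> K by rewrite natK_eq0 //; move: hd; lia.
have H u : dot mu u * dot (gradv F e) u = 0.
  by apply: (mulIf n0); rewrite mul0r mulr_natr dot_gradv (preserves_polar u ce h) m0 mul0r.
case: (dot_prod0 H) => [->|g0] //.
by have := centre_grad_neq0 ce; rewrite g0 eqxx.
Qed.

(** The ratio a = 1 + mu(e) determines the homology, see [preserves_ratio_inj];
    this makes G[P] a group of roots of unity. *)
Definition acts e (a : K) : Prop := exists2 mu, preserves e mu & 1 + dot mu e = a.

Lemma preserves_comp e mu mu' : preserves e mu -> preserves e mu' ->
  preserves e (mu + mu' + dot mu e *: mu').
Proof.
move=> h h' v; rewrite -[RHS]h' -[RHS]h !dotDl dotZl dotD dotZ; congr (evf F _).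
by rewrite -[RHS]addrA -scalerDl; congr (v + _ *: e); ring.
Qed.

Lemma actsM e a b : acts e a -> acts e b -> acts e (a * b).
Proof.
move=> [mu h ea] [mu' h' eb]; exists (mu + mu' + dot mu e *: mu').
  exact: preserves_comp.
by rewrite !dotDl dotZl -ea -eb; ring.
Qed.

Lemma acts1 e : acts e 1.
Proof.
have z v : dot 0 v = 0 by rewrite -(scale0r (0 : vec)) dotZl mul0r.
by exists 0 => [v|]; rewrite z ?scale0r addr0.
Qed.

Lemma acts_root1 e a : on_curve F e -> acts e a -> a ^+ d.-1 = 1.
Proof. by move=> ce [mu h <-]; apply: preserves_root1. Qed.

(** * The group of a point of the curve *)

Lemma point_vector P : exists2 e, e != 0 & sval P = <[e]>%VS.
Proof.
case: P => U /= dU; exists (vpick U).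
  by rewrite vpick0 -dimv_eq0 (eqP dU).
apply/esym/eqP; rewrite eqEdim -memvE memv_pick dim_vline vpick0 -dimv_eq0.
by rewrite (eqP dU).
Qed.

Lemma point_eq P P' : sval P = sval P' -> P = P'.
Proof. exact: val_inj. Qed.

Lemma vector_point e : e != 0 -> exists P : point K, sval P = <[e]>%VS.
Proof.
move=> en0; have h : \dim <[e]>%VS == 1%N by rewrite dim_vline en0.
by exists (exist (fun U : {vspace vec} => is_true (\dim U == 1%N)) _ h).
Qed.

Lemma on_curve_scale c v : c != 0 -> on_curve F v -> on_curve F (c *: v).
Proof.
move=> cn0 [vn0 Fv]; split; first by rewrite scaler_eq0 negb_or cn0.
by have := evf_scale c v homF; rewrite /evf Fv mulr0.
Qed.

Lemma point_on_curveP P e : e != 0 -> sval P = <[e]>%VS ->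
  point_on_curve F P <-> on_curve F e.
Proof.
move=> en0 eP; split=> [h|h v]; first by apply: h => //; rewrite eP memv_line.
rewrite eP => /vlineP [k ->]; rewrite scaler_eq0 negb_or => /andP[kn0 _].
exact: on_curve_scale.
Qed.

Lemma line_scale k v : k != 0 -> <[k *: v]>%VS = <[v]>%VS.
Proof.
move=> kn0; apply/eqP; rewrite eqEsubv -!memvE memvZ ?memv_line //=.
by apply/vlineP; exists k^-1; rewrite scalerA mulVf // scale1r.
Qed.

Lemma linear_ratmap e mu : on_curve F e -> preserves e mu -> 1 + dot mu e != 0 ->
  exists s : ratmap F, forall v, rm_eval s v = v + dot mu v *: e.
Proof.
move=> ce inv an0.
pose A (i : 'I_3) : {mpoly K[3]} := 'X_i + e ord0 i *: linf mu.
have homA i : A i \is 1.-homog.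
  by apply: rpredD; [rewrite dhomogX /= mdeg1 | apply: rpredZ; apply: linf_homog].
have evA v : eval3 A v = v + dot mu v *: e.
  apply/rowP => i; rewrite !mxE -[LHS]/(evf (A i) v) evfD evfZ evf_linf.
  by rewrite /evf mevalXU mulrC.
have dom : exists v, on_curve F v /\ eval3 A v != 0.
  exists e; split=> //; rewrite evA -{1}[e]scale1r -scalerDl scaler_eq0 negb_or an0.
  exact: ce.1.
have img v : on_curve F v -> eval3 A v != 0 -> on_curve F (eval3 A v).
  by move=> cv nz; split=> //; rewrite evA; apply: etrans (inv v) cv.2.
by exists (RatMap homA dom img).
Qed.

Lemma preserves_inv e mu : preserves e mu -> 1 + dot mu e != 0 ->
  let mu' := - (1 + dot mu e)^-1 *: mu in
  [/\ preserves e mu', 1 + dot mu' e != 0,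
      forall v, (v + dot mu v *: e) + dot mu' (v + dot mu v *: e) *: e = v
    & forall v, (v + dot mu' v *: e) + dot mu (v + dot mu' v *: e) *: e = v].
Proof.
move=> inv an0 mu'; set a := 1 + dot mu e in an0 mu' *.
have c1 v : (v + dot mu v *: e) + dot mu' (v + dot mu v *: e) *: e = v.
  rewrite -addrA -scalerDl dotZl dotD dotZ.
  have -> : dot mu v + - a^-1 * (dot mu v + dot mu v * dot mu e) = 0 by rewrite /a; field.
  by rewrite scale0r addr0.
have c2 v : (v + dot mu' v *: e) + dot mu (v + dot mu' v *: e) *: e = v.
  rewrite -addrA -scalerDl !dotZl dotD !dotZ.
  have -> : - a^-1 * dot mu v + (dot mu v + - a^-1 * dot mu v * dot mu e) = 0.
    by rewrite /a; field.
  by rewrite scale0r addr0.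
split=> //; first by move=> v; rewrite -(inv (v + dot mu' v *: e)) c2.
by rewrite dotZl (_ : _ + _ = a^-1) ?invr_eq0 // /a; field.
Qed.

Lemma move_neq0 e mu v : v != 0 -> 1 + dot mu e != 0 -> v + dot mu v *: e != 0.
Proof.
move=> vn0 an0; apply: contra_neq vn0 => /eqP; rewrite addr_eq0 => /eqP ev.
have : dot mu v * (1 + dot mu e) = 0.
  by rewrite mulrDr mulr1 {1}ev -scaleNr dotZ mulNr addNr.
by move/eqP; rewrite mulf_eq0 (negPf an0) orbF => /eqP m0; rewrite ev m0 scale0r oppr0.
Qed.

Lemma linear_in_G P e mu (s : ratmap F) : on_curve F e -> sval P = <[e]>%VS ->
  preserves e mu -> 1 + dot mu e != 0 ->
  (forall v, rm_eval s v = v + dot mu v *: e) -> in_G P s.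
Proof.
move=> ce eP inv an0 es.
have [inv' an0' c1 c2] := preserves_inv inv an0.
set mu' := _ *: mu in inv' an0' c1 c2.
have [t et] := linear_ratmap ce inv' an0'.
split.
  exists t; split; split.
  - by exists e; rewrite es et c1; split=> //; [exact: move_neq0 ce.1 an0 | exact: ce.1].
  - by move=> v cv _ _; rewrite es et c1.
  - by exists e; rewrite et es c2; split=> //; [exact: move_neq0 ce.1 an0' | exact: ce.1].
  by move=> v cv _ _; rewrite et es c2.
move=> v cv _ _ _; rewrite es /proj_from eP.
apply/eqP; rewrite eqEsubv !subv_add !addvSl /= -!memvE; apply/andP; split.
  apply: memvD; first by apply: (subvP (addvSr _ _)); apply: memv_line.
  by apply: (subvP (addvSl _ _)); apply: memvZ; apply: memv_line.
rewrite -{1}(addrK (dot mu v *: e) v); apply: memvB.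
  by apply: (subvP (addvSr _ _)); apply: memv_line.
by apply: (subvP (addvSl _ _)); apply: memvZ; apply: memv_line.
Qed.

Lemma nonzero_entry v : v != 0 -> exists i, v ord0 i != 0.
Proof. by move/row3_neq0 => /or3P[h|h|h]; [exists ord0|exists i1|exists i2]. Qed.

(** If all values were equal to P, those of the inverse would be constant too,
    and the curve would be a point. *)
Lemma birational_nonconstant e (s : ratmap F) : on_curve F e -> birational s ->
  exists2 v, on_curve F v & forall k, rm_eval s v <> k *: e.
Proof.
move=> ce [t [[[v0 [cv0 sv0 tv0]] ts] _]]; apply: NNPP => h.
have sE v : on_curve F v -> exists k, rm_eval s v = k *: e.
  by move=> cv; apply: NNPP => h2; apply: h; exists v => // k ek; apply: h2; exists k.
have tZ c : rm_eval t (c *: e) = c ^+ rm_deg t *: rm_eval t e.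
  by apply/rowP => i; rewrite !mxE; apply: evf_scale; apply: rm_homog.
set w := rm_eval t e in tZ.
have wn0 : w != 0.
  have [k ek] := sE v0 cv0; apply: contraNneq tv0 => w0.
  by rewrite ek tZ w0 scaler0.
have prop v : on_curve F v -> rm_eval s v != 0 -> exists c, v = c *: w.
  move=> cv sv; have [k ek] := sE v cv.
  have kn0 : k != 0 by apply: contraNneq sv => k0; rewrite ek k0 scale0r.
  have tn0 : rm_eval t (rm_eval s v) != 0.
    by rewrite ek tZ scaler_eq0 negb_or expf_neq0.
  have := ts v cv sv tn0; rewrite ek tZ => e1.
  have : v \in <[v]>%VS by apply: memv_line.
  by rewrite -e1 => /vlineP [c ->]; exists (c * k ^+ rm_deg t); rewrite scalerA.
have [p [q D]] := complete_basis wn0.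
pose a : vec := coord1 p q w.
have aw : dot a w = 0.
  have := dot_coord1 0 0 1 D; by rewrite !scale0r scale1r !add0r.
have ap : dot a p = 1.
  by have := dot_coord1 1 0 0 D; rewrite !scale0r scale1r !addr0.
have [i si] := nonzero_entry sv0.
have a0 : forall v, on_curve F v -> evf (linf a) v = 0.
  apply: (curve_irreducible' charK0 hd1 hF (rm_homog s i) (linf_homog a)).
    by exists v0 => //; move: si; rewrite mxE.
  move=> v cv; rewrite evf_linf.
  have [s0|sn0] := eqVneq (rm_eval s v) 0.
    by have := congr1 (fun x : vec => x ord0 i) s0; rewrite !mxE /evf => ->; rewrite mul0r.
  by have [c ->] := prop v cv sn0; rewrite dotZ aw !mulr0.
have := low_degree_form charK0 hd1 hF hd1 (linf_homog a) a0 p.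
by rewrite evf_linf ap => /eqP; rewrite oner_eq0.
Qed.

(** Preserving the lines through P means that s(v), v and e are linearly
    dependent, as required by [fibre_map_linear]. *)
Lemma in_G_linear P e (s : ratmap F) : on_curve F e -> sval P = <[e]>%VS -> in_G P s ->
  exists mu, [/\ preserves e mu, 1 + dot mu e != 0 &
    forall v, on_curve F v -> exists k, rm_eval s v = k *: (v + dot mu v *: e)].
Proof.
move=> ce eP [bir pres].
apply: (fibre_map_linear charK0 hd hF ce (rm_homog s)).
- move=> v cv; have [->|nz] := eqVneq (eval3 (rm_form s) v) 0; first exact: evf0 homF.
  by have [] := rm_img cv nz.
- have d0l u : det3 (0 : vec) u e = 0 by rewrite /det3 !mxE; ring.
  have dkl k u : det3 (k *: e) u e = 0 by rewrite /det3 !mxE; ring.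
  have dkr k u : det3 u (k *: e) e = 0 by rewrite /det3 !mxE; ring.
  move=> v cv; have [|vP] := boolP (v \in sval P).
    by rewrite eP => /vlineP [k ->].
  have [->|nz] := eqVneq (eval3 (rm_form s) v) 0; first exact: d0l.
  have [|sP] := boolP (eval3 (rm_form s) v \in sval P).
    by rewrite eP => /vlineP [k ->].
  have e1 := pres v cv vP nz sP.
  have : rm_eval s v \in proj_from P (rm_eval s v).
    by apply: (subvP (addvSr _ _)); apply: memv_line.
  rewrite e1 /proj_from eP => /memv_addP [x /vlineP [k ->] [y /vlineP [l ->]]].
  rewrite /rm_eval => ->; rewrite /det3 !mxE; ring.
exact: birational_nonconstant bir.
Qed.

Lemma common_nonzero k l m (A B C : {mpoly K[3]}) :
  A \is k.-homog -> B \is l.-homog -> C \is m.-homog ->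
  (exists2 v, on_curve F v & evf A v != 0) ->
  (exists2 v, on_curve F v & evf B v != 0) ->
  (exists2 v, on_curve F v & evf C v != 0) ->
  exists2 v, on_curve F v & [/\ evf A v != 0, evf B v != 0 & evf C v != 0].
Proof.
move=> hA hB hC nA nB nC; apply: NNPP => h.
have hAB : exists2 v, on_curve F v & evf (A * B) v != 0.
  apply: NNPP => h2; have [v cv Bv] := nB.
  suff B0 : evf B v = 0 by rewrite B0 eqxx in Bv.
  move: v cv {Bv}; apply: (curve_irreducible' charK0 hd1 hF hA hB nA) => v cv.
  by rewrite -evfM; apply/eqP/negPn/negP => nz; apply: h2; exists v.
have [v cv Cv] := nC; suff C0 : evf C v = 0 by rewrite C0 eqxx in Cv.
move: v cv {Cv}; apply: (curve_irreducible' charK0 hd1 hF (dhomogM hA hB) hC hAB) => v cv.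
rewrite evfM; apply/eqP/negPn/negP; rewrite !mulf_eq0 !negb_or => /andP[/andP[a b] c].
by apply: h; exists v.
Qed.

Lemma linear_nonzero a : a != 0 -> exists2 v, on_curve F v & evf (linf a) v != 0.
Proof.
move=> an0; apply: (low_degree_nonzero charK0 hd1 hF hd1 (linf_homog a)).
by have [v av] := dot_neq0 an0; exists v; rewrite evf_linf.
Qed.

(** The two maps are compared at a point where all the representatives are
    nonzero and mu - mu' does not vanish. *)
Lemma rm_eq_linear e mu mu' (s t : ratmap F) : on_curve F e ->
  1 + dot mu e != 0 -> 1 + dot mu' e != 0 ->
  (forall v, on_curve F v -> exists k, rm_eval s v = k *: (v + dot mu v *: e)) ->
  (forall v, on_curve F v -> exists k, rm_eval t v = k *: (v + dot mu' v *: e)) ->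
  rm_eq s t <-> mu = mu'.
Proof.
move=> ce an0 an0' hs ht; split; last first.
  move=> emu v cv sv tv; have [k ek] := hs v cv; have [l el] := ht v cv.
  move: sv tv; rewrite ek el emu !scaler_eq0 !negb_or => /andP[kn0 _] /andP[ln0 _].
  by rewrite !line_scale.
move=> est; apply/eqP/negPn/negP => ne.
have mun0 : mu - mu' != 0 by rewrite subr_eq0.
have dom (r : ratmap F) : exists i, exists2 v, on_curve F v & evf (rm_form r i) v != 0.
  have [v [cv nz]] := rm_dom r; have [i hi] := nonzero_entry nz.
  by exists i, v => //; move: hi; rewrite mxE.
have [i hi] := dom s; have [j hj] := dom t.
have [p [q D]] := complete_basis ce.1.
(* A linear form vanishing at e, so that it only sees the scalar factors. *)
pose y := coord1 p q e.
have ye : dot y e = 0 by have := dot_coord1 0 0 1 D; rewrite !scale0r scale1r !add0r.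
have yn0 : y != 0.
  apply/eqP => y0; have := dot_coord1 1 0 0 D; rewrite !scale0r scale1r !addr0 -/y y0.
  by rewrite -(scale0r (0 : vec)) dotZl mul0r => /esym/eqP; rewrite oner_eq0.
have hym : exists2 v, on_curve F v & evf (linf y * linf (mu - mu')) v != 0.
  have [v cv [h1 h2 _]] := common_nonzero (linf_homog y) (linf_homog (mu - mu'))
    (linf_homog y) (linear_nonzero yn0) (linear_nonzero mun0) (linear_nonzero yn0).
  by exists v => //; rewrite evfM mulf_neq0.
have [v cv [sv tv]] := common_nonzero (rm_homog s i) (rm_homog t j)
  (dhomogM (linf_homog y) (linf_homog (mu - mu'))) hi hj hym.
rewrite evfM !evf_linf mulf_eq0 negb_or => /andP[yv mv].
have sn0 : rm_eval s v != 0.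
  apply: contraNneq sv => s0.
  by have := congr1 (fun x : vec => x ord0 i) s0; rewrite !mxE /evf => ->.
have tn0 : rm_eval t v != 0.
  apply: contraNneq tv => t0.
  by have := congr1 (fun x : vec => x ord0 j) t0; rewrite !mxE /evf => ->.
have [k ek] := hs v cv; have [l el] := ht v cv.
have := est v cv sn0 tn0; rewrite ek el => est'.
have : k *: (v + dot mu v *: e) \in <[l *: (v + dot mu' v *: e)]>%VS.
  by rewrite -est' memv_line.
move=> /vlineP [c]; rewrite scalerA => ec.
have kn0 : k != 0 by apply: contraNneq sn0 => k0; rewrite ek k0 scale0r.
have ekl : k = c * l.
  have := congr1 (dot y) ec; rewrite !dotZ !dotD !dotZ ye !mulr0 !addr0.
  exact: mulIf.
move: ec; rewrite -ekl => /(scalerI kn0) /addrI /eqP.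
rewrite -subr_eq0 -scalerBl scaler_eq0 (negPf ce.1) orbF.
by move: mv; rewrite -scaleN1r dotDl dotZl mulN1r => /negPf ->.
Qed.

Lemma preserves_ratio_inj e mu mu' : on_curve F e -> preserves e mu -> preserves e mu' ->
  1 + dot mu e = 1 + dot mu' e -> mu = mu'.
Proof.
move=> ce h h' /addrI e1; have [m0|mn0] := eqVneq (dot mu e) 0.
  by rewrite (preserves_id ce h m0) (preserves_id ce h') // -e1.
by have := preserves_unique ce h h'; rewrite -e1; apply: scalerI.
Qed.

Lemma acts_neq0 e a : on_curve F e -> acts e a -> a != 0.
Proof.
move=> ce /(acts_root1 ce) h; apply/eqP => a0; move: h.
rewrite a0 expr0n; case: eqP => [|_ /eqP]; first by move: hd; lia.
by rewrite eq_sym oner_eq0.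
Qed.

Lemma G_order_ratios P e n : on_curve F e -> sval P = <[e]>%VS -> G_order F P n ->
  exists s : seq K, [/\ uniq s, size s = n & forall a, a \in s <-> acts e a].
Proof.
move=> ce eP [s [sG s_inj s_surj]].
have hmu i := in_G_linear ce eP (sG i).
have [mu hm] := fin_all_exists hmu.
exists [seq 1 + dot (mu i) e | i <- enum 'I_n]; split.
- rewrite map_inj_in_uniq ?enum_uniq // => i j _ _ eij.
  have [pi ni hi] := hm i; have [pj nj hj] := hm j.
  apply: s_inj; apply/(rm_eq_linear ce ni nj hi hj).
  exact: preserves_ratio_inj eij.
- by rewrite size_map size_enum_ord.
move=> a; split=> [/mapP [i _ ->]|[m hm' <-]].
  by have [pi _ _] := hm i; exists (mu i).
have an0 : 1 + dot m e != 0 by apply: (acts_neq0 ce); exists m.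
have [t et] := linear_ratmap ce hm' an0.
have tG := linear_in_G ce eP hm' an0 et.
have [i hi] := s_surj t tG; have [pi ni hi'] := hm i.
have ht v : on_curve F v -> exists k, rm_eval t v = k *: (v + dot m v *: e).
  by move=> _; exists 1; rewrite scale1r.
have em : m = mu i by apply/(rm_eq_linear ce an0 ni ht hi').
by apply/mapP; exists i; rewrite ?mem_enum // em.
Qed.

(** The ratios of the elements of G[P] form a finite subgroup of the
    multiplicative group of K. *)
Lemma G_order_roots P e n : (0 < n)%N -> on_curve F e -> sval P = <[e]>%VS -> G_order F P n ->
  exists2 om : K, n.-primitive_root om & forall a, acts e a <-> a ^+ n = 1.
Proof.
move=> n0 ce eP /(G_order_ratios ce eP) [s [us szs hs]].
have root1 a : a \in s -> a ^+ n = 1.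
  rewrite -szs; apply: finite_mul_roots => // [b|b c].
    by move/hs; apply: acts_neq0.
  by move=> /hs hb /hs hc; apply/hs; apply: actsM.
have all_s : all n.-unity_root s by apply/allP => a /root1 h; apply/unity_rootP.
have /hasP [om oms prim] : has n.-primitive_root s by apply: has_prim_root; rewrite ?szs.
exists om => // a; split=> [/hs /root1 //|an].
have [i ->] := prim_rootP prim an.
elim: (i : nat) => [|j IH]; first exact: acts1.
by rewrite exprS; apply: actsM => //; apply/hs.
Qed.

Lemma roots_G_order P e n (om : K) : on_curve F e -> sval P = <[e]>%VS ->
  n.-primitive_root om -> (forall a, acts e a <-> a ^+ n = 1) -> G_order F P n.
Proof.
move=> ce eP prim hacts; have n0 := prim_order_gt0 prim.
have hmu (i : 'I_n) : exists sm : ratmap F * vec,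
    [/\ preserves e sm.2, 1 + dot sm.2 e = om ^+ i, 1 + dot sm.2 e != 0 &
      forall v, rm_eval sm.1 v = v + dot sm.2 v *: e].
  have [mu hm em] : acts e (om ^+ i).
    by apply/hacts; rewrite exprAC (prim_expr_order prim) expr1n.
  have an0 : 1 + dot mu e != 0 by apply: (acts_neq0 ce); exists mu.
  by have [s es] := linear_ratmap ce hm an0; exists (s, mu).
have [sm hsm] : exists sm : 'I_n -> ratmap F * vec, forall i,
    [/\ preserves e (sm i).2, 1 + dot (sm i).2 e = om ^+ i, 1 + dot (sm i).2 e != 0 &
      forall v, rm_eval (sm i).1 v = v + dot (sm i).2 v *: e].
  exact: fin_all_exists hmu.
have lin i v : on_curve F v -> exists k, rm_eval (sm i).1 v = k *: (v + dot (sm i).2 v *: e).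
  by move=> _; have [_ _ _ es] := hsm i; exists 1; rewrite scale1r es.
exists (fun i => (sm i).1); split=> [i|i j eij|t tG].
- by have [hm _ an0 es] := hsm i; apply: linear_in_G eP hm an0 es.
- have [_ ei ni _] := hsm i; have [_ ej nj _] := hsm j.
  have /(rm_eq_linear ce ni nj (lin i) (lin j)) em := eij.
  apply: val_inj; apply/eqP; have := eq_prim_root_expr prim i j.
  by rewrite -ei -ej em eqxx => /esym; rewrite /eqn !modn_small.
have [m [hm an0 ht]] := in_G_linear ce eP tG.
have : (1 + dot m e) ^+ n = 1 by apply/hacts; exists m.
move/(prim_rootP prim) => [i ei]; exists i.
have [hm' ei' ni _] := hsm i.
apply/(rm_eq_linear ce an0 ni ht (lin i)).
by apply: (preserves_ratio_inj ce hm hm'); rewrite ei ei'.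
Qed.

Lemma G_order_quasi_galois P n : (1 < n)%N -> G_order F P n -> quasi_galois F P.
Proof.
move=> n1 [s [sG s_inj _]].
exists (s (Ordinal (ltnW n1))), (s (Ordinal n1)); split=> // h.
by have := s_inj _ _ h => /(congr1 val).
Qed.

(** * Centres of homologies of a given order *)

Definition indep u w : Prop := forall a b : K, a *: u + b *: w = 0 -> a = 0 /\ b = 0.

Lemma indep_cross u w : indep u w -> cross u w != 0.
Proof.
move=> ind; apply/eqP => /rowP c0.
have m0 := c0 ord0; have m1 := c0 i1; have m2 := c0 i2; rewrite !mxE /= in m0 m1 m2.
have cmp (i : 'I_3) : - w ord0 i *: u + u ord0 i *: w = 0.
  have [->|[->|->]] : i = ord0 \/ i = i1 \/ i = i2.
    by case: i => -[|[|[|//]]] hi; [left|right; left|right; right]; apply: val_inj.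
  - apply: row3P; rewrite !mxE; [ring | by rewrite -m2; ring | ].
    by rewrite -[RHS]oppr0 -m1; ring.
  - apply: row3P; rewrite !mxE; [ | ring | by rewrite -m0; ring].
    by rewrite -[RHS]oppr0 -m2; ring.
  apply: row3P; rewrite !mxE; [by rewrite -m1; ring | | ring].
  by rewrite -[RHS]oppr0 -m0; ring.
have u0 : u = 0 by apply/rowP => i; rewrite mxE; have [] := ind _ _ (cmp i).
have [|/eqP] := ind 1 0; first by rewrite u0 scaler0 scale0r addr0.
by rewrite oner_eq0.
Qed.

(** A line in the curve would be the graph Y = 0 of some chart. *)
Lemma curve_no_line u w : indep u w ->
  exists t, evf F (u + t *: w) != 0.
Proof.
move=> ind; have [o o1] := (curve_unit_point hd1 hF).
apply: NNPP => h; have F0 t : evf F (u + t *: w) = 0.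
  by apply/eqP/negPn/negP => nz; apply: h; exists t.
have F_span a b : evf F (a *: u + b *: w) = 0.
  rewrite (evf_pencil homF) big1 // => j _.
  have -> : line F u w = 0 by apply: poly_all_eq0 => t; rewrite line_ev.
  by rewrite coef0 mul0r.
have cn0 := indep_cross ind.
have [p] := dot_neq0 cn0; rewrite dot_cross => Dp.
have Dp' : det3 u w p != 0 by rewrite (_ : det3 u w p = det3 p u w) // /det3; ring.
have [a [b [c eo]]] := basis_span o Dp'.
have cne0 : c != 0.
  apply/eqP => c0; move/eqP: o1; rewrite eo c0 scale0r addr0 F_span.
  by rewrite eq_sym oner_eq0.
have D : det3 u w o != 0 by rewrite eo det3_lin1 mulf_neq0.
have [mf szf] := ch_monic hF u w o1.
have szf3 : (2 < size (chart F u w o))%N by rewrite szf ltnS.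
have := chart_no_section charK0 hd1 hF 0 D mf szf3; apply/negP; rewrite negbK.
by apply/eqP/poly_all_eq0 => t; rewrite (ch_horner F u w o 0) scale0r addr0 line_ev.
Qed.

Lemma indep_sym u w : indep u w -> indep w u.
Proof. by move=> h a b e; have [] := h b a; rewrite 1?addrC. Qed.

Lemma indep_scale u w : u != 0 -> (forall k, w <> k *: u) -> indep u w.
Proof.
move=> un0 nk a b e; have [b0|bn0] := eqVneq b 0.
  move: e; rewrite b0 scale0r addr0 => /eqP; rewrite scaler_eq0 (negPf un0) orbF.
  by move/eqP.
case: (nk (- (a / b))); apply: (scalerI bn0).
by rewrite scalerA mulrN mulrC divfK // scaleNr; apply/eqP; rewrite -addr_eq0 addrC e.
Qed.

Lemma indep_combo u w c : indep u w -> indep u (w + c *: u).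
Proof.
move=> h a b; rewrite scalerDr scalerA addrCA -scalerDl addrC => e.
by have [a0 b0] := h (a + b * c) b e; move: a0; rewrite b0 mul0r addr0.
Qed.

(** The homology of ratio c with centre g and axis h = 0, when h(g) = 1. *)
Definition keeps_curve (c : K) g h : Prop :=
  forall v, evf F (v + ((c - 1) * dot h v) *: g) = evf F v.

(** With the normalisation f(e) = 1, the form f is determined by e and c, see
    [centre_unique]. *)
Definition centre (c : K) e f : Prop :=
  [/\ on_curve F e, dot f e = 1 & keeps_curve c e f].

Lemma keeps_preserves c g h : keeps_curve c g h -> preserves g ((c - 1) *: h).
Proof. by move=> inv v; rewrite dotZl inv. Qed.

Lemma centre_acts c e f : centre c e f -> acts e c.
Proof.
case=> ce fe inv; exists ((c - 1) *: f); first exact: keeps_preserves.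
by rewrite dotZl fe mulr1 addrC subrK.
Qed.

Lemma acts_centre c e : on_curve F e -> c != 1 -> acts e c -> exists f, centre c e f.
Proof.
move=> ce c1 [mu inv emu]; have c1' : c - 1 != 0 by rewrite subr_eq0.
have eme : dot mu e = c - 1 by rewrite -emu addrC addKr.
exists ((c - 1)^-1 *: mu); split=> // [|v]; first by rewrite dotZl eme mulVf.
by rewrite dotZl mulrA mulfV // mul1r inv.
Qed.

Lemma centre_unique c e f f' : c != 1 -> centre c e f -> centre c e f' -> f = f'.
Proof.
move=> c1 [ce fe inv] [_ fe' inv']; have c1' : c - 1 != 0 by rewrite subr_eq0.
apply: (scalerI c1').
apply: (preserves_ratio_inj ce (keeps_preserves inv) (keeps_preserves inv')).
by rewrite !dotZl fe fe'.
Qed.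

Lemma centre_scale c k e f : k != 0 -> centre c e f -> centre c (k *: e) (k^-1 *: f).
Proof.
move=> kn0 [ce fe inv]; split.
- exact: (on_curve_scale kn0 ce).
- by rewrite dotZl dotZ fe mulr1 mulVf.
move=> v; rewrite dotZl scalerA.
by have -> : (c - 1) * (k^-1 * dot f v) * k = (c - 1) * dot f v; [field | exact: inv].
Qed.

Lemma keeps_curveM c c' g h : dot h g = 1 -> keeps_curve c g h -> keeps_curve c' g h ->
  keeps_curve (c * c') g h.
Proof.
move=> hg i i' v; rewrite -[RHS]i' -[RHS]i dotD dotZ hg -addrA -scalerDl.
by congr (evf F (v + _ *: g)); ring.
Qed.

(** The homology with centre g conjugates the homology with centre e into one
    of the same ratio. *)
Lemma centre_image c c' e f g h : c' != 0 -> dot h g = 1 -> keeps_curve c' g h ->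
  centre c e f ->
  centre c (e + ((c' - 1) * dot h e) *: g) (f + ((c'^-1 - 1) * dot f g) *: h).
Proof.
move=> cn0 hg inv [[en0 Fe] fe inve].
have dual v : dot (f + ((c'^-1 - 1) * dot f g) *: h) (v + ((c' - 1) * dot h v) *: g) = dot f v.
  by rewrite dotDl dotZl !dotD !dotZ hg; field.
split.
- split; last by apply: etrans (inv e) Fe.
  apply: contra_eq_neq fe => e0; have := dual e; rewrite e0 dot0r => <-.
  by rewrite eq_sym oner_eq0.
- by rewrite dual.
move=> v; pose w := v + ((c'^-1 - 1) * dot h v) *: g.
have ev : v = w + ((c' - 1) * dot h w) *: g.
  rewrite /w dotD dotZ hg -addrA -scalerDl.
  have -> : (c'^-1 - 1) * dot h v + (c' - 1) * (dot h v + (c'^-1 - 1) * dot h v * 1) = 0.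
    by field; exact: cn0.
  by rewrite scale0r addr0.
rewrite {1 2}ev dual.
have -> : w + ((c' - 1) * dot h w) *: g + ((c - 1) * dot f w) *:
    (e + ((c' - 1) * dot h e) *: g) =
  (w + ((c - 1) * dot f w) *: e) + ((c' - 1) * dot h (w + ((c - 1) * dot f w) *: e)) *: g.
  by rewrite dotD dotZ; apply/rowP => i; rewrite !mxE; ring.
by rewrite inv inve ev inv.
Qed.

Lemma det3_indep u v w : det3 u v w != 0 -> indep v w.
Proof.
move=> D a b e; split; apply: (mulIf D); rewrite mul0r.
  have -> : a * det3 u v w = det3 u (a *: v + b *: w) w by rewrite /det3 !mxE; ring.
  by rewrite e /det3 !mxE; ring.
have -> : b * det3 u v w = det3 u v (a *: v + b *: w) by rewrite /det3 !mxE; ring.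
by rewrite e /det3 !mxE; ring.
Qed.

Lemma indep_span u w v : indep u w -> det3 u w v = 0 -> exists a b, v = a *: u + b *: w.
Proof.
move=> /indep_cross /dot_neq0 [p]; rewrite dot_cross => D.
have [x [y [z ->]]] := basis_span v D => e.
exists y, z; suff -> : x = 0 by rewrite scale0r add0r.
by apply: (mulIf D); rewrite mul0r -e /det3 !mxE; ring.
Qed.

Lemma acts_exp e a k : acts e a -> acts e (a ^+ k).
Proof.
by move=> ha; elim: k => [|k ih]; rewrite ?expr0 ?exprS; [apply: acts1 | apply: actsM].
Qed.

Section Primitive.
Variables (n : nat) (om : K).
Hypothesis prim : n.-primitive_root om.
Hypothesis n3 : (2 < n)%N.
Local Notation centre := (centre om).

Lemma om_neq1 : om != 1.
Proof.
have := prim_order_dvd prim 1; rewrite expr1 => <-.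
by rewrite dvdn1 gtn_eqF // ltnW.
Qed.

Lemma om_neq0 : om != 0.
Proof.
apply/eqP => o0; have := prim_expr_order prim; rewrite o0 expr0n.
by case: (n) n3 => // k _ /eqP; rewrite eq_sym oner_eq0.
Qed.

Lemma centre_order_dvd e f : centre e f -> (n %| d.-1)%N.
Proof.
move=> ce; rewrite (prim_order_dvd prim); apply/eqP.
by have [ec _ _] := ce; apply: (acts_root1 ec (centre_acts ce)).
Qed.

(** If e' were on the axis of e, it would be fixed by the homology at e, and
    the multiplicity at e' of the curve on the line joining the centres would
    be 0 modulo n. But e' is a centre, so that this multiplicity is d modulo n,
    that is 1 modulo n. *)
Lemma centre_off_axis e f e' f' : centre e f -> centre e' f' -> indep e e' ->
  dot f e' != 0.
Proof.
move=> ce ce' ind; apply/eqP => f0.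
have nd := centre_order_dvd ce.
have [_ fe inv] := ce; have [_ fe' inv'] := ce'.
(* e' is the point t = 0 of the first expansion; the second one uses the
   intersection w of the line with the axis of e', and starts alike. *)
pose phi := line F e' e.
have phi_n k : phi`_k != 0 -> (n %| k)%N.
  move=> pk; have : phi \Po (om *: 'X) = phi.
    apply: poly_all_eq => t; rewrite horner_comp hornerZ hornerX !line_ev.
    rewrite -[RHS]inv dotD dotZ fe f0 -addrA -scalerDl.
    by congr (evf F (e' + _ *: e)); ring.
  move/(congr1 (fun p : {poly K} => p`_k)).
  rewrite coef_comp_scale -{2}[phi`_k]mul1r => /(mulIf pk) ok.
  by rewrite (prim_order_dvd prim) ok.
pose c := dot f' e; pose w := e - c *: e'.
have fw : dot f' w = 0 by rewrite /w -scaleNr dotD dotZ fe' mulr1 subrr.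
pose l := line F e' w.
have l_n k : (k <= d)%N -> l`_k != 0 -> (n %| d - k)%N.
  move=> kd lk.
  have : \sum_(j < d.+1) (l`_j * om ^+ (d - j)) *: 'X^j = l.
    apply: poly_all_eq => t; rewrite horner_sum line_ev -[RHS]inv' dotD dotZ fw fe'.
    have -> : e' + t *: w + ((om - 1) * (1 + t * 0)) *: e' = om *: e' + t *: w.
      by rewrite addrAC -{1}[e']scale1r -scalerDl; congr (_ *: _ + _); ring.
    rewrite (evf_pencil homF); apply: eq_bigr => j _.
    by rewrite hornerZ hornerXn; ring.
  move/(congr1 (fun p : {poly K} => p`_k)); rewrite coef_sum.
  have lt : (k < d.+1)%N by [].
  rewrite (bigD1 (Ordinal lt)) //= big1 => [|j ne]; last first.
    by rewrite coefZ coefXn; rewrite -val_eqE /= eq_sym in ne; rewrite (negPf ne) mulr0.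
  rewrite coefZ coefXn eqxx mulr1 addr0 mulrC -{2}[l`_k]mul1r => /(mulIf lk) ok.
  by rewrite (prim_order_dvd prim) ok.
have lE : l = \sum_(j < d.+1) phi`_j *: ('X^j * (1%:P + (- c) *: 'X) ^+ (d - j)).
  apply: poly_all_eq => t; rewrite line_ev horner_sum.
  have -> : e' + t *: w = (1 - c * t) *: e' + t *: e.
    rewrite /w scalerBr scalerA scalerBl scale1r [t * c]mulrC.
    by rewrite addrA addrAC.
  rewrite (evf_pencil homF); apply: eq_bigr => j _.
  rewrite hornerZ hornerM !horner_exp hornerX hornerD hornerC hornerZ hornerX.
  by rewrite mulNr.
have phi0 : phi != 0.
  have [t nz] := curve_no_line (indep_sym ind).
  by apply: contraNneq nz => p0; rewrite -line_ev -/phi p0 horner0.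
have exP : exists k, phi`_k != 0.
  by exists (size phi).-1; rewrite -lead_coefE lead_coef_eq0.
have [k pk mink] := ex_minnP exP.
have kd : (k <= d)%N.
  rewrite leqNgt; apply/negP => lt; move: pk; rewrite nth_default ?eqxx //.
  exact: leq_trans (size_line homF _ _) lt.
have lk : l`_k = phi`_k.
  rewrite lE coef_sum; have lt : (k < d.+1)%N by [].
  rewrite (bigD1 (Ordinal lt)) //= big1 => [|j ne].
    by rewrite coefZ coefXnM ltnn subnn coef_lin_pow subn0 expr1n expr0 mulr1 bin0 mulr1n mulr1 addr0.
  rewrite coefZ coefXnM; case: ltnP => [_|le]; first by rewrite mulr0.
  have [->|pj] := eqVneq phi`_j 0; first by rewrite mul0r.
  by move: ne; rewrite -val_eqE /= eqn_leq le (mink _ pj).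
have h1 := phi_n k pk.
have h2 : (n %| d - k)%N by apply: l_n; rewrite ?lk.
have nd' : (n %| d)%N by rewrite -(subnK kd) dvdn_add.
have : (n %| 1)%N by rewrite -(dvdn_addr _ nd) addn1 prednK // ltnW.
by rewrite dvdn1; move: n3; lia.
Qed.

Lemma centre_rotate e f u g : centre e f -> dot f u = 0 -> forall t,
  centre (u + t *: e) g -> exists g', centre (u + (om * t) *: e) g'.
Proof.
move=> ce fu t cu; have [_ fe inv] := ce.
exists (g + ((om^-1 - 1) * dot g e) *: f).
have := centre_image (om_neq0) fe inv cu.
rewrite dotD dotZ fu fe -addrA -scalerDl.
by have -> : t + (om - 1) * (0 + t * 1) = om * t by ring.
Qed.

(** Take the coordinate t of r + t e on the line, where r is its intersection
    with the axis of e: the homology at e is the rotation t |-> om t. From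
    another centre r + t e the point e is seen at beta t = f_t(e). The other
    centres of the line form a set to which [configuration_four] applies. *)
Theorem centre_pair e f e' f' : centre e f -> centre e' f' -> indep e e' ->
  [/\ n = 3%N, 3 * (dot f e' * dot f' e) = 1 &
    exists2 T : seq K, uniq T /\ size T = 3%N &
      forall t, t \in T <-> exists g, centre (e' - dot f e' *: e + t *: e) g].
Proof.
move=> ce ce' ind; have [cve fe inv] := ce.
set r := e' - dot f e' *: e.
have fr : dot f r = 0 by rewrite /r -scaleNr dotD dotZ fe mulr1 subrr.
have er : indep e r by rewrite /r -scaleNr; apply: indep_combo.
have re' : r + dot f e' *: e = e' by rewrite /r subrK.
clearbody r.
have [t0 nz0] := curve_no_line (indep_sym er).
have ln0 : line F r e != 0.
  by apply: contraNneq nz0 => l0; rewrite -line_ev l0 horner0.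
have [rs eqrs] := closed_field_poly_normal (line F r e).
have root_rs t : evf F (r + t *: e) = 0 -> t \in rs.
  rewrite -line_ev => /eqP; rewrite eqrs -rootE rootZ ?lead_coef_eq0 //.
  by rewrite root_prod_XsubC.
have [T uT hT0] := classical_filter (fun t => exists g, centre (r + t *: e) g) rs.
have hT t : t \in T <-> exists g, centre (r + t *: e) g.
  split; first by case/hT0.
  by move=> h; apply/hT0; split=> //; have [g [[_ h0] _ _]] := h; apply: root_rs.
have [ft hft] := seq_choice 0 (fun t => (hT t).1).
pose beta t := dot (ft t) e.
have ind_t t : indep (r + t *: e) e by apply/indep_sym/indep_combo.
have ind_tu (t u : K) : u != t -> indep (r + t *: e) (r + u *: e).
  move=> ne; have -> : r + u *: e = (u - t) *: e + 1 *: (r + t *: e).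
    by rewrite scale1r addrCA -scalerDl subrK.
  apply: indep_combo => a b; rewrite scalerA => /(ind_t t) [-> /eqP].
  by rewrite mulf_eq0 subr_eq0 (negPf ne) orbF => /eqP.
have t'T : dot f e' \in T by apply/hT; exists f'; rewrite re'.
have T_gt0 : (0 < size T)%N by case: (T) t'T.
have T0 : 0 \notin T.
  apply/negP => /hT [g]; rewrite scale0r addr0 => cr.
  by have := centre_off_axis ce cr er; rewrite fr eqxx.
have Trot : {in T, forall x, om * x \in T}.
  by move=> t /hT [g cg]; apply/hT; exact: (centre_rotate ce fr cg).
have beta0 t : t \in T -> beta t != 0.
  by move=> tT; apply: (centre_off_axis (hft t tT) ce (ind_t t)).
have S0 : {in T, forall t, 0 \notin seen_from T beta t}.
  move=> t tT; rewrite in_cons eq_sym (negPf (beta0 t tT)) /=.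
  apply/mapP => -[u]; rewrite mem_filter => /andP[ne uT' e0].
  have ut0 : u - t != 0 by rewrite subr_eq0.
  have := centre_off_axis (hft t tT) (hft u uT') (ind_tu t u ne).
  have -> : r + u *: e = (r + t *: e) + (u - t) *: e by rewrite -addrA -scalerDl [t + _]addrC subrK.
  rewrite dotD dotZ; have [_ -> _] := hft t tT; rewrite -/(beta t).
  have -> : beta t = - (u - t)^-1 by apply/eqP; rewrite -addr_eq0 -e0.
  by rewrite mulrN mulfV // subrr eqxx.
(* The rotation about r + t e acts on the points seen from there. *)
have seenP t : t \in T -> forall x, x \in seen_from T beta t <->
    exists g, centre (e - beta t *: (r + t *: e) + x *: (r + t *: e)) g.
  move=> tT x; have -> : e - beta t *: (r + t *: e) + x *: (r + t *: e) =
      e + (x - beta t) *: (r + t *: e) by rewrite scalerBl addrAC addrA.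
  rewrite in_cons; split.
    case/predU1P => [->|/mapP[u]]; first by exists f; rewrite subrr scale0r addr0.
    rewrite mem_filter => /andP[ne uT'] ->; rewrite [beta t + _]addrC addrK.
    have ut0 : u - t != 0 by rewrite subr_eq0.
    exists ((u - t)^-1^-1 *: ft u).
    have := centre_scale (invr_neq0 ut0) (hft u uT').
    congr (centre _ _); apply/rowP => i; rewrite !mxE; field; exact: ut0.
  case=> g cg; have [->|ne] := eqVneq x (beta t); first by [].
  have xb : x - beta t != 0 by rewrite subr_eq0.
  apply/mapP; exists (t + (x - beta t)^-1); last by rewrite [t + _]addrC addrK invrK addrC subrK.
  rewrite mem_filter -subr_eq0 [t + _]addrC addrK invr_eq0 xb /=.
  apply/hT; exists ((x - beta t)^-1^-1 *: g).
  have := centre_scale (invr_neq0 xb) cg.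
  congr (centre _ _); apply/rowP => i; rewrite !mxE; field; exact: xb.
have Srot : {in T, forall t, {in seen_from T beta t, forall x, om * x \in seen_from T beta t}}.
  move=> t tT x /(seenP t tT) [g cg]; apply/(seenP t tT).
  have [_ fte _] := hft t tT.
  by apply: (centre_rotate (hft t tT) _ cg); rewrite -scaleNr dotD dotZ fte mulr1 subrr.
have [en eT h] := configuration_four charK0 prim n3 uT T_gt0 T0 Trot S0 Srot.
split=> //; last by exists T.
have := h _ t'T; rewrite mulrC [_ * dot f e']mulrC mulrC /beta.
suff -> : ft (dot f e') = f' by [].
apply: (centre_unique (om_neq1) (e := e')) => //.
by have := hft _ t'T; rewrite re'.
Qed.

Lemma cube_root_sum : n = 3%N -> om ^+ 2 = - om - 1.
Proof.
move=> en; apply/eqP; rewrite -subr_eq0; apply/eqP.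
have o1 : om - 1 != 0 by rewrite subr_eq0 (om_neq1).
apply: (mulfI o1); rewrite mulr0.
have := prim_expr_order prim; rewrite en => o3.
by rewrite -[RHS](subrr 1) -{3}o3; ring.
Qed.

(** The pair relation for the third centre and the image of the second one
    under a homology at the first one. *)
Lemma cyclic_products c e1 f1 e2 f2 e3 f3 :
  centre e1 f1 -> centre e2 f2 -> centre e3 f3 -> det3 e1 e2 e3 != 0 ->
  c ^+ 2 = - c - 1 -> keeps_curve c e1 f1 ->
  3 * ((c - 1) * (dot f1 e2 * dot f2 e3 * dot f3 e1) +
    (- c - 2) * (dot f1 e3 * dot f3 e2 * dot f2 e1)) = - 1.
Proof.
move=> c1 c2 c3 D cE inv; have [_ fe1 _] := c1.
have [D2 D3] : det3 e3 e1 e2 != 0 /\ det3 e2 e3 e1 != 0.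
  by split; move: D; congr (_ != 0); rewrite /det3; ring.
have [_ r12 _] := centre_pair c1 c2 (det3_indep D2).
have [_ r23 _] := centre_pair c2 c3 (det3_indep D).
have [_ r31 _] := centre_pair c3 c1 (det3_indep D3).
have ci : c * (- c - 1) = 1 by ring: cE.
have cn0 : c != 0 by apply: contra_eq_neq ci => ->; rewrite mul0r eq_sym oner_eq0.
have cV : c^-1 = - c - 1 by apply: (mulfI cn0); rewrite mulfV.
have c2' := centre_image cn0 fe1 inv c2; rewrite cV in c2'.
have D' : det3 e1 (e2 + ((c - 1) * dot f1 e2) *: e1) e3 != 0.
  by move: D; congr (_ != 0); rewrite /det3 !mxE; ring.
have [_ r _] := centre_pair c2' c3 (det3_indep D').
rewrite dotDl dotZl dotD dotZ in r.
move: r r12 r23 r31; set a12 := dot f1 e2; set a21 := dot f2 e1; set a13 := dot f1 e3.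
set a31 := dot f3 e1; set a23 := dot f2 e3; set a32 := dot f3 e2 => r r12 r23 r31.
transitivity (3 * ((a23 + (- c - 1 - 1) * a21 * a13) * (a32 + (c - 1) * a12 * a31)) -
  3 * (a23 * a32) - (3 * (a12 * a21)) * (3 * (a31 * a13))); first by ring: cE.
by rewrite r r23 r12 r31; ring.
Qed.

(** Let a_ij = f_i(e_j), G = a_12 a_23 a_31 and H = a_13 a_32 a_21. The
    relations of [cyclic_products] for c = om and c = om^2 give G = H = 1/9,
    while those of the three pairs give G H = 1/27. *)
Lemma centres_collinear e1 f1 e2 f2 e3 f3 :
  centre e1 f1 -> centre e2 f2 -> centre e3 f3 -> det3 e1 e2 e3 = 0.
Proof.
move=> c1 c2 c3; apply: NNPP => /eqP D.
have D2 : det3 e3 e1 e2 != 0 by rewrite (_ : det3 e3 e1 e2 = det3 e1 e2 e3) // /det3; ring.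
have [en _ _] := centre_pair c1 c2 (det3_indep D2).
have D3 : det3 e2 e3 e1 != 0 by rewrite (_ : det3 e2 e3 e1 = det3 e1 e2 e3) // /det3; ring.
have [_ r12 _] := centre_pair c1 c2 (det3_indep D2).
have [_ r23 _] := centre_pair c2 c3 (det3_indep D).
have [_ r31 _] := centre_pair c3 c1 (det3_indep D3).
have o2 := cube_root_sum en; have [_ fe1 inv1] := c1.
have o2' : (om * om) ^+ 2 = - (om * om) - 1.
  have -> : (om * om) ^+ 2 = om ^+ 3 * om by ring.
  by have := prim_expr_order prim; rewrite en => ->; rewrite -expr2 o2; ring.
have := cyclic_products c1 c2 c3 D o2 inv1.
have := cyclic_products c1 c2 c3 D o2' (keeps_curveM fe1 inv1 inv1).
set G := dot f1 e2 * _ * _; set H := dot f1 e3 * _ * _; rewrite -expr2 o2 => h2 h1.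
have GH : 27 * (G * H) = 1.
  have -> : 27 * (G * H) = (3 * (dot f1 e2 * dot f2 e1)) * (3 * (dot f2 e3 * dot f3 e2)) *
    (3 * (dot f3 e1 * dot f1 e3)) by rewrite /G /H; ring.
  by rewrite r12 r23 r31 !mulr1.
have n3' : (3 : K) != 0 by apply: (nat_neq0 charK0 (n := 3)).
have sum : 9 * (G + H) = 2.
  have -> : 9 * (G + H) = - (3 * ((om - 1) * G + (- om - 2) * H) +
     3 * ((- om - 1 - 1) * G + (- (- om - 1) - 2) * H)) by ring.
  by rewrite h1 h2; ring.
have o21 : 2 * om + 1 != 0.
  have : (2 * om + 1) ^+ 2 != 0.
    have -> : (2 * om + 1) ^+ 2 = 4 * om ^+ 2 + 4 * om + 1 by ring.
    by rewrite o2 (_ : _ + 1 = - 3) ?oppr_eq0 //; ring.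
  by rewrite expf_eq0.
have eGH : G = H.
  apply/eqP; rewrite -subr_eq0; apply/eqP; apply: (mulfI o21); apply: (mulfI n3').
  rewrite !mulr0; transitivity (3 * ((om - 1) * G + (- om - 2) * H) -
    3 * ((- om - 1 - 1) * G + (- (- om - 1) - 2) * H)); first by ring.
  by rewrite h1 h2 subrr.
have : (8 : K) = 0.
  have -> : (8 : K) = 12 * (27 * (G * H)) - (9 * (G + H)) ^+ 2 by rewrite GH sum; ring.
  by rewrite eGH; ring.
by apply/eqP; apply: (nat_neq0 charK0 (n := 8)).
Qed.

(** The homology at one centre followed by the inverse homology at the other
    one acts on the plane of e and e' as a matrix of trace 0 and determinant 1.
    Its square is - 1, hence (- 1)^d = 1. *)
Lemma pair_even_degree e f e' f' : centre e f -> centre e' f' -> indep e e' -> ~~ odd d.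
Proof.
move=> ce ce' ind; have [en rel _] := centre_pair ce ce' ind.
have o2 := cube_root_sum en.
have [_ fe inv] := ce; have [_ fe' inv'] := ce'.
have inv2 := keeps_curveM fe' inv' inv'.
set a := dot f e' in rel; set b := dot f' e in rel.
have step x y : evf F ((om * x + (om - 1) * a * y) *: e +
    ((1 - om) * b * x - om * y) *: e') = evf F (x *: e + y *: e').
  rewrite -[RHS]inv -[RHS]inv2.
  rewrite !(dotD, dotZ) fe fe' -/a -/b.
  congr (evf F _); apply/rowP => i; rewrite !mxE.
  by ring: o2 rel.
have sym x y : evf F (- (x *: e + y *: e')) = evf F (x *: e + y *: e').
  rewrite -[RHS]step -[RHS]step; congr (evf F _); apply/rowP => i; rewrite !mxE; ring: o2 rel.
have [t nz] := curve_no_line ind.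
apply/negP => od; have := sym 1 t; rewrite scale1r -scaleN1r (evf_scale _ _ hF.1) -signr_odd od.
rewrite mulN1r => /eqP; rewrite eq_sym -addr_eq0 -mulr2n -mulr_natl mulf_eq0 (negPf nz).
by rewrite (negPf (nat_neq0 charK0 (n := 2) _)).
Qed.

End Primitive.

(** If the homology of ratio a at e has order at least 3, then e is a centre
    for a, and so is its image under the homology of ratio om at e'; by
    [centre_pair] the order is 3. An involution is excluded because its product
    with om would have order 6. *)
Lemma centre_acts_roots (om : K) e f e' f' : 3.-primitive_root om ->
  centre om e f -> centre om e' f' -> indep e e' ->
  forall a, acts e a <-> a ^+ 3 = 1.
Proof.
move=> prim ce ce' ind; have n3 : (2 < 3)%N by [].
 have [cve fe inv] := ce; have [_ fe' inv'] := ce'.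
(* For e' as a centre of ratio om, the image of e differs from e. *)
have big_order a N : acts e a -> N.-primitive_root a -> (2 < N)%N -> a ^+ 3 = 1.
  move=> ha pa N3.
  have [g cg] := acts_centre cve (om_neq1 pa N3) ha.
  have cg' := centre_image (om_neq0 prim n3) fe' inv' cg.
  have ind' : indep e (e + ((om - 1) * dot f' e) *: e').
    have k0 : (om - 1) * dot f' e != 0.
      rewrite mulf_neq0 ?subr_eq0 ?(om_neq1 prim n3) //.
      exact: (centre_off_axis prim n3 ce' ce (indep_sym ind)).
    move=> x y; rewrite scalerDr scalerA addrA -scalerDl => /ind [xy /eqP].
    by rewrite mulf_eq0 (negPf k0) orbF => /eqP y0; rewrite y0 addr0 in xy.
  have [eN _ _] := centre_pair pa N3 cg cg' ind'.
  by rewrite -(prim_expr_order pa) eN.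
have finite_order a : acts e a -> exists2 N, (0 < N)%N & N.-primitive_root a.
  move=> /(acts_root1 cve) h.
  have d1 : (0 < d.-1)%N by move: hd; lia.
  by have [N pN _] := prim_order_exists d1 h; exists N => //; apply: prim_order_gt0 pN.
move=> a; split=> [ha|a3]; last first.
  have [k ->] := prim_rootP prim a3.
  by apply: acts_exp; apply: centre_acts ce.
have [N N0 pN] := finite_order a ha.
case: (ltnP 2 N) => [N3|N2]; first exact: big_order pN N3.
have a2 : a ^+ 2 = 1.
  by case: N N0 N2 pN => [|[|[|N]]] // _ _ /prim_expr_order; rewrite ?expr1 => ->; rewrite ?expr1n.
have hao : acts e (a * om) by apply: actsM ha (centre_acts ce).
have [N' N'0 pN'] := finite_order _ hao.
have o3 := prim_expr_order prim.
case: (ltnP 2 N') => [N3|N'2].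
  by have := big_order _ _ hao pN' N3; rewrite exprMn o3 mulr1.
have ao2 : (a * om) ^+ 2 = 1.
  by case: N' N'0 N'2 pN' => [|[|[|k]]] // _ _ /prim_expr_order; rewrite ?expr1 => ->; rewrite ?expr1n.
move: ao2; rewrite exprMn a2 mul1r => o2.
by have := om_neq1 prim n3; rewrite -o3 exprS o2 mulr1 eqxx.
Qed.

(** * Counting the points *)

Definition counted n P : Prop :=
  [/\ point_on_curve F P, quasi_galois F P & G_order F P n].

Lemma counted_centre n P : (2 < n)%N -> counted n P ->
  exists e, [/\ on_curve F e, sval P = <[e]>%VS & forall om : K, n.-primitive_root om ->
    exists f, centre om e f].
Proof.
move=> n3 [cP _ GP]; have [e en0 eP] := point_vector P.
have ce : on_curve F e by apply/(point_on_curveP en0 eP).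
have n0 : (0 < n)%N := ltnW (ltnW n3).
have [_ _ h] := G_order_roots n0 ce eP GP.
exists e; split=> // om pom; apply: (acts_centre ce (om_neq1 pom n3)).
by apply/h; apply: prim_expr_order.
Qed.

Lemma centre_counted (om : K) P e f e' f' : 3.-primitive_root om -> sval P = <[e]>%VS ->
  centre om e f -> centre om e' f' -> indep e e' -> counted 3 P.
Proof.
move=> pom eP ce ce' ind; have [cve _ _] := ce.
have h := centre_acts_roots pom ce ce' ind.
have G3 := roots_G_order cve eP pom h.
split=> //; last exact: G_order_quasi_galois G3.
by apply/(point_on_curveP cve.1 eP).
Qed.

Lemma line_eq v w : v != 0 -> <[v]>%VS = <[w]>%VS -> exists2 k, k != 0 & v = k *: w.
Proof.
move=> vn0 e; have : v \in <[w]>%VS by rewrite -e memv_line.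
case/vlineP => k ev; exists k => //.
by apply: contraNneq vn0 => k0; rewrite ev k0 scale0r.
Qed.

(** A common primitive n-th root of unity acts at both points. By [centre_pair]
    their line contains exactly four centres, and by [centres_collinear] there
    is no other one; by [centre_acts_roots] all four are counted. Moreover d is
    even and 3 divides d - 1. *)
Theorem two_counted_points n P Q : (2 < n)%N -> counted n P -> counted n Q -> P <> Q ->
  [/\ n = 3%N, exists m, d = (6 * m + 4)%N & delta_eq F n 4].
Proof.
move=> n3 cP cQ PQ.
have [e [cve eP hP]] := counted_centre n3 cP; have [e' [cve' eQ hQ]] := counted_centre n3 cQ.
have [om pom] : exists om : K, n.-primitive_root om.
  have [_ _ GP] := cP; have n0 : (0 < n)%N := ltnW (ltnW n3).
  by have [om pom _] := G_order_roots n0 cve eP GP; exists om.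
have [f ce] := hP _ pom; have [f' ce'] := hQ _ pom.
have ind : indep e e'.
  apply: indep_scale cve.1 _ => k ek; apply: PQ; apply: point_eq; rewrite eP eQ ek.
  have kn0 : k != 0 by apply: contraTneq cve'.1 => k0; rewrite ek k0 scale0r eqxx.
  by rewrite line_scale.
have [en _ [T [uT szT] hT]] := centre_pair pom n3 ce ce' ind.
have evd := pair_even_degree pom n3 ce ce' ind.
have dvd := centre_order_dvd pom ce.
subst n; split=> //.
  exists ((d - 4) %/ 6)%N; move: dvd evd hd; clear.
  move=> /dvdnP [k ek] evd hd; have ed : d = (3 * k + 1)%N by lia.
  by move: evd hd; rewrite ed; lia.
set r := e' - dot f e' *: e in hT.
have er : indep e r by rewrite /r -scaleNr; apply: indep_combo.
have re' : r + dot f e' *: e = e' by rewrite /r subrK.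
clearbody r.
pose vs := e :: [seq r + t *: e | t <- T].
have vs_centre v : v \in vs -> exists g, centre om v g.
  by rewrite in_cons => /predU1P [->|/mapP [t /hT [g cg] ->]]; [exists f | exists g].
have vs0 v : v \in vs -> v != 0 by case/vs_centre => g [[]].
have [pt hpt] := seq_choice P (fun v vv => vector_point (vs0 v vv)).
have e_t t k : e <> k *: (r + t *: e).
  move=> /eqP; rewrite eq_sym -subr_eq0 => /eqP h.
  have [|kt k0] := er (k * t - 1) k.
    by rewrite -[RHS]h; apply/rowP => i; rewrite !mxE; ring.
  by move/eqP: kt; rewrite k0 mul0r sub0r oppr_eq0 oner_eq0.
have vs_inj v w : v \in vs -> w \in vs -> <[v]>%VS = <[w]>%VS -> v = w.
  move=> vv ww; have v0 := vs0 v vv; have w0 := vs0 w ww; move: vv ww.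
  rewrite !in_cons => /predU1P [->|/mapP [t tT ->]] /predU1P [->|/mapP [u uT' ->]] // h.
  - by case: (line_eq cve.1 h) => k _ /e_t.
  - by case: (line_eq cve.1 (esym h)) => k _ /e_t.
  have rn0 : r + t *: e != 0 by apply: vs0; rewrite in_cons (map_f _ tT) orbT.
  have [k _ ek] := line_eq rn0 h.
  have [|t_ku k1] := er (t - k * u) (1 - k).
    move/eqP: ek; rewrite -subr_eq0 => /eqP ek; rewrite -[RHS]ek.
    by apply/rowP => i; rewrite !mxE; ring.
  have {}k1 : k = 1 by apply/eqP; rewrite eq_sym -subr_eq0 k1.
  by congr (_ + _ *: e); apply/eqP; rewrite -subr_eq0 -t_ku k1 mul1r.
exists [seq pt v | v <- vs]; split.
- rewrite map_inj_in_uniq /=; last first.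
    move=> v w vv ww h; apply: vs_inj => //.
    by rewrite -(hpt v vv) -(hpt w ww) h.
  rewrite map_inj_uniq ?uT ?andbT; last first.
    by move=> t u /addrI /eqP; rewrite -subr_eq0 -scalerBl scaler_eq0 (negPf cve.1) orbF subr_eq0 => /eqP.
  by apply/mapP => -[t tT et]; apply: (e_t t 1); rewrite scale1r.
- by rewrite size_map /= size_map szT.
move=> R; split.
  case/mapP => v vv ->; have [g cg] := vs_centre v vv.
  have /predU1P [ev|/mapP [t tT ev]] := vv.
    rewrite ev in vv *; exact: (centre_counted pom (hpt e vv) ce ce' ind).
  apply: (centre_counted pom (hpt v vv) cg ce).
  by rewrite ev; apply/indep_sym/indep_combo.
move=> cR; have [w [cw eR hR]] := counted_centre n3 cR.
have [g cg] := hR _ pom.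
have D : det3 e e' w = 0 by apply: (centres_collinear pom n3 ce ce' cg).
have [a [b ew]] := indep_span ind D.
suff [v vv ev] : exists2 v, v \in vs & <[w]>%VS = <[v]>%VS.
  by apply/mapP; exists v => //; apply: point_eq; rewrite (hpt v vv) eR.
have [b0|bn0] := eqVneq b 0.
  exists e; first exact: mem_head.
  rewrite ew b0 scale0r addr0 line_scale //.
  by apply: contraTneq cw.1 => a0; rewrite ew a0 b0 !scale0r addr0 eqxx.
pose t := dot f e' + a / b.
have bw : b^-1 *: w = r + t *: e.
  by rewrite ew -re'; apply/rowP => i; rewrite /t !mxE; field.
exists (r + t *: e); last by rewrite -bw line_scale ?invr_neq0.
rewrite in_cons; apply/orP; right; apply/map_f/hT.
by exists (b^-1^-1 *: g); rewrite -bw; apply: (centre_scale); rewrite ?invr_neq0.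
Qed.

End SmoothCurve.

Theorem theorem3p4 (K : closedFieldType) (charK0 : [pchar K] =i pred0)
    (d : nat) (hd : (4 <= d)%N) (F : {mpoly K[3]})
    (hF : smooth_plane_curve d F) (n : nat) (hn : (3 <= n)%N) :
  (delta_eq F n 0 \/ delta_eq F n 1 \/ delta_eq F n 4) /\
  (delta_eq F n 4 -> n = 3%N /\ exists m : nat, d = (6 * m + 4)%N).
Proof.
have two P Q := two_counted_points charK0 hd hF (P := P) (Q := Q) hn.
split; last first.
  case=> [[|P [|Q s]]] [us // sz hs].
  have [hP hQ] : counted F n P /\ counted F n Q.
    by split; apply/hs; rewrite !in_cons eqxx ?orbT.
  have [|? ? _] // := two P Q hP hQ.
  by move=> PQ; move: us; rewrite PQ /= mem_head.
have [[P [Q [hP hQ PQ]]]|no2] := classic (exists P Q, [/\ counted F n P, counted F n Q & P <> Q]).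
  by have [_ _ h4] := two P Q hP hQ PQ; right; right.
have [[P hP]|no1] := classic (exists P, counted F n P); last first.
  by left; exists [::]; split=> // P; split=> // hP; case: no1; exists P.
right; left; exists [:: P]; split=> // Q; rewrite mem_seq1; split=> [/eqP->|hQ] //.
by apply/eqP; apply: NNPP => QP; apply: no2; exists Q, P.
Qed.
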